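(* Let $y_0>0$, $a>0$, $\sigma>0$ with $2a\ge\sigma^2$, and let $Y$ be the unique non-negative strong solution (squared Bessel process) of $$Y(t) = y_0 + a t + \sigma \int_0^t \sqrt{Y(s)}\,dW_s,\qquad t\ge 0.$$ Let $(b_n)_{n\ge1}$ be a sequence of non-negative numbers with $b_n\downarrow0$ as $n\to\infty$, and for $n\ge1$ let $Y_n$ be the unique non-negative strong solution of $$Y_n(t) = y_0 + \int_0^t (a - b_n Y_n(s))\,ds + \sigma \int_0^t \sqrt{Y_n(s)}\,dW_s,\qquad t\ge0,$$ with the same Wiener process $W$. Let $\{T_n,n\ge1\}$ be a sequence of positive numbers such that $$T_n \to \infty \quad\text{and}\quad e^{b_n T_n}\, b_n T_n^2 \to 0 \qquad\text{as } n\to\infty.$$ Then $$\sup_{t\in[0,T_n]} \mathbf E \left|Y_n(t) - Y(t)\right| \to 0, \qquad n\to\infty.$$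
   Context: $W=\{W_t,t\ge0\}$ is a Wiener process on a probability space $(\Omega,\mathcal F,\mathbf P)$ and $\mathbf E$ is expectation with respect to $\mathbf P$. *)

(* Defs.v *)
From HB Require Import structures.
From mathcomp Require Import all_boot all_order all_algebra.
From mathcomp Require Import all_classical all_reals all_analysis.

Set Implicit Arguments.
Unset Strict Implicit.
Unset Printing Implicit Defensive.
Import Order.TTheory GRing.Theory Num.Theory.
Import numFieldNormedType.Exports.

Local Open Scope classical_set_scope.
Local Open Scope ring_scope.

(* Processes are indexed by all of R, but only times t >= 0 are ever constrained. *)

Section stochastic_integral.
Context {R : realType} {d : measure_display} {Omega : measurableType d}.
Variable P : probability Omega R.
Implicit Types (X I : R -> Omega -> R) (F : R -> set (set Omega)).

Definition natural_filtration X (t : R) : set (set Omega) :=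
  <<s \bigcup_(s in `[0, t]) preimage_set_system setT (X s) measurable >>.

Definition augmented_filtration X (t : R) : set (set Omega) :=
  <<s natural_filtration X t `|` [set N | measurable N /\ P N = 0%E] >>.

Definition continuous_paths X : Prop :=
  {ae P, forall w, {within `[0, +oo[, continuous (fun t => X t w)}}.

Definition wiener_process (W : R -> {RV P >-> R}) : Prop :=
  [/\ {ae P, forall w, W 0 w = 0},
      forall s t, 0 <= s -> s < t -> forall A B,
        natural_filtration W s A -> measurable B ->
        P (A `&` (W t \- W s)%R @^-1` B) = (P A * P ((W t \- W s)%R @^-1` B))%E,
      forall s t, 0 <= s -> s < t -> forall B, measurable B ->
        pushforward P (W t \- W s) B = normal_prob 0 (Num.sqrt (t - s)) B
    & continuous_paths W].

Definition sub_measurable (G : set (set Omega)) (xi : Omega -> R) : Prop :=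
  forall B : set R, measurable B -> G (xi @^-1` B).

Definition adapted F X : Prop := forall t, 0 <= t -> sub_measurable (F t) (X t).

(* The outer measure of P is used because the events below need not be
   measurable: P is not assumed complete, and paths are only regular almost
   surely.  On measurable events it coincides with P. *)
Definition cvg0_in_probability (X : nat -> Omega -> \bar R) : Prop :=
  forall e : R, 0 < e ->
    (fun k => mu_ext P [set w | (e%:E <= X k w)%E]) @ \oo --> 0%E.

(* coef_0, ..., coef_{m-1} on the intervals ]time_i, time_{i+1}] *)
Record simple_process := SimpleProcess {
  sp_size : nat;
  sp_time : nat -> R;
  sp_coef : nat -> Omega -> R }.

Definition simple_on F (t : R) (h : simple_process) : Prop :=
  [/\ sp_time h 0 = 0,
      sp_time h (sp_size h) = t
    & forall i, (i < sp_size h)%N ->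
        [/\ sp_time h i <= sp_time h i.+1,
            sub_measurable (F (sp_time h i)) (sp_coef h i)
          & exists M, forall w, `|sp_coef h i w| <= M]].

Definition simple_value (h : simple_process) (s : R) (w : Omega) : R :=
  \sum_(i < sp_size h) sp_coef h i w * \1_(`]sp_time h i, sp_time h i.+1]) s.

Definition simple_integral W (h : simple_process) (w : Omega) : R :=
  \sum_(i < sp_size h)
    sp_coef h i w * (W (sp_time h i.+1) w - W (sp_time h i) w).

(* Z is (a version of) the Ito integral of H over [0, t] with respect to W, for
   an adapted H that is almost surely square integrable on [0, t]. *)
Definition ito_integral (W : R -> {RV P >-> R}) (t : R) (H : R -> Omega -> R)
    (Z : Omega -> R) : Prop :=
  [/\ adapted (augmented_filtration W) H,
      {ae P, forall w, measurable_fun `[0, t] (fun s => H s w)},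
      {ae P, forall w,
        (\int[lebesgue_measure]_(s in `[0%R, t]) ((H s w) ^+ 2)%:E < +oo)%E}
    & exists h : nat -> simple_process,
        [/\ forall k, simple_on (augmented_filtration W) t (h k),
            cvg0_in_probability (fun k w =>
              (\int[lebesgue_measure]_(s in `[0%R, t])
                 ((simple_value (h k) s w - H s w) ^+ 2)%:E)%E)
          & cvg0_in_probability (fun k w =>
              `|simple_integral W (h k) w - Z w|%:E)]].

Definition ito_integral_process (W : R -> {RV P >-> R}) H I : Prop :=
  [/\ adapted (augmented_filtration W) I,
      continuous_paths I
    & forall t, 0 <= t -> ito_integral W t H (I t)].

(* X is a non-negative strong solution of
     X(t) = x0 + A(t) + sigma * \int_0^t sqrt (X s) dW_s,   t >= 0;
   the finite variation part A may itself be computed from X. *)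
Definition nonneg_strong_solution (W : R -> {RV P >-> R}) (x0 sigma : R)
    (A : R -> Omega -> R) X : Prop :=
  [/\ adapted (augmented_filtration W) X,
      continuous_paths X,
      {ae P, forall w, forall t, 0 <= t -> 0 <= X t w}
    & exists2 I, ito_integral_process W (fun s w => Num.sqrt (X s w)) I
        & {ae P, forall w, forall t, 0 <= t ->
             X t w = x0 + A t w + sigma * I t w}].

End stochastic_integral.

(* Main.v *)
Require Import Defs.
From HB Require Import structures.
From mathcomp Require Import all_boot all_order all_algebra.
From mathcomp Require Import all_classical all_reals all_analysis.
From mathcomp Require Import measurable_realfun.
From mathcomp Require Import ring lra.
Import Order.TTheory GRing.Theory Num.Theory.
Import numFieldNormedType.Exports.
Local Open Scope classical_set_scope.
Local Open Scope ring_scope.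

Set Implicit Arguments.
Unset Strict Implicit.
Unset Printing Implicit Defensive.

(* Both Y and D = Y_n - Y solve an equation dD = alpha dt + beta dW with
   beta^2 <= sigma^2 |D| and alpha D <= gamma |D|, where gamma = a for Y and
   gamma = b_n Y for the difference (because -b_n Y_n has the wrong sign when
   Y_n > Y).  The Yamada-Watanabe argument then gives
   E |D_t| <= |D_0| + t sup_{s <= t} E gamma_s: test functions f close to |x|
   with f''(x) |x| small make the second-order term of Ito's formula vanish.
   Hence E Y_s <= y0 + a s and E |Y_n(t) - Y(t)| <= t b_n (y0 + a t), which is
   at most (y0 + a) b_n T_n^2 on [0, T_n] as soon as T_n >= 1.

   Ito's formula is replaced by a Taylor expansion along an Euler scheme.  The
   scheme is uniformly close to D in probability by Lenglart's inequality
   P(|int H dW| >= e) <= P(int H^2 ds > d) + C d / e^2, which passes from simple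
   integrands to the Ito integral by definition of the latter. *)

(** * Smooth approximation of the absolute value *)

(** At the start nothing is known about moments of [D]: its noise is an Ito integral, given only as
    a limit in probability of simple integrals, so neither an isometry nor a martingale property is
    at hand for it. Expectations of [D] are therefore taken only through bounded functions: the test
    functions are capped as F = f / (1 + eta f), and eta is sent to 0 by monotone convergence at the
    very end. Two Euler schemes divide the work. The one with coefficients clipped at the level m of
    the mesh is close to [D], because clipping becomes inactive as m grows, but its Taylor remainder
    depends on m. The one stopped when a coefficient exceeds a fixed N has a remainder of order
    sqrt(t/m) with a constant free of m. They coincide up to the stopping, which is improbable for
    large N. So N is chosen first, then the closeness r, and last m. Gaussian moments enter only up
    to the constant 130: the isometry serves as an inequality, and the second-order term is made
    small by the choice of f whatever factor it carries. *)

Section smooth_absolute_value.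
Context {R : realType}.
Implicit Types x y h dl : R.

(** Boundedness makes a test function integrable along any measurable process; the Lipschitz bound
    lets its argument be moved from the Euler scheme to [D]. *)
Definition lipb (g : R -> R) : Prop := exists2 K : R, 0 <= K &
  (forall x, `|g x| <= K) /\ (forall x y, `|g x - g y| <= K * `|x - y|).

Lemma lipb_cst (c : R) : lipb (fun=> c).
Proof.
exists `|c| => //; split => // x y.
by rewrite subrr normr0 mulr_ge0.
Qed.

Lemma lipbD (f g : R -> R) : lipb f -> lipb g -> lipb (fun x => f x + g x).
Proof.
move=> [K K0 [Kb KL]] [L L0 [Lb LL]]; exists (K + L); first exact: addr_ge0.
split=> [x|x y]; first by rewrite (le_trans (ler_normD _ _))// lerD.
rewrite (_ : _ - _ = (f x - f y) + (g x - g y)); last by ring.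
by rewrite (le_trans (ler_normD _ _))// mulrDl lerD.
Qed.

Lemma lipbM (f g : R -> R) : lipb f -> lipb g -> lipb (fun x => f x * g x).
Proof.
move=> [K K0 [Kb KL]] [L L0 [Lb LL]].
exists (K * L + K * L); first by rewrite addr_ge0 ?mulr_ge0.
split=> [x|x y].
  rewrite normrM (@le_trans _ _ (K * L))//; first by rewrite ler_pM.
  by rewrite lerDl mulr_ge0.
rewrite (_ : _ - _ = (f x - f y) * g x + f y * (g x - g y)); last by ring.
rewrite (le_trans (ler_normD _ _))// !normrM mulrDl lerD//.
  by rewrite mulrAC ler_pM.
by rewrite -mulrA ler_pM.
Qed.

Lemma lipb_sum (I : finType) (f : I -> R -> R) : (forall i, lipb (f i)) ->
  lipb (fun x => \sum_i f i x).
Proof.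
move=> lf; rewrite unlock; elim: index_enum => [|i s IH] /=.
  exact: lipb_cst.
exact: lipbD.
Qed.

(** 1/u - 1/v = (v - u) / (u v), where 1/u and 1/v are at most 1; the constant 1 + L covers the
    bound and the slope. *)
Lemma lipb_inv_ge1 (u : R -> R) (L : R) : 0 <= L -> (forall x, 1 <= u x) ->
  (forall x y, `|u x - u y| <= L * `|x - y|) -> lipb (fun x => (u x)^-1).
Proof.
move=> L0 u1 uL; exists (1 + L); first by rewrite addr_ge0.
have u0 x : 0 < u x by rewrite (lt_le_trans _ (u1 x)).
split=> [x|x y].
  rewrite gtr0_norm ?invr_gt0// (@le_trans _ _ 1) ?lerDl//.
  by rewrite invf_le1.
rewrite (_ : _ - _ = (u x)^-1 * (u y)^-1 * (u y - u x)); last first.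
  by field; rewrite !gt_eqF.
rewrite normrM distrC.
apply: (@le_trans _ _ (1 * (L * `|x - y|))); last first.
  by rewrite mul1r ler_wpM2r// lerDr.
apply: ler_pM => //; rewrite gtr0_norm ?mulr_gt0 ?invr_gt0//.
by rewrite mulr_ile1 ?invr_ge0 ?invf_le1// ltW.
Qed.

(** A smoothing of |x| at scale [dl]. Its first two derivatives are x / psi and dl^2 / psi^3, the
    coefficients that recur below. *)
Definition psi dl x : R := Num.sqrt (x ^+ 2 + dl ^+ 2).

Section psi.
Variable dl : R.
Hypothesis dl0 : 0 < dl.

Lemma psi_sqr x : psi dl x ^+ 2 = x ^+ 2 + dl ^+ 2.
Proof. by rewrite sqr_sqrtr// addr_ge0// sqr_ge0. Qed.

Lemma psi_ge_norm x : `|x| <= psi dl x.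
Proof. by rewrite -sqrtr_sqr ler_wsqrtr// lerDl sqr_ge0. Qed.

Lemma psi_ge x : dl <= psi dl x.
Proof. by rewrite -[leLHS]gtr0_norm// -sqrtr_sqr ler_wsqrtr// lerDr sqr_ge0. Qed.

Lemma psi_gt0 x : 0 < psi dl x.
Proof. by rewrite (lt_le_trans dl0)// psi_ge. Qed.

Lemma psi_le x : psi dl x <= `|x| + dl.
Proof.
rewrite -ler_sqr ?nnegrE ?(ltW (psi_gt0 _))//; last by rewrite addr_ge0// ltW.
rewrite psi_sqr; have := real_normK (num_real x).
have := mulr_ge0 (normr_ge0 x) (ltW dl0); nra.
Qed.

Lemma psi_lip x y : `|psi dl x - psi dl y| <= `|x - y|.
Proof.
have sx := psi_gt0 x; have sy := psi_gt0 y.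
have s0 : 0 < psi dl x + psi dl y by rewrite addr_gt0.
rewrite -(ler_pM2r s0) -[X in _ * X <= _](gtr0_norm s0) -normrM.
rewrite (_ : _ * _ = (x - y) * (x + y)); last first.
  have := psi_sqr x; have := psi_sqr y; nra.
rewrite normrM ler_wpM2l// (le_trans (ler_normD _ _))// lerD//; exact: psi_ge_norm.
Qed.

(** Algebra replaces calculus: with s, s' the values at x, x + h and e = s' - s, one has e (s + s')
    = h (2 x + h), so the remainder is an explicit fraction. Divided by h^2, its two pieces are at
    most 2 |h| / dl^2 and 3/2 |h| / dl^2, hence the constant 4. *)
Lemma psi_taylor x h : psi dl (x + h) <= psi dl x + x / psi dl x * h +
  dl ^+ 2 / psi dl x ^+ 3 * (h ^+ 2 / 2) + 4 / dl ^+ 2 * `|h| ^+ 3.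
Proof.
have := psi_sqr x; have := psi_sqr (x + h).
have := psi_gt0 x; have := psi_gt0 (x + h).
have := psi_ge x; have := psi_ge (x + h).
have := psi_lip (x + h) x; have := psi_ge_norm x.
rewrite [x + h - x]addrAC subrr add0r.
set s := psi dl x; set s' := psi dl (x + h).
move=> xs ehh ds' ds s'0 s0 s'2 s2.
have ss0 : 0 < s + s' by rewrite addr_gt0.
pose e := s' - s.
have sN : s != 0 by rewrite gt_eqF.
have ssN : s + s' != 0 by rewrite gt_eqF.
(* Using e (s + s') = h (2 x + h) twice gives e - x h / s = h^2 (2 dl^2 + s e - x h) / (s (s +
   s')^2). [A] is the part with s e - x h; [B] is the error made in replacing 2 dl^2 / (s (s +
   s')^2) by its value dl^2 / (2 s^3) at s' = s. *)
pose A := (s * e - x * h) / (s * (s + s') ^+ 2).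
pose B := (s ^+ 2 - x ^+ 2) * (- e * (4 * s + e)) / (2 * s ^+ 3 * (s + s') ^+ 2).
have key : s' = s + x / s * h + dl ^+ 2 / s ^+ 3 * (h ^+ 2 / 2) + h ^+ 2 * (A + B).
  have eE : e = (2 * x * h + h ^+ 2) / (s + s').
    apply: (mulIf ssN); rewrite mulfVK// /e.
    nra.
  have dE : dl ^+ 2 = s ^+ 2 - x ^+ 2 by rewrite s2; ring.
  have -> : s' = s + e by rewrite /e; ring.
  have hE : h ^+ 2 = e * (s + s') - 2 * x * h.
    by rewrite eE mulfVK//; ring.
  have s'E : s' = s + e by rewrite /e; ring.
  rewrite dE /A /B s'E.
  have seN : s + (s + e) != 0 by rewrite -s'E.
  rewrite s'E in hE.
  have -> : s + x / s * h + (s ^+ 2 - x ^+ 2) / s ^+ 3 * (h ^+ 2 / 2) +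
   h ^+ 2 *
   ((s * e - x * h) / (s * (s + (s + e)) ^+ 2) +
    (s ^+ 2 - x ^+ 2) * (- e * (4 * s + e)) /
    (2 * s ^+ 3 * (s + (s + e)) ^+ 2)) =
   s + x / s * h + h ^+ 2 * (2 * (s ^+ 2 - x ^+ 2) + s * e - x * h) / (s * (s + (s + e)) ^+ 2).
    by field; rewrite seN sN.
  have : h ^+ 2 * (2 * (s ^+ 2 - x ^+ 2) + s * e - x * h) =
     (s + (s + e)) ^+ 2 * (s * e - x * h).
    have -> : 2 * (s ^+ 2 - x ^+ 2) + s * e - x * h = s * (s + (s + e)) - x * (2 * x + h) by ring.
    have -> : (s + (s + e)) ^+ 2 * (s * e - x * h) = (s + (s + e)) * (s * (e * (s + (s + e))) - x * h * (s + (s + e))) by ring.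
    have -> : e * (s + (s + e)) = 2 * x * h + h ^+ 2 by rewrite hE; ring.
    have e2 : e * (s + (s + e)) = h * (2 * x + h) by rewrite [RHS]mulrDr -expr2 hE; ring.
    have -> : (s + (s + e)) * (s * (2 * x * h + h ^+ 2) - x * h * (s + (s + e))) =
      h * ((s + (s + e)) * s * (2 * x + h) - x * (s + (s + e)) ^+ 2) by ring.
    have e3 : (s + (s + e)) ^+ 2 = 2 * s * (s + (s + e)) + h * (2 * x + h) by rewrite -e2; ring.
    rewrite e3; ring.
  move=> ->.
  by field; rewrite seN sN.
rewrite {1}key lerD2l.
have d20 : 0 < dl ^+ 2 by rewrite exprn_gt0.
have hA : `|A| <= 2 * `|h| / dl ^+ 2.
  rewrite /A normrM normfV [X in _ / X <= _]gtr0_norm; last by rewrite mulr_gt0// exprn_gt0.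
  have n1 : `|s * e - x * h| <= 2 * s * `|h|.
    rewrite (le_trans (ler_normB _ _))// !normrM (gtr0_norm s0).
    rewrite -mulrA mulr_natl mulr2n lerD//; first by rewrite ler_wpM2l// ltW.
    by rewrite ler_wpM2r.
  rewrite ler_pdivrMr; last by rewrite mulr_gt0// exprn_gt0.
  apply: (le_trans n1).
  rewrite [leRHS](_ : _ = 2 * s * `|h| * (((s + s') ^+ 2) / dl ^+ 2)); last first.
    by field; rewrite gt_eqF.
  rewrite ler_peMr ?mulr_ge0 ?(ltW s0)//.
  by rewrite ler_pdivlMr// mul1r ler_sqr ?nnegrE ?ltW//; lra.
have hB : `|B| <= 3 / 2 * `|h| / dl ^+ 2.
  have e4 : - s < e by rewrite /e; lra.
  rewrite /B normrM normfV [X in _ / X <= _]gtr0_norm; last by rewrite !mulr_gt0// exprn_gt0.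
  rewrite ler_pdivrMr; last by rewrite !mulr_gt0// exprn_gt0.
  have s4 : 0 <= 4 * s + e by lra.
  rewrite !normrM normrN (ger0_norm s4).
  have -> : `|s ^+ 2 - x ^+ 2| = dl ^+ 2 by rewrite s2 addrAC subrr add0r gtr0_norm.
  have n2 : dl ^+ 2 * (`|e| * (4 * s + e)) <= s ^+ 2 * (`|h| * (3 * (s + s'))).
    apply: ler_pM; [exact: sqr_ge0|exact: mulr_ge0| |].
      by rewrite ler_sqr ?nnegrE ?(ltW dl0) ?(ltW s0).
    by apply: ler_pM => //; rewrite /e; lra.
  apply: (le_trans n2).
  rewrite [leRHS](_ : _ = s ^+ 2 * (`|h| * (3 * (s + s'))) * (s * (s + s') / dl ^+ 2)); last first.
    by field; rewrite gt_eqF.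
  have ssp : 0 <= s ^+ 2 * (`|h| * (3 * (s + s'))).
    apply: mulr_ge0; first exact: sqr_ge0.
    by rewrite !mulr_ge0// ltW.
  rewrite ler_peMr//.
  by rewrite ler_pdivlMr// mul1r expr2 ler_pM ?(ltW dl0)//; lra.
have -> : 4 / dl ^+ 2 * `|h| ^+ 3 = h ^+ 2 * (4 * `|h| / dl ^+ 2).
  by rewrite -(@real_normK _ h) ?num_real//; field; rewrite gt_eqF.
rewrite ler_wpM2l ?sqr_ge0//.
rewrite (le_trans (ler_norm _))// (le_trans (ler_normD _ _))//.
apply: (le_trans (lerD hA hB)).
have t0 : 0 <= `|h| / dl ^+ 2 by rewrite divr_ge0// ltW.
rewrite -!mulrA; lra.
Qed.

Lemma lipb_psi_inv : lipb (fun x => (psi dl x)^-1).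
Proof.
have -> : (fun x => (psi dl x)^-1) = (fun x => dl^-1 * (psi dl x / dl)^-1).
  by apply/funext => x; field; rewrite !gt_eqF// psi_gt0.
apply: lipbM; first exact: lipb_cst.
apply: (@lipb_inv_ge1 _ dl^-1); first by rewrite invr_ge0 ltW.
  by move=> x; rewrite ler_pdivlMr// mul1r psi_ge.
move=> x y; rewrite -mulrBl normrM mulrC (gtr0_norm (x := dl^-1)) ?invr_gt0//.
by rewrite ler_pM2l ?invr_gt0// psi_lip.
Qed.

(** The factor x is unbounded, so [lipbM] does not apply; the difference is rearranged so that only
    the bounded quotient y / psi y and the 1-Lipschitz psi occur. *)
Lemma lipb_psi1 : lipb (fun x => x / psi dl x).
Proof.
exists (1 + 2 / dl); first by rewrite addr_ge0// divr_ge0// ltW.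
have n1 x : `|x / psi dl x| <= 1.
  by rewrite normrM normfV (gtr0_norm (psi_gt0 x)) ler_pdivrMr ?psi_gt0// mul1r psi_ge_norm.
split=> [x|x y].
  by rewrite (le_trans (n1 x))// lerDl divr_ge0// ltW.
have sx := psi_gt0 x; have sy := psi_gt0 y.
rewrite (_ : _ - _ = (psi dl x)^-1 * ((x - y) + (y / psi dl y) * (psi dl y - psi dl x))); last first.
  by field; rewrite !gt_eqF.
rewrite normrM gtr0_norm ?invr_gt0//.
have : `|x - y + y / psi dl y * (psi dl y - psi dl x)| <= 2 * `|x - y|.
  rewrite (le_trans (ler_normD _ _))// [leRHS]mulr_natl mulr2n lerD2l normrM.
  rewrite -[leRHS]mul1r ler_pM// distrC; exact: psi_lip.
move=> h2; apply: (@le_trans _ _ (dl^-1 * (2 * `|x - y|))).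
  by rewrite ler_pM// ?invr_ge0 ?(ltW sx)// lef_pV2// psi_ge.
by rewrite mulrA [dl^-1 * _]mulrC ler_wpM2r// lerDr.
Qed.

(** Halving the scale makes the right side a difference of consecutive terms, so that it telescopes
    over dyadic scales. With r, s the values at scales dl/2 and dl, s^2 - r^2 = 3/4 dl^2, and after
    cancelling s - r the claim becomes r (s + r) <= 3 s^2, which follows from r <= s. *)
Lemma psi_telescope x : dl ^+ 2 / psi dl x ^+ 3 * `|x| <=
  4 * (`|x| / psi (dl / 2) x - `|x| / psi dl x).
Proof.
rewrite -mulrBr mulrC [leRHS]mulrCA ler_wpM2l//.
have sA := psi_gt0 x.
have := psi_sqr x.
have : psi (dl / 2) x ^+ 2 = x ^+ 2 + (dl / 2) ^+ 2.
  by rewrite sqr_sqrtr// addr_ge0// sqr_ge0.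
have : 0 < psi (dl / 2) x.
  by rewrite sqrtr_gt0 ltr_wpDl ?sqr_ge0// exprn_gt0// divr_gt0.
move: sA; set s := psi dl x; set r := psi (dl / 2) x => s0 r0 r2 s2.
have rs : r <= s.
  rewrite -ler_sqr ?nnegrE ?(ltW r0) ?(ltW s0)// r2 s2 lerD2l.
  nra.
have d2 : dl ^+ 2 = 4 / 3 * (s - r) * (s + r).
  have -> : 4 / 3 * (s - r) * (s + r) = 4 / 3 * (s ^+ 2 - r ^+ 2) by ring.
  by rewrite r2 s2; field.
rewrite d2.
have -> : 4 / 3 * (s - r) * (s + r) / s ^+ 3 = (s - r) * (4 / 3 * (s + r) / s ^+ 3).
  by field; rewrite gt_eqF.
have -> : 4 * (r^-1 - s^-1) = (s - r) * (4 / (r * s)) by field; rewrite !gt_eqF.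
rewrite ler_wpM2l ?subr_ge0//.
rewrite ler_pdivrMr ?exprn_gt0//.
have -> : 4 / (r * s) * s ^+ 3 = 4 * (s * s) / r by field; rewrite !gt_eqF.
rewrite ler_pdivlMr//; nra.
Qed.

End psi.

(* f is the average of the k functions psi (2^-j), j < k: by psi_telescope the
   second derivatives, multiplied by |x|, telescope to at most 4, hence the bound
   q x * |x| <= 4 / k. *)
Lemma smooth_abs (e : R) : 0 < e -> exists f p q : R -> R, exists2 K : R, 0 <= K &
  [/\ forall x, `|x| <= f x <= `|x| + e,
      forall x, [/\ `|p x| <= 1, 0 <= p x * x & p 0 = 0],
      forall x, 0 <= q x /\ q x * `|x| <= e,
      (forall x y, `|f x - f y| <= `|x - y|) /\ lipb p /\ lipb q &
      forall x h, f (x + h) <= f x + p x * h + q x * (h ^+ 2 / 2) + K * `|h| ^+ 3].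
Proof.
move=> e0.
pose k := (Num.trunc (4 / e)).+1.
have k0 : 0 < k%:R :> R by rewrite ltr0n.
have kN : k%:R != 0 :> R by rewrite gt_eqF.
have ke : 4 / k%:R <= e.
  rewrite ler_pdivrMr// mulrC -ler_pdivrMr// ltW//.
  exact: truncnS_gt.
pose d (j : nat) : R := (2 ^+ j)^-1.
have d0 j : 0 < d j by rewrite invr_gt0 exprn_gt0.
have dS j : d j.+1 = d j / 2 by rewrite /d exprS invfM mulrC.
exists (fun x => k%:R^-1 * \sum_(j < k) psi (d j) x).
exists (fun x => k%:R^-1 * \sum_(j < k) (x / psi (d j) x)).
exists (fun x => k%:R^-1 * \sum_(j < k) (d j ^+ 2 / psi (d j) x ^+ 3)).
exists (k%:R^-1 * \sum_(j < k) (4 / d j ^+ 2)).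
  by rewrite mulr_ge0 ?invr_ge0// sumr_ge0// => j _; rewrite divr_ge0// sqr_ge0.
have avg (c : R) : c = k%:R^-1 * \sum_(j < k) c.
  by rewrite sumr_const card_ord -[c *+ _]mulr_natr mulrCA mulVf// mulr1.
have ki0 : 0 < k%:R^-1 :> R by rewrite invr_gt0.
split.
- move=> x; apply/andP; split.
    rewrite [leLHS]avg ler_pM2l// ler_sum// => j _; exact: psi_ge_norm.
  (* Each psi exceeds |x| by at most its scale, and the dyadic scales sum to less than 2, so the
     average exceeds |x| by less than 2 / k. *)
  have dsum n : \sum_(j < n) d j <= 2 - 2 * d n.
    elim: n => [|n IH]; first by rewrite big_ord0 /d expr0 invr1 mulr1 subrr.
    rewrite big_ord_recr/= dS; lra.
  apply: (@le_trans _ _ (k%:R^-1 * \sum_(j < k) (`|x| + d j))).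
    by rewrite ler_pM2l// ler_sum// => j _; exact: psi_le.
  rewrite big_split/= mulrDr -avg lerD2l; apply: le_trans ke.
  rewrite mulrC ler_pM2r//; apply: (le_trans (dsum k)); have := d0 k; lra.
- move=> x; split.
    rewrite normrM gtr0_norm// [leRHS](avg 1) ler_pM2l//.
    apply: (le_trans (ler_norm_sum _ _ _)); apply: ler_sum => j _.
    rewrite normrM normfV (gtr0_norm (psi_gt0 (d0 _) _))// ler_pdivrMr ?psi_gt0// mul1r.
    exact: psi_ge_norm.
  rewrite -mulrA mulr_ge0 ?(ltW ki0)// mulr_suml sumr_ge0// => j _.
  by rewrite mulrAC -expr2 divr_ge0 ?sqr_ge0// ltW// psi_gt0.
  by rewrite big1 ?mulr0// => j _; rewrite mul0r.
- move=> x; split.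
    rewrite mulr_ge0 ?(ltW ki0)// sumr_ge0// => j _.
    by rewrite divr_ge0 ?exprn_ge0// ltW// psi_gt0.
  apply: le_trans ke; rewrite -mulrA mulrC ler_pM2r// mulr_suml.
  apply: (@le_trans _ _ (\sum_(j < k) (4 * (`|x| / psi (d j.+1) x - `|x| / psi (d j) x)))).
    by apply: ler_sum => j _; rewrite dS; exact: psi_telescope.
  rewrite -mulr_sumr ler_piMr//.
  rewrite -(big_mkord xpredT (fun j => `|x| / psi (d j.+1) x - `|x| / psi (d j) x)).
  rewrite telescope_sumr// lerBlDr (@le_trans _ _ 1)//; last first.
    by rewrite lerDl divr_ge0// ltW// psi_gt0.
  by rewrite ler_pdivrMr ?psi_gt0// mul1r psi_ge_norm.
- split.
    move=> x y; rewrite -mulrBr -sumrB normrM gtr0_norm// [leRHS]avg ler_pM2l//.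
    by apply: (le_trans (ler_norm_sum _ _ _)); apply: ler_sum => j _; exact: psi_lip.
  split; apply: lipbM; (try exact: lipb_cst); apply: lipb_sum => j.
    exact: lipb_psi1.
  apply: lipbM; first exact: lipb_cst.
  have -> : (fun x => (psi (d j) x ^+ 3)^-1) = (fun x => (psi (d j) x)^-1 * ((psi (d j) x)^-1 * (psi (d j) x)^-1)).
    by apply/funext => x; field; rewrite gt_eqF// psi_gt0.
  by do 2?[apply: lipbM]; exact: lipb_psi_inv.
- move=> x h.
  apply: (@le_trans _ _ (k%:R^-1 * \sum_(j < k) (psi (d j) x + x / psi (d j) x * h +
    d j ^+ 2 / psi (d j) x ^+ 3 * (h ^+ 2 / 2) + 4 / d j ^+ 2 * `|h| ^+ 3))).
    by rewrite ler_pM2l// ler_sum// => j _; exact: psi_taylor.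
  by rewrite !big_split/= !mulrDr -!mulr_suml !mulrA.
Qed.

(* F = f / (1 + eta f), with f from smooth_abs: composing with a concave function
   preserves the one-sided Taylor bound. *)
Lemma smooth_bounded_abs (e eta : R) : 0 < e -> 0 < eta ->
  exists F p q : R -> R, exists2 K : R, 0 <= K &
  [/\ forall x, `|x| / (1 + eta * `|x|) <= F x <= `|x| + e,
      forall x (a g : R), 0 <= g -> a * x <= g * `|x| -> p x * a <= g,
      forall x, 0 <= q x /\ q x * `|x| <= e,
      lipb F /\ lipb p /\ lipb q &
      forall x h, F (x + h) <= F x + p x * h + q x * (h ^+ 2 / 2) + K * `|h| ^+ 3].
Proof.
move=> e0 eta0.
have [f [p [q [K K0 [fE pE qE [fL [pL qL]] fT]]]]] := smooth_abs e0.
have f0 x : 0 <= f x by have /andP[+ _] := fE x; apply: le_trans.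
pose u x := 1 + eta * f x.
have u1 x : 1 <= u x by rewrite /u lerDl mulr_ge0// ltW.
have u0 x : 0 < u x by rewrite (lt_le_trans _ (u1 x)).
have uN x : u x != 0 by rewrite gt_eqF.
pose c x := (u x)^-1.
have c01 x : 0 < c x <= 1 by rewrite invr_gt0 u0/= invf_le1.
have cL : lipb c.
  apply: (@lipb_inv_ge1 _ eta); [exact: ltW|exact: u1|].
  move=> x y; rewrite /u opprD addrACA subrr add0r -mulrBr normrM gtr0_norm//.
  by rewrite ler_pM2l.
exists (fun x => f x / u x), (fun x => c x * c x * p x), (fun x => c x * c x * q x), K => //.
have cc01 x : 0 <= c x * c x <= 1.
  by have /andP[? ?] := c01 x; rewrite mulr_ge0 ?mulr_ile1// ltW.
split.
- move=> x; have /andP[f1 f2] := fE x; apply/andP; split; last first.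
    by apply: le_trans f2; rewrite ler_pdivrMr// ler_peMr.
  have t0 : 0 < 1 + eta * `|x| by rewrite ltr_pwDl// mulr_ge0// ltW.
  rewrite ler_pdivrMr// mulrAC ler_pdivlMr// /u; nra.
- move=> x a g g0 axg; have [p1 px p00] := pE x.
  (* At x = 0 the hypothesis leaves [a] free, and only p 0 = 0 gives the bound. Elsewhere one
     multiplies by x^2 and uses p x * x = |p x| |x|. *)
  have [x0|xN] := eqVneq x 0.
  - subst x.
    by rewrite p00 mulr0 mul0r.
  have x2 : 0 < x ^+ 2 by rewrite exprn_even_gt0.
  have pag : p x * a <= g.
    rewrite -(ler_pM2r x2) [leLHS](_ : _ = (p x * x) * (a * x)); last by ring.
    apply: (@le_trans _ _ ((p x * x) * (g * `|x|))); first by rewrite ler_wpM2l.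
    have pxE : p x * x = `|p x| * `|x| by rewrite -normrM ger0_norm.
    rewrite pxE [leLHS](_ : _ = `|p x| * (g * `|x| ^+ 2)); last by ring.
    rewrite real_normK ?num_real//; apply: ler_piMl => //.
    by rewrite mulr_ge0 ?(ltW x2).
  have /andP[c0 c1] := cc01 x.
  have [pa0|pa0] := leP 0 (p x * a).
    rewrite -(mulrA (c x * c x)); apply: le_trans pag; exact: ler_piMl.
  by rewrite -(mulrA (c x * c x)) (le_trans _ g0)// mulr_ge0_le0// ltW.
- move=> x; have [q0 qx] := qE x; have /andP[c0 c1] := cc01 x.
  split; first by rewrite mulr_ge0.
  by rewrite -(mulrA (c x * c x)); apply: le_trans qx; apply: ler_piMl; rewrite ?mulr_ge0.
- split; last by split; apply: lipbM => //; apply: lipbM.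
  (* [f] itself is unbounded; written as (1 - c) / eta, the quotient is visibly bounded and
     Lipschitz. *)
  have -> : (fun x => f x / u x) = (fun x => eta^-1 + (- eta^-1) * c x).
    by apply/funext => x; rewrite /c /u; field; rewrite -/(u x) (gt_eqF eta0) (gt_eqF (u0 x)).
  by apply: lipbD; [exact: lipb_cst|apply: lipbM; [exact: lipb_cst|]].
- move=> x h.
  pose w' := f x + p x * h + q x * (h ^+ 2 / 2) + K * `|h| ^+ 3.
  have fw : f (x + h) <= w' := fT x h.
  (* The concave map v / (1 + eta v) lies below its tangent at f x, whose slope is c^2. As c^2 <= 1,
     the cubic term keeps its constant [K]. *)
  apply: (@le_trans _ _ (f x / u x + c x * c x * (f (x + h) - f x))).
    rewrite -subr_ge0.
    have -> : f x / u x + c x * c x * (f (x + h) - f x) - f (x + h) / u (x + h) =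
       eta * (f (x + h) - f x) ^+ 2 * (c x * c x) / u (x + h).
      by rewrite /c /u; field; rewrite uN; exact: uN.
    rewrite divr_ge0//; last exact: ltW.
    have /andP[c0 _] := cc01 x; rewrite mulr_ge0// mulr_ge0 ?(ltW eta0)//.
    exact: sqr_ge0.
  have /andP[c0 c1] := cc01 x.
  rewrite -!addrA lerD2l.
  apply: (@le_trans _ _ (c x * c x * (w' - f x))); first by rewrite ler_wpM2l// lerD2r.
  rewrite (_ : w' - f x = p x * h + q x * (h ^+ 2 / 2) + K * `|h| ^+ 3); last by rewrite /w'; ring.
  rewrite [leLHS](_ : _ = c x * c x * p x * h + (c x * c x * q x * (h ^+ 2 / 2) +
    c x * c x * (K * `|h| ^+ 3))); last by ring.
  rewrite !lerD2l; apply: ler_piMl => //.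
  by rewrite mulr_ge0// exprn_ge0.
Qed.

End smooth_absolute_value.

(** * Expectation and independence *)

Section expectation.
Context {R : realType} {d : measure_display} {Omega : measurableType d}.
Variable P : probability Omega R.
Implicit Types (f g X Y : Omega -> R) (A B : set Omega).

Definition L1 f := P.-integrable setT (EFin \o f).

(** [Rintegral] sends an infinite integral to 0, so the rules for [Ex] are stated with [L1] where
    that default would break them. *)
Definition Ex f : R := \int[P]_w f w.

Definition Pr A : R := fine (P A).

Lemma PrE A : measurable A -> P A = (Pr A)%:E.
Proof. by move=> mA; rewrite /Pr fineK// fin_num_measure. Qed.

Lemma ExE f : L1 f -> (\int[P]_w (f w)%:E)%E = (Ex f)%:E.
Proof.
by move=> if_; rewrite /Ex /Rintegral fineK//; exact: (integrable_fin_num _ if_).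
Qed.

Lemma L1_measurable f : L1 f -> measurable_fun setT f.
Proof. by move=> /(measurable_int P) /measurable_EFinP. Qed.

Lemma L1_le f g : measurable_fun setT f -> L1 g -> (forall w, `|f w| <= g w) ->
  L1 f.
Proof.
move=> mf ig fg; apply: (le_integrable _ _ _ ig) => //; first exact/measurable_EFinP.
by move=> w _ /=; rewrite lee_fin (le_trans (fg w))// ler_norm.
Qed.

Lemma L1_cst c : L1 (fun=> c).
Proof. exact: finite_measure_integrable_cst. Qed.

Lemma L1_bounded f M : measurable_fun setT f -> (forall w, `|f w| <= M) -> L1 f.
Proof. by move=> mf fM; apply: (@L1_le f (fun=> M)) => //; exact: L1_cst. Qed.

Lemma L1D f g : L1 f -> L1 g -> L1 (fun w => f w + g w).
Proof. by move=> if_ ig; have := integrableD measurableT if_ ig. Qed.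

Lemma L1B f g : L1 f -> L1 g -> L1 (fun w => f w - g w).
Proof. by move=> if_ ig; have := integrableB measurableT if_ ig. Qed.

Lemma L1Z c f : L1 f -> L1 (fun w => c * f w).
Proof. by move=> if_; have := @integrableZl _ _ _ P _ measurableT c _ if_. Qed.

Lemma L1_norm f : L1 f -> L1 (fun w => `|f w|).
Proof. by move=> /integrable_norm. Qed.

Lemma L1_sum n (f : nat -> Omega -> R) : (forall i, (i < n)%N -> L1 (f i)) ->
  L1 (fun w => \sum_(i < n) f i w).
Proof.
elim: n => [|n IH] h.
  by under eq_fun do rewrite big_ord0; exact: L1_cst.
under eq_fun do rewrite big_ord_recr/=.
by apply: L1D; [apply: IH => i ni; apply: h; exact: ltnW|exact: h].
Qed.

Lemma ExD f g : L1 f -> L1 g -> Ex (fun w => f w + g w) = Ex f + Ex g.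
Proof. by move=> *; exact: RintegralD. Qed.

Lemma ExB f g : L1 f -> L1 g -> Ex (fun w => f w - g w) = Ex f - Ex g.
Proof. by move=> *; exact: RintegralB. Qed.

Lemma ExZ c f : L1 f -> Ex (fun w => c * f w) = c * Ex f.
Proof. by move=> *; exact: RintegralZl. Qed.

Lemma Ex_cst c : Ex (fun=> c) = c.
Proof.
rewrite /Ex Rintegral_cst//.
have -> : fine (P [set: Omega]) = 1 by rewrite probability_setT.
by rewrite mulr1.
Qed.

Lemma Ex_le f g : L1 f -> L1 g -> (forall w, f w <= g w) -> Ex f <= Ex g.
Proof. by move=> if_ ig fg; apply: le_Rintegral => // w _; exact: fg. Qed.

Lemma Ex_ge0 f : (forall w, 0 <= f w) -> 0 <= Ex f.
Proof. by move=> f0; apply: Rintegral_ge0. Qed.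

(** min(f, g) equals f almost everywhere and is below g everywhere, which reduces to [Ex_le]. *)
Lemma Ex_ae_le f g : L1 f -> L1 g -> {ae P, forall w, f w <= g w} ->
  Ex f <= Ex g.
Proof.
move=> if_ ig fg.
pose h w := Order.min (f w) (g w).
have mh : measurable_fun setT h.
  by apply: measurable_minr; exact: L1_measurable.
have ih : L1 h.
  apply: (@L1_le h (fun w => `|f w| + `|g w|)) => //.
    by apply: L1D; exact: L1_norm.
  move=> w; rewrite /h; case: (leP (f w) (g w)) => _.
    by rewrite lerDl.
  by rewrite lerDr.
have <- : Ex h = Ex f.
  rewrite /Ex /Rintegral; congr fine; apply: ae_eq_integral => //.
  - exact/measurable_EFinP.
  - exact/measurable_EFinP/L1_measurable.
  - by apply: filterS fg => w fgw _; rewrite /h; congr EFin; exact/min_idPl.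
by apply: Ex_le => // w; rewrite /h ge_min lexx orbT.
Qed.

Lemma L1_indic A : measurable A -> L1 (\1_A : Omega -> R).
Proof.
move=> mA; apply: (@L1_bounded _ 1); first exact: measurable_indic.
by move=> w; rewrite ger0_norm// indicE; case: (_ \in _).
Qed.

Lemma Ex_indic A : measurable A -> Ex (\1_A : Omega -> R) = Pr A.
Proof. by move=> mA; rewrite /Ex /Rintegral integral_indic// setIT. Qed.

Lemma Pr_ge0 A : 0 <= Pr A.
Proof. exact: fine_ge0. Qed.

Lemma Pr_le A B : measurable A -> measurable B -> A `<=` B -> Pr A <= Pr B.
Proof.
by move=> mA mB AB; rewrite -lee_fin -!PrE// le_measure// inE.
Qed.

Lemma PrU A B : measurable A -> measurable B -> Pr (A `|` B) <= Pr A + Pr B.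
Proof.
move=> mA mB; rewrite -lee_fin EFinD -!PrE//; last exact: measurableU.
exact: measureU2.
Qed.

Lemma markov_sqr f c : measurable_fun setT f -> L1 (fun w => f w ^+ 2) -> 0 < c ->
  Pr [set w | c <= `|f w|] <= Ex (fun w => f w ^+ 2) / c ^+ 2.
Proof.
move=> mf i2 c0; set A := [set w | _].
have mA : measurable A.
  rewrite (_ : A = (fun w => `|f w|) @^-1` `[c, +oo[); last first.
    by apply/seteqP; split => w /=; rewrite in_itv/= andbT.
  by rewrite -[X in measurable X]setTI; apply: measurableT_comp => //; exact: measurableT_comp.
rewrite ler_pdivlMr ?exprn_gt0// -Ex_indic// mulrC -ExZ; last exact: L1_indic.
apply: Ex_le => //; first by apply: L1Z; exact: L1_indic.
move=> w; rewrite indicE; case: (boolP (w \in A)) => [|_]; last first.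
  by rewrite mulr0 sqr_ge0.
rewrite inE /A /= mulr1 => cf.
by rewrite -[leRHS]real_normK ?num_real// ler_sqr ?nnegrE// ltW.
Qed.

End expectation.

(** * Products of independent random variables *)

Section independence.
Context {R : realType} {d : measure_display} {Omega : measurableType d}.
Variable P : probability Omega R.
Implicit Types (X Y : {mfun Omega >-> R}).
Let L1 := @L1 R d Omega P.
Let Ex := @Ex R d Omega P.

Definition indep2 (X Y : Omega -> R) := forall A B, measurable A -> measurable B ->
  P (X @^-1` A `&` Y @^-1` B) = (P (X @^-1` A) * P (Y @^-1` B))%E.

(** The joint law agrees with the product of the marginals on rectangles, hence everywhere by
    uniqueness of the product measure. *)
Lemma indep2_integral X Y (f : R * R -> \bar R) : indep2 X Y ->
  measurable_fun setT f -> (forall z, 0 <= f z)%E ->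
  (\int[P]_w f (X w, Y w) = \int[distribution P X \x distribution P Y]_z f z)%E.
Proof.
move=> XY mf f0.
pose phi w := (X w, Y w).
have mphi : measurable_fun setT phi by exact/measurable_fun_pair.
pose mphi_mixin := isMeasurableFun.Build _ _ _ _ _ mphi.
pose Phi : {mfun _ >-> _} := HB.pack phi mphi_mixin.
transitivity (\int[distribution P Phi]_z f z)%E.
  by rewrite /distribution ge0_integral_pushforward.
apply: eq_measure_integral => A mA _; apply/esym.
apply: (@product_measure_unique _ _ _ _ _ (distribution P X) (distribution P Y) (distribution P Phi)) => //.
Qed.

Lemma indep2_ge0M X Y (g h : R -> R) : indep2 X Y ->
  measurable_fun setT g -> measurable_fun setT h ->
  (forall x, 0 <= g x) -> (forall x, 0 <= h x) ->
  (\int[P]_w (g (X w) * h (Y w))%:E =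
   (\int[P]_w (g (X w))%:E) * \int[P]_w (h (Y w))%:E)%E.
Proof.
move=> XY mg mh g0 h0.
have mM : measurable_fun setT (fun z : R * R => (g z.1 * h z.2)%:E).
  apply/measurable_EFinP.
  by apply: measurable_funM; [exact: (measurableT_comp mg)|exact: (measurableT_comp mh)].
rewrite (@indep2_integral X Y (fun z => (g z.1 * h z.2)%:E))//; last first.
  by move=> z; rewrite lee_fin mulr_ge0.
rewrite fubini_tonelli1//; last by move=> z; rewrite lee_fin mulr_ge0.
rewrite (eq_integral (fun x : R => ((g x)%:E * \int[distribution P Y]_y (h y)%:E)%E)); last first.
  move=> x _; rewrite /fubini_F /=.
  under eq_integral do rewrite EFinM.
  rewrite ge0_integralZl ?lee_fin//; first exact/measurable_EFinP.
  by move=> y _; rewrite lee_fin.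
rewrite ge0_integralZr//.
- by rewrite /distribution !ge0_integral_pushforward//;
    [exact/measurable_EFinP|move=> y _; rewrite lee_fin|exact/measurable_EFinP|move=> y _; rewrite lee_fin].
- exact/measurable_EFinP.
- by move=> x _; rewrite lee_fin.
- by apply: integral_ge0 => y _; rewrite lee_fin.
Qed.

Lemma indep2_ge0_L1M X Y (g h : R -> R) : indep2 X Y ->
  measurable_fun setT g -> measurable_fun setT h ->
  (forall x, 0 <= g x) -> (forall x, 0 <= h x) ->
  L1 (fun w => g (X w)) -> L1 (fun w => h (Y w)) ->
  L1 (fun w => g (X w) * h (Y w)) /\
  Ex (fun w => g (X w) * h (Y w)) = Ex (fun w => g (X w)) * Ex (fun w => h (Y w)).
Proof.
move=> XY mg mh g0 h0 ig ih.
have H := indep2_ge0M XY mg mh g0 h0.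
have iM : L1 (fun w => g (X w) * h (Y w)).
  apply/integrableP; split.
    by apply/measurable_EFinP/measurable_funM; exact: measurableT_comp.
  under eq_integral do rewrite /= ger0_norm ?mulr_ge0//.
  by rewrite H (ExE ig) (ExE ih) -EFinM ltry.
split=> //; apply: EFin_inj.
by rewrite EFinM -(ExE ig) -(ExE ih) -(ExE iM).
Qed.

(** Writing x = (|x| + x) - |x| splits each factor into nonnegative functions of itself, and the
    nonnegative case applies to the four products. *)
Lemma indep2_L1M X Y : indep2 X Y -> L1 X -> L1 Y ->
  L1 (fun w => X w * Y w) /\ Ex (fun w => X w * Y w) = Ex X * Ex Y.
Proof.
move=> XY iX iY.
pose u (x : R) := `|x| + x; pose v (x : R) := `|x|.
have mv : measurable_fun setT v by exact: normr_measurable.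
have mu : measurable_fun setT u by exact: measurable_funD.
have v0 x : 0 <= v x by exact: normr_ge0.
have u0 x : 0 <= u x by rewrite /u -lerBlDr sub0r -normrN ler_norm.
have ivX : L1 (fun w => v (X w)) by exact: L1_norm.
have ivY : L1 (fun w => v (Y w)) by exact: L1_norm.
have iuX : L1 (fun w => u (X w)) by exact: L1D.
have iuY : L1 (fun w => u (Y w)) by exact: L1D.
have [iuu Euu] := indep2_ge0_L1M XY mu mu u0 u0 iuX iuY.
have [iuv Euv] := indep2_ge0_L1M XY mu mv u0 v0 iuX ivY.
have [ivu Evu] := indep2_ge0_L1M XY mv mu v0 u0 ivX iuY.
have [ivv Evv] := indep2_ge0_L1M XY mv mv v0 v0 ivX ivY.
have XE : (X : Omega -> R) = (fun w => u (X w) - v (X w)).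
  by apply/funext => w; rewrite /u /v; ring.
have YE : (Y : Omega -> R) = (fun w => u (Y w) - v (Y w)).
  by apply/funext => w; rewrite /u /v; ring.
have XYE : (fun w => X w * Y w) = (fun w =>
    (u (X w) * u (Y w) - u (X w) * v (Y w)) - (v (X w) * u (Y w) - v (X w) * v (Y w))).
  by apply/funext => w; rewrite /u /v; ring.
rewrite XYE; split; first by apply: L1B; exact: L1B.
rewrite [in RHS]XE [in RHS]YE /Ex !ExB; do ?[exact: L1B|by []].
rewrite -/Ex Euu Euv Evu Evv; ring.
Qed.

End independence.

(** * Gaussian moments and Wiener increments *)

Section gaussian.
Context {R : realType}.
Variable s : R.
Hypothesis s0 : 0 < s.
Notation mu := (@lebesgue_measure R).
Import HBNNSimple.
Notation pdf := (normal_pdf 0 s).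

(** Both sides are monotone limits along simple functions increasing to f; on indicators the
    identity is the definition of the Gaussian law by its density. *)
Lemma normal_prob_integral (f : R -> \bar R) :
  measurable_fun [set: measurableTypeR R] (f : measurableTypeR R -> \bar R) ->
  (forall x, 0 <= f x)%E ->
  (\int[normal_prob 0 s]_x f x = \int[mu]_x (f x * (pdf x)%:E))%E.
Proof.
move=> mf f0.
pose h := nnsfun_approx measurableT mf.
have mpdf : measurable_fun setT (fun x => (pdf x)%:E).
  by apply/measurable_EFinP; exact: measurable_normal_pdf.
have cvh x : EFin \o h^~ x @ \oo --> f x.
  by apply: cvg_nnsfun_approx.
have -> : (\int[normal_prob 0 s]_x f x =
    lim (\int[normal_prob 0 s]_x (h n x)%:E @[n --> \oo]))%E.
  rewrite -monotone_convergence//.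
  - by apply: eq_integral => x _; apply/esym/cvg_lim => //; exact: cvh.
  - by move=> n; exact/measurable_EFinP.
  - by move=> n x _; rewrite lee_fin.
  - by move=> x _ a b ab; rewrite lee_fin; exact/lefP/nd_nnsfun_approx.
have -> : (\int[mu]_x (f x * (pdf x)%:E) =
    lim (\int[mu]_x ((h n x)%:E * (pdf x)%:E) @[n --> \oo]))%E.
  rewrite -monotone_convergence//.
  - apply: eq_integral => x _; apply/esym/cvg_lim => //.
    by apply: cvgeZr => //; exact: cvh.
  - by move=> n; apply: emeasurable_funM => //; exact/measurable_EFinP.
  - by move=> n x _; rewrite mule_ge0 ?lee_fin ?normal_pdf_ge0.
  - move=> x _ a b ab; rewrite lee_wpmul2r ?lee_fin ?normal_pdf_ge0//.
    exact/lefP/nd_nnsfun_approx.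
congr (lim _); apply/congr2 => //; apply/funext => n.
under eq_integral do rewrite fimfunE -fsumEFin//.
under [RHS]eq_integral.
  move=> x _; rewrite fimfunE -fsumEFin// ge0_mule_fsuml; last first.
    by move=> r; exact: nnfun_muleindic_ge0.
  over.
rewrite ge0_integral_fsum//; last 2 first.
  - by move=> r; exact/measurable_EFinP/measurableT_comp.
  - by move=> r x _; exact: nnfun_muleindic_ge0.
rewrite ge0_integral_fsum//; last 2 first.
  - by move=> r; apply: emeasurable_funM => //; exact/measurable_EFinP/measurableT_comp.
  - by move=> r x _; rewrite mule_ge0 ?nnfun_muleindic_ge0 ?lee_fin ?normal_pdf_ge0.
apply: eq_fsbigr => r; rewrite inE => -[x _ <-].
under [RHS]eq_integral do rewrite EFinM -muleA.
under eq_integral do rewrite EFinM.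
rewrite !ge0_integralZl//.
- congr (_ * _)%E; rewrite integral_indic// setIT.
  rewrite /normal_prob [LHS]integral_mkcond/=; apply: eq_integral => y _.
  rewrite patchE indicE; case: ifPn => yA; first by rewrite mul1e.
  by rewrite mul0e.
- by apply: emeasurable_funM => //; exact/measurable_EFinP.
- by move=> y _; rewrite mule_ge0 ?lee_fin ?normal_pdf_ge0.
- by rewrite lee_fin.
- exact/measurable_EFinP.
- by rewrite lee_fin.
Qed.

Lemma normal_pdf_sym x : pdf (- x) = pdf x.
Proof.
by rewrite normal_pdfE ?gt_eqF// /normal_fun !subr0 sqrrN.
Qed.

(** The vanishing mean, phrased through positive and negative parts so that only integrals of
    nonnegative functions occur; it follows from the substitution x -> -x. *)
Lemma normal_prob_sym :
  (\int[normal_prob 0 s]_x (Order.max x 0)%:E =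
   \int[normal_prob 0 s]_x (Order.max (- x) 0)%:E)%E.
Proof.
have m0 (x : R) : 0 <= Order.max x 0 by rewrite le_max lexx orbT.
have mm : measurable_fun setT (fun x : R => Order.max x 0).
  by apply: measurable_maxr.
have mmN : measurable_fun setT (fun x : R => Order.max (- x) 0).
  by apply: measurable_maxr.
rewrite !normal_prob_integral//; do ?[exact/measurable_EFinP|by move=> x; rewrite lee_fin].
transitivity (\int[mu]_(x in `[0%R, +oo[) (Order.max x 0 * pdf x)%:E)%E.
  rewrite [RHS]integral_mkcond/=; apply: eq_integral => x _.
  rewrite patchE; case: ifPn => //.
  rewrite notin_setE/= in_itv/= andbT => /negP; rewrite -ltNge => x0.
  by rewrite (max_idPr (ltW x0)) mul0e.
transitivity (\int[mu]_(x in `]-oo, 0%R]) (Order.max (- x) 0 * pdf x)%:E)%E; last first.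
  rewrite [LHS]integral_mkcond/=; apply: eq_integral => x _.
  rewrite patchE; case: ifPn => //.
  rewrite notin_setE/= in_itv/= => /negP; rewrite -ltNge => x0.
  by rewrite (max_idPr _) ?mul0e// oppr_le0 ltW.
have := @ge0_integration_by_substitutionNy R (fun x => Order.max (- x) 0 * pdf x) 0.
rewrite oppr0 => ->.
- by apply: eq_integral => x _ /=; rewrite opprK normal_pdf_sym.
- apply: continuous_subspaceT => x; apply: cvgM; last by apply: continuous_normal_pdf; rewrite gt_eqF.
  apply: (@continuous_max _ R (fun x => - x) (fun=> 0) x); last exact: cvg_cst.
  by apply: (@cvgN _ R^o); exact: cvg_id.
- by move=> x _; rewrite mulr_ge0 ?normal_pdf_ge0.
Qed.

(* The constant 130 is crude: only its independence of s matters.  Half of the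
   Gaussian exponent absorbs the power, which leaves a Gaussian of deviation
   sqrt 2 * s. *)
Lemma normal_prob_moment (k : nat) : (k <= 3)%N ->
  (\int[normal_prob 0 s]_x (`|x| ^+ k)%:E <= (130 * s ^+ k)%:E)%E.
Proof.
move=> k3.
have mk : measurable_fun setT (fun x : R => `|x| ^+ k).
  by apply: measurable_funX; exact: normr_measurable.
rewrite normal_prob_integral; do ?[exact/measurable_EFinP|by move=> x; rewrite lee_fin exprn_ge0].
pose s2 := Num.sqrt 2 * s.
have s20 : 0 < s2 by rewrite mulr_gt0// sqrtr_gt0.
rewrite -[leRHS]mule1 -(@integral_normal_pdf R 0 s2) -ge0_integralZl//; last 3 first.
- by apply/measurable_EFinP; exact: measurable_normal_pdf.
- by move=> x _; rewrite lee_fin normal_pdf_ge0.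
- by rewrite lee_fin mulr_ge0// exprn_ge0// ltW.
apply: ge0_le_integral => //.
- by move=> x _; rewrite mule_ge0 ?lee_fin ?exprn_ge0 ?normal_pdf_ge0.
- by apply: emeasurable_funM; apply/measurable_EFinP => //; exact: measurable_normal_pdf.
- by apply: emeasurable_funM => //; apply/measurable_EFinP; exact: measurable_normal_pdf.
move=> x _; rewrite -!EFinM lee_fin.
rewrite !normal_pdfE ?gt_eqF//.
rewrite /normal_fun !subr0.
have -> : s2 ^+ 2 = 2 * s ^+ 2 by rewrite exprMn sqr_sqrtr.
have -> : normal_peak s = Num.sqrt 2 * normal_peak s2.
  rewrite /normal_peak exprMn sqr_sqrtr//.
  rewrite (_ : 2 * s ^+ 2 * pi *+ 2 = 2 * (s ^+ 2 * pi *+ 2)); last by ring.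
  rewrite (sqrtrM (s ^+ 2 * pi *+ 2)); last by [].
  by rewrite invfM mulVKf// gt_eqF// sqrtr_gt0.
set pk := normal_peak s2; have pk0 : 0 < pk by apply: normal_peak_gt0; rewrite gt_eqF.
pose u := `|x| / s.
have u0 : 0 <= u by rewrite divr_ge0// ltW.
have xE : `|x| = u * s by rewrite /u divfK// gt_eqF.
have x2E : x ^+ 2 = u ^+ 2 * s ^+ 2 by rewrite -exprMn -xE real_normK// num_real.
have -> : - x ^+ 2 / (s ^+ 2 *+ 2) = - (u ^+ 2 / 4) + - (u ^+ 2 / 4).
  by rewrite x2E; field; rewrite gt_eqF.
have -> : - x ^+ 2 / (2 * s ^+ 2 *+ 2) = - (u ^+ 2 / 4).
  by rewrite x2E; field; rewrite gt_eqF.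
rewrite expRD.
set e := expR (- (u ^+ 2 / 4)); have e0 : 0 < e by exact: expR_gt0.
rewrite xE exprMn.
(* 130 = 2 * 65: the 2 bounds the sqrt 2 by which the two peaks differ, and 65 bounds u^k exp(- u^2
   / 4). *)
suff H : u ^+ k * e <= 65.
  have s20' : Num.sqrt 2 <= 2 :> R.
    by rewrite -[leRHS]gtr0_norm// -sqrtr_sqr ler_wsqrtr//; lra.
  have sk : 0 <= s ^+ k by rewrite exprn_ge0// ltW.
  have q0 : 0 <= Num.sqrt 2 :> R by exact: sqrtr_ge0.
  have uk : 0 <= u ^+ k * e by rewrite mulr_ge0 ?exprn_ge0// ltW.
  rewrite [leLHS](_ : _ = (Num.sqrt 2 * (u ^+ k * e)) * (s ^+ k * (pk * e))); last by ring.
  rewrite [leRHS](_ : _ = 130 * (s ^+ k * (pk * e))); last by ring.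
  rewrite ler_wpM2r//; first by rewrite !mulr_ge0// ltW.
  rewrite (_ : 130 = 2 * 65) ?ler_pM//; ring.
rewrite /e expRN ler_pdivrMr ?expR_gt0//.
(* Squaring this bounds exp(u^2 / 4) from below by a quartic. Since u^4 = 64 (u^2 / 8)^2, the
   majorant 1 + u^4 of u^k is at most 65 times that quartic. *)
have e8 : 1 + u ^+ 2 / 8 <= expR (u ^+ 2 / 8) by exact: expR_ge1Dx.
have -> : expR (u ^+ 2 / 4) = expR (u ^+ 2 / 8) ^+ 2.
  by rewrite [RHS]expr2 -expRD; congr expR; field.
have u20 : 0 <= u ^+ 2 by exact: sqr_ge0.
have e82 : (1 + u ^+ 2 / 8) ^+ 2 <= expR (u ^+ 2 / 8) ^+ 2.
  by rewrite ler_sqr ?nnegrE ?expR_ge0// addr_ge0// divr_ge0.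
have uk4 : u ^+ k <= 1 + u ^+ 4.
  have [u1|u1] := leP u 1.
    by rewrite (le_trans (exprn_ile1 _ u0 u1))// lerDl exprn_ge0.
  rewrite (le_trans (ler_weXn2l (ltW u1) (_ : k <= 4)%N))//; last by rewrite lerDr.
  exact: leqW.
apply: (le_trans uk4); apply: (@le_trans _ _ (65 * (1 + u ^+ 2 / 8) ^+ 2)).
  have -> : u ^+ 4 = u ^+ 2 * u ^+ 2 by rewrite -exprD.
  move: u20; set q := u ^+ 2 => q0; nra.
by rewrite ler_pM2l.
Qed.

End gaussian.

(** * The augmented filtration and moments of weighted Wiener increments *)

Section filtration.
Context {R : realType} {d : measure_display} {Omega : measurableType d}.
Variables (P : probability Omega R) (W : R -> {RV P >-> R}).
Notation F := (augmented_filtration P W).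

Lemma natural_filtration_measurable t A : natural_filtration W t A -> measurable A.
Proof.
apply: smallest_sub; first exact: sigma_algebra_measurable.
by move=> B [s _ [C mC <-]]; rewrite setTI; exact: measurable_funPTI.
Qed.

Lemma augmented_filtration_measurable t A : F t A -> measurable A.
Proof.
apply: smallest_sub; first exact: sigma_algebra_measurable.
by move=> B [/natural_filtration_measurable|[]].
Qed.

Lemma augmented_filtrationS s t : s <= t -> F s `<=` F t.
Proof.
move=> st; apply: smallest_sub; first exact: smallest_sigma_algebra.
move=> A [nA|nA]; last by apply: sub_gen_smallest; right.
apply: sub_gen_smallest; left; move: nA.
apply: smallest_sub; first exact: smallest_sigma_algebra.
move=> B [u us uB]; apply: sub_gen_smallest; exists u => //.
by move: us; rewrite /= !in_itv/= => /andP[-> us]; exact: le_trans us st.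
Qed.

Lemma wiener_adapted (s t : R) : 0 <= s -> s <= t -> sub_measurable (F t) (W s).
Proof.
move=> s0 st B mB; apply: sub_gen_smallest; left; apply: sub_gen_smallest.
by exists s; rewrite /= ?in_itv/= ?s0//; exists B => //; rewrite setTI.
Qed.

(** A copy of [Omega] carrying the sigma-algebra of time t, so that the library's closure properties
    of measurable functions apply to [sub_measurable]. *)
Definition augmented_space t : Type := g_sigma_algebraType
  (natural_filtration W t `|` [set N | measurable N /\ P N = 0%E]).
HB.instance Definition _ t := Measurable.on (augmented_space t).

Lemma sub_measurableP t (xi : Omega -> R) :
  sub_measurable (F t) xi <-> measurable_fun [set: augmented_space t] xi.
Proof.
split=> h; last by move=> B mB; have := h measurableT B mB; rewrite setTI.
by move=> _ B mB; rewrite setTI; exact: h.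
Qed.

Lemma sub_measurable_measurable t (xi : Omega -> R) :
  sub_measurable (F t) xi -> measurable_fun setT xi.
Proof.
move=> h _ B mB; rewrite setTI; apply: (@augmented_filtration_measurable t); exact: h.
Qed.

Lemma sub_measurableS s t (xi : Omega -> R) : s <= t ->
  sub_measurable (F s) xi -> sub_measurable (F t) xi.
Proof. by move=> st h B mB; apply: (augmented_filtrationS st); exact: h. Qed.

(** The sets that agree with an event of the natural filtration off a null set form a sigma-algebra
    containing the generators. This carries the independence of increments, postulated for the
    natural filtration, over to the augmented one. *)
Lemma augmented_filtration_approx s A : F s A -> exists A' N,
  [/\ natural_filtration W s A', measurable N, P N = 0%E &
      forall w, ~ N w -> (A w <-> A' w)].
Proof.
pose Q := [set B : set Omega | exists A' N,
  [/\ natural_filtration W s A', measurable N, P N = 0%E &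
      forall w, ~ N w -> (B w <-> A' w)]].
suff : F s `<=` Q by apply.
apply: smallest_sub.
  split.
  - by exists set0, set0; split; [exact: sigma_algebra0|exact: measurable0|exact: measure0|].
  - move=> B [B' [N [nB' mN PN BB']]]; exists (setT `\` B'), N; split => //.
      exact: sigma_algebraCD.
    by move=> w Nw /=; have := BB' w Nw; tauto.
  - move=> B HB.
    have [f Hf] := choice HB; have [g Hg] := choice Hf.
    exists (\bigcup_i f i), (\bigcup_i g i); split => //.
    + by apply: sigma_algebra_bigcup => i; case: (Hg i).
    + by apply: bigcupT_measurable => i; case: (Hg i).
    + apply: measure_negligible; first by apply: bigcupT_measurable => i; case: (Hg i).
      by apply: negligible_bigcup => i; case: (Hg i) => _ mg Pg _; exact/negligibleP.
    + move=> w Nw; split => -[i _ Bi]; exists i => //.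
        have [_ _ _ /(_ w) H] := Hg i.
        by apply/H => // Ni; apply: Nw; exists i.
      have [_ _ _ /(_ w) H] := Hg i.
      by apply/H => // Ni; apply: Nw; exists i.
move=> B [nB|[mB PB]]; first by exists B, set0; split; [| |exact: measure0|].
by exists set0, B; split => //; exact: sigma_algebra0.
Qed.

Lemma PI_ae_eq (A A' N C : set Omega) : measurable A -> measurable A' ->
  measurable N -> measurable C -> P N = 0%E ->
  (forall w, ~ N w -> (A w <-> A' w)) -> P (A `&` C) = P (A' `&` C).
Proof.
move=> mA mA' mN mC PN AA'.
have le (B B' : set Omega) : measurable B -> measurable B' ->
    (forall w, ~ N w -> (B w <-> B' w)) -> (P (B `&` C) <= P (B' `&` C))%E.
  move=> mB mB' BB'.
  apply: (@le_trans _ _ (P ((B' `&` C) `|` N))).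
    apply: le_measure; rewrite ?inE//; do ?[exact: measurableI].
      by apply: measurableU => //; exact: measurableI.
    move=> w [Bw Cw]; have [Nw|Nw] := pselect (N w); first by right.
    by left; split => //; apply/BB'.
  apply: (le_trans (measureU2 _ _ _)) => //; first exact: measurableI.
  rewrite -[leRHS]adde0 leeD//.
  by rewrite le_eqVlt; apply/orP; left; apply/eqP; exact: PN.
apply/eqP; rewrite eq_le !le// => w Nw; exact: iff_sym (AA' w Nw).
Qed.

Hypothesis hW : wiener_process W.

Lemma wiener_indep (s t : R) (xi : Omega -> R) : 0 <= s -> s < t ->
  sub_measurable (F s) xi -> indep2 P xi (W t \- W s).
Proof.
move=> s0 st mxi A B mA mB.
have [_ ind _ _] := hW.
have mD : measurable ((W t \- W s) @^-1` B).
  rewrite -[X in measurable X]setTI.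
  have m : measurable_fun setT (W t \- W s) by exact: measurable_funB.
  exact: m.
have [A' [N [nA' mN PN AA']]] := augmented_filtration_approx (mxi A mA).
have mA1 := augmented_filtration_measurable (mxi A mA).
have mA' := natural_filtration_measurable nA'.
rewrite (PI_ae_eq mA1 mA' mN mD PN AA') ind//.
by have := PI_ae_eq mA1 mA' mN measurableT PN AA'; rewrite !setIT => ->.
Qed.

Lemma wiener_increment_integral (s t : R) (f : R -> \bar R) : 0 <= s -> s < t ->
  measurable_fun [set: measurableTypeR R] (f : measurableTypeR R -> \bar R) ->
  (forall x, 0 <= f x)%E ->
  (\int[P]_w f (W t w - W s w)%R =
   \int[normal_prob 0 (Num.sqrt (t - s))]_x f x)%E.
Proof.
move=> s0 st mf f0; have [_ _ law _] := hW.
have m0 : measurable_fun setT (W t \- W s) by exact: measurable_funB.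
pose dW (w : Omega) : measurableTypeR R := W t w - W s w.
have m : measurable_fun setT dW by move=> mT B mB; exact: m0.
pose D : {mfun Omega >-> measurableTypeR R} := HB.pack dW (isMeasurableFun.Build _ _ _ _ _ m).
transitivity (\int[distribution P D]_x f x)%E.
  by rewrite /distribution ge0_integral_pushforward.
apply: eq_measure_integral => B mB _; have e := law s t s0 st B mB.
exact: e.
Qed.

Lemma wiener_increment_moment (s t : R) k : 0 <= s -> s <= t -> (0 < k <= 3)%N ->
  L1 P (fun w => `|W t w - W s w| ^+ k) /\
  Ex P (fun w => `|W t w - W s w| ^+ k) <= 130 * Num.sqrt (t - s) ^+ k.
Proof.
move=> s0; rewrite le_eqVlt => /predU1P[<-|st] /andP[k0 k3].
  have -> : (fun w => `|W s w - W s w| ^+ k) = (fun=> 0).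
    by apply/funext => w; rewrite subrr normr0 expr0n eqn0Ngt k0.
  by rewrite Ex_cst subrr sqrtr0 expr0n eqn0Ngt k0 mulr0; split => //; exact: L1_cst.
have mk : measurable_fun setT (fun x : R => `|x| ^+ k).
  by apply: measurable_funX; exact: normr_measurable.
have sd : 0 < Num.sqrt (t - s) by rewrite sqrtr_gt0 subr_gt0.
have H : (\int[P]_w (`|W t w - W s w| ^+ k)%:E <= (130 * Num.sqrt (t - s) ^+ k)%:E)%E.
  rewrite (@wiener_increment_integral s t (fun x => (`|x| ^+ k)%:E))//.
  - exact: normal_prob_moment.
  - exact/measurable_EFinP.
have iD : L1 P (fun w => `|W t w - W s w| ^+ k).
  apply/integrableP; split.
    apply/measurable_EFinP; apply: (measurableT_comp mk); exact: measurable_funB.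
  under eq_integral do rewrite /= ger0_norm ?exprn_ge0//.
  by apply: le_lt_trans H _; rewrite ltry.
by split => //; rewrite -lee_fin -ExE.
Qed.

Lemma wiener_increment_L1 (s t : R) : 0 <= s -> s <= t -> L1 P (fun w => W t w - W s w).
Proof.
move=> s0 st; have [+ _] := @wiener_increment_moment s t 1 s0 st isT.
move=> /L1_le; apply; first exact: measurable_funB.
by move=> w; rewrite expr1.
Qed.

(** The positive and negative parts of the increment have equal means by symmetry of the Gaussian
    law. *)
Lemma wiener_increment_mean (s t : R) : 0 <= s -> s <= t ->
  Ex P (fun w => W t w - W s w) = 0.
Proof.
move=> s0; rewrite le_eqVlt => /predU1P[<-|st].
  by under [X in Ex _ X]eq_fun do rewrite subrr; rewrite Ex_cst.
have iD := wiener_increment_L1 s0 (ltW st).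
have mD := L1_measurable iD.
pose u w := Order.max (W t w - W s w) 0; pose v w := Order.max (- (W t w - W s w)) 0.
have iu : L1 P u.
  apply: (L1_le _ (L1_norm iD)); first exact: measurable_maxr.
  by move=> w; rewrite /u; case: (leP (W t w - W s w) 0) => _; rewrite ?normr0.
have iv : L1 P v.
  apply: (L1_le _ (L1_norm iD)); first by apply: measurable_maxr => //; exact: measurableT_comp.
  by move=> w; rewrite /v; case: (leP (- (W t w - W s w)) 0) => _; rewrite ?normr0 ?normrN.
have -> : (fun w => W t w - W s w) = (fun w => u w - v w).
  by apply/funext => w; rewrite /u /v; case: (leP (W t w - W s w) 0) => ?; case: (leP (- (W t w - W s w)) 0) => ?; lra.
rewrite ExB//; apply/eqP; rewrite subr_eq0; apply/eqP; apply: EFin_inj.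
rewrite -!ExE//.
have m0 (x : R) : 0 <= Order.max x 0 by rewrite le_max lexx orbT.
rewrite (@wiener_increment_integral s t (fun x => (Order.max x 0)%:E)); do ?[by []|by move=> x; rewrite lee_fin|by apply/measurable_EFinP; exact: measurable_maxr].
rewrite (@wiener_increment_integral s t (fun x => (Order.max (- x) 0)%:E)); do ?[by []|by move=> x; rewrite lee_fin|by apply/measurable_EFinP; exact: measurable_maxr].
by apply: normal_prob_sym; rewrite sqrtr_gt0 subr_gt0.
Qed.

Lemma wiener_L1M (s t : R) (xi : Omega -> R) (g : R -> R) : 0 <= s -> s <= t ->
  sub_measurable (F s) xi -> measurable_fun setT g ->
  L1 P xi -> L1 P (fun w => g (W t w - W s w)) ->
  L1 P (fun w => xi w * g (W t w - W s w)) /\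
  Ex P (fun w => xi w * g (W t w - W s w)) = Ex P xi * Ex P (fun w => g (W t w - W s w)).
Proof.
move=> s0; rewrite le_eqVlt => /predU1P[<-|st] mxi mg ix ig.
  have -> : (fun w => xi w * g (W s w - W s w)) = (fun w => g 0 * xi w).
    by apply/funext => w; rewrite subrr mulrC.
  have -> : (fun w => g (W s w - W s w)) = (fun w => g 0).
    by apply/funext => w; rewrite subrr.
  by rewrite Ex_cst ExZ// mulrC; split => //; exact: L1Z.
have mX := L1_measurable ix; have mY := L1_measurable ig.
pose X : {mfun Omega >-> R} := HB.pack xi (isMeasurableFun.Build _ _ _ _ _ mX).
pose Y : {mfun Omega >-> R} := HB.pack (fun w => g (W t w - W s w)) (isMeasurableFun.Build _ _ _ _ _ mY).
apply: (@indep2_L1M _ _ _ P X Y) => // A B mA mB.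
have := @wiener_indep s t xi s0 st mxi A (g @^-1` B) mA.
apply; rewrite -[X in measurable X]setTI; exact: mg.
Qed.

(** The martingale property in the form used later: the weight is independent of the increment,
    which is centred. It removes the cross terms of the isometry and the first-order noise term of
    Taylor's expansion. *)
Lemma wiener_mart (s t : R) (xi : Omega -> R) : 0 <= s -> s <= t ->
  sub_measurable (F s) xi -> L1 P xi ->
  L1 P (fun w => xi w * (W t w - W s w)) /\
  Ex P (fun w => xi w * (W t w - W s w)) = 0.
Proof.
move=> s0 st mxi ix.
have [? ->] := @wiener_L1M s t xi id s0 st mxi (@measurable_id _ _ _) ix (wiener_increment_L1 s0 st).
by rewrite wiener_increment_mean// mulr0.
Qed.

Lemma wiener_moment (s t : R) (xi : Omega -> R) k : 0 <= s -> s <= t -> (0 < k <= 3)%N ->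
  sub_measurable (F s) xi -> L1 P xi -> (forall w, 0 <= xi w) ->
  L1 P (fun w => xi w * `|W t w - W s w| ^+ k) /\
  Ex P (fun w => xi w * `|W t w - W s w| ^+ k) <=
    130 * Num.sqrt (t - s) ^+ k * Ex P xi.
Proof.
move=> s0 st k3 mxi ix xi0.
have [i1 e1] := wiener_increment_moment s0 st k3.
have mk : measurable_fun setT (fun x : R => `|x| ^+ k).
  by apply: measurable_funX; exact: normr_measurable.
have [i2 ->] := @wiener_L1M s t xi _ s0 st mxi mk ix i1.
by split => //; rewrite mulrC ler_wpM2r// Ex_ge0.
Qed.

End filtration.

(** * Lenglart's inequality *)

Section stochastic_sums.
Context {R : realType} {d : measure_display} {Omega : measurableType d}.
Variables (P : probability Omega R) (W : R -> {RV P >-> R}).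
Hypothesis hW : wiener_process W.
Notation F := (augmented_filtration P W).
Notation L1 := (L1 P).
Notation Ex := (Ex P).

Lemma sub_measurable_cst (t c : R) : sub_measurable (F t) (fun=> c).
Proof. by apply/sub_measurableP; exact: measurable_cst. Qed.

Lemma sub_measurableD t (f g : Omega -> R) : sub_measurable (F t) f ->
  sub_measurable (F t) g -> sub_measurable (F t) (fun w => f w + g w).
Proof. by move=> /sub_measurableP ? /sub_measurableP ?; apply/sub_measurableP; exact: measurable_funD. Qed.

Lemma sub_measurableB t (f g : Omega -> R) : sub_measurable (F t) f ->
  sub_measurable (F t) g -> sub_measurable (F t) (fun w => f w - g w).
Proof. by move=> /sub_measurableP ? /sub_measurableP ?; apply/sub_measurableP; exact: measurable_funB. Qed.

Lemma sub_measurableM t (f g : Omega -> R) : sub_measurable (F t) f ->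
  sub_measurable (F t) g -> sub_measurable (F t) (fun w => f w * g w).
Proof. by move=> /sub_measurableP ? /sub_measurableP ?; apply/sub_measurableP; exact: measurable_funM. Qed.

Lemma sub_measurable_comp t (g : R -> R) (f : Omega -> R) : measurable_fun setT g ->
  sub_measurable (F t) f -> sub_measurable (F t) (fun w => g (f w)).
Proof. by move=> mg /sub_measurableP mf; apply/sub_measurableP; exact: (measurableT_comp mg). Qed.

Lemma sub_measurable_sum t n (f : nat -> Omega -> R) :
  (forall i, (i < n)%N -> sub_measurable (F t) (f i)) ->
  sub_measurable (F t) (fun w => \sum_(i < n) f i w).
Proof.
elim: n => [|n IH] h.
  rewrite (_ : (fun w => _) = (fun=> 0)); first exact: sub_measurable_cst.
  by apply/funext => w; rewrite big_ord0.
rewrite (_ : (fun w => _) = (fun w => \sum_(i < n) f i w + f n w)); last first.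
  by apply/funext => w; rewrite big_ord_recr.
by apply: sub_measurableD; [apply: IH => i ni; apply: h; exact: ltnW|exact: h].
Qed.

Lemma sub_measurable_indic t (A : set Omega) : F t A ->
  sub_measurable (F t) (\1_A : Omega -> R).
Proof.
by move=> FA; apply/sub_measurableP; exact: (@measurable_indic _ (augmented_space W t)).
Qed.

Definition stoch_sum (c : nat -> Omega -> R) (u : nat -> R) n w :=
  \sum_(i < n) c i w * (W (u i.+1) w - W (u i) w).

Section isometry.
Variables (c : nat -> Omega -> R) (u : nat -> R) (n : nat).
Hypothesis u0 : 0 <= u 0%N.
Hypothesis u_mono : forall i, (i < n)%N -> u i <= u i.+1.
Hypothesis c_meas : forall i, (i < n)%N -> sub_measurable (F (u i)) (c i).
Hypothesis c_bnd : forall i, (i < n)%N -> exists M : R, forall w, `|c i w| <= M.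

Lemma mesh_le i j : (i <= j)%N -> (j <= n)%N -> u i <= u j.
Proof.
elim: j => [|j IH]; first by rewrite leqn0 => /eqP->.
rewrite leq_eqVlt => /predU1P[->//|ij jn].
by rewrite (le_trans (IH _ (ltnW jn)))// u_mono.
Qed.

Lemma mesh_ge0 i : (i <= n)%N -> 0 <= u i.
Proof. by move=> ni; rewrite (le_trans u0)// mesh_le. Qed.

Lemma stoch_sum_measurable m : (m <= n)%N ->
  sub_measurable (F (u m)) (stoch_sum c u m).
Proof.
move=> mn.
apply: (@sub_measurable_sum _ m (fun i w => c i w * (W (u i.+1) w - W (u i) w))) => i im.
have iN : (i < n)%N by exact: leq_trans mn.
apply: sub_measurableM.
  by apply: sub_measurableS (c_meas iN); apply: mesh_le => //; exact: ltnW.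
have i0 : 0 <= u i by apply: mesh_ge0; exact: ltnW.
have i1 : 0 <= u i.+1 by exact: mesh_ge0.
by apply: sub_measurableB; apply: wiener_adapted => //; apply: mesh_le => //; exact: ltnW.
Qed.

(** Ito's isometry as an inequality. The cross term 2 S c dW has mean 0, since S c is known at the
    left end of the step; the factor 130 is that of the crude second moment. *)
Lemma stoch_sum_isometry m : (m <= n)%N ->
  L1 (fun w => stoch_sum c u m w ^+ 2) /\
  Ex (fun w => stoch_sum c u m w ^+ 2) <=
    130 * Ex (fun w => \sum_(i < m) c i w ^+ 2 * (u i.+1 - u i)).
Proof.
elim: m => [_|m IH mn].
  rewrite /stoch_sum; under eq_fun do rewrite big_ord0 expr0n/=.
  under [X in _ /\ _ <= 130 * Ex X]eq_fun do rewrite big_ord0.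
  by rewrite Ex_cst mulr0; split => //; exact: L1_cst.
have [iS ES] := IH (ltnW mn).
have [M' cM'] := c_bnd mn.
pose M := `|M'|; have M0 : 0 <= M by exact: normr_ge0.
have cM w : `|c m w| <= M by rewrite (le_trans (cM' w))// ler_norm.
have mc := c_meas mn.
have mS := stoch_sum_measurable (ltnW mn).
have um0 := mesh_ge0 (ltnW mn).
have umm := u_mono mn.
have mS1 := sub_measurable_measurable mS.
have mc1 := sub_measurable_measurable mc.
have iS1 : L1 (stoch_sum c u m).
  apply: (@L1_le _ _ _ _ _ (fun w => 1 + stoch_sum c u m w ^+ 2)) => //.
    by apply: L1D => //; exact: L1_cst.
  move=> w; set x := stoch_sum _ _ _ _.
  have := sqr_ge0 (`|x| - 1); rewrite sqrrB1 real_normK ?num_real//.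
  by have := normr_ge0 x; lra.
have iSc : L1 (fun w => 2 * (stoch_sum c u m w * c m w)).
  apply: L1Z; apply: (@L1_le _ _ _ _ _ (fun w => M * `|stoch_sum c u m w|)).
  - exact: measurable_funM.
  - by apply: L1Z; exact: L1_norm.
  - by move=> w; rewrite normrM mulrC ler_wpM2r.
have mSc : sub_measurable (F (u m)) (fun w => 2 * (stoch_sum c u m w * c m w)).
  by apply: sub_measurableM; [exact: sub_measurable_cst|exact: sub_measurableM].
have ic2 : L1 (fun w => c m w ^+ 2).
  apply: (@L1_bounded _ _ _ _ _ (M ^+ 2)); first exact: measurable_funX.
  by move=> w; rewrite normrX ler_sqr ?nnegrE.
have mc2 : sub_measurable (F (u m)) (fun w => c m w ^+ 2).
  by apply: (@sub_measurable_comp _ (fun x => x ^+ 2)) => //; exact: measurable_funX.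
have [i1 e1] := wiener_mart hW um0 umm mSc iSc.
have [i2 e2] := @wiener_moment _ _ _ _ _ hW _ _ (fun w => c m w ^+ 2) 2 um0 umm isT mc2 ic2 (fun w => sqr_ge0 _).
have -> : (fun w => stoch_sum c u m.+1 w ^+ 2) = (fun w => stoch_sum c u m w ^+ 2 +
    2 * (stoch_sum c u m w * c m w) * (W (u m.+1) w - W (u m) w) +
    c m w ^+ 2 * `|W (u m.+1) w - W (u m) w| ^+ 2).
  apply/funext => w; rewrite {1}/stoch_sum big_ord_recr/= -/(stoch_sum c u m w).
  rewrite real_normK ?num_real//; ring.
split; first by apply: L1D => //; exact: L1D.
have iQ : L1 (fun w => \sum_(i < m) c i w ^+ 2 * (u i.+1 - u i)).
  apply: (@L1_sum _ _ _ _ _ (fun i w => c i w ^+ 2 * (u i.+1 - u i))) => i im.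
  have iN : (i < n)%N by exact: leq_trans (ltnW mn).
  have [Mi cMi] := c_bnd iN.
  under eq_fun do rewrite mulrC; apply: L1Z.
  apply: (@L1_bounded _ _ _ _ _ (Mi ^+ 2)).
    by apply: measurable_funX; exact: (sub_measurable_measurable (c_meas iN)).
  move=> w; rewrite normrX ler_sqr ?nnegrE//.
  by rewrite (le_trans _ (cMi w)).
have -> : (fun w => \sum_(i < m.+1) c i w ^+ 2 * (u i.+1 - u i)) =
    (fun w => \sum_(i < m) c i w ^+ 2 * (u i.+1 - u i) + (u m.+1 - u m) * c m w ^+ 2).
  by apply/funext => w; rewrite big_ord_recr/= [X in _ + X]mulrC.
rewrite ExD//; last exact: L1D.
rewrite ExD// e1 addr0 ExD//; last exact: L1Z.
rewrite ExZ// mulrDr lerD// mulrA.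
by rewrite sqr_sqrtr ?subr_ge0// in e2.
Qed.

End isometry.
End stochastic_sums.

(** * Lenglart's inequality for stochastic sums *)

Section lenglart.
Context {R : realType} {d : measure_display} {Omega : measurableType d}.
Variables (P : probability Omega R) (W : R -> {RV P >-> R}).
Hypothesis hW : wiener_process W.
Notation F := (augmented_filtration P W).
Notation L1 := (L1 P).
Notation Ex := (Ex P).
Notation Pr := (Pr P).

Lemma measurable_ge (f : Omega -> R) c : measurable_fun setT f ->
  measurable [set w | c <= f w].
Proof.
move=> mf; rewrite (_ : [set w | _] = f @^-1` `[c, +oo[); last first.
  by apply/seteqP; split => w /=; rewrite in_itv/= andbT.
by rewrite -[X in measurable X]setTI; apply: mf.
Qed.

Lemma measurable_gt (f : Omega -> R) c : measurable_fun setT f ->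
  measurable [set w | c < f w].
Proof.
move=> mf; rewrite (_ : [set w | _] = f @^-1` `]c, +oo[); last first.
  by apply/seteqP; split => w /=; rewrite in_itv/= andbT.
by rewrite -[X in measurable X]setTI; apply: mf.
Qed.

Section truncation.
Variables (c : nat -> Omega -> R) (u : nat -> R) (n : nat).
Hypothesis u0 : 0 <= u 0%N.
Hypothesis u_mono : forall i, (i < n)%N -> u i <= u i.+1.
Hypothesis c_meas : forall i, (i < n)%N -> sub_measurable (F (u i)) (c i).
Hypothesis c_bnd : forall i, (i < n)%N -> exists M : R, forall w, `|c i w| <= M.

Let Q m w := \sum_(i < m) c i w ^+ 2 * (u i.+1 - u i).

Let Q_le i m w : (i <= m)%N -> (m <= n)%N -> Q i w <= Q m w.
Proof.
elim: m => [|m IH]; first by rewrite leqn0 => /eqP->.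
rewrite leq_eqVlt => /predU1P[->//|im mn].
rewrite (le_trans (IH im (ltnW mn)))// /Q big_ord_recr/= lerDl.
by rewrite mulr_ge0 ?sqr_ge0// subr_ge0 u_mono.
Qed.

(** The quadratic variation is predictable: [Q m.+1] involves the coefficients up to [c m] only, all
    known at time [u m]. *)
Let Q_meas i m : (m < n)%N -> (i <= m.+1)%N -> sub_measurable (F (u m)) (Q i).
Proof.
move=> mn im.
apply: (@sub_measurable_sum _ _ _ _ _ _ _ (fun i w => c i w ^+ 2 * (u i.+1 - u i))) => j ji.
have jm : (j <= m)%N by rewrite -ltnS; exact: leq_trans im.
have jn : (j < n)%N by exact: leq_ltn_trans mn.
apply: sub_measurableM; last exact: sub_measurable_cst.
apply: (@sub_measurable_comp _ _ _ _ _ _ (fun x => x ^+ 2)); first exact: measurable_funX.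
by apply: sub_measurableS (c_meas jn); apply: (mesh_le u_mono) => //; exact: ltnW.
Qed.

(* The sum is stopped before its quadratic variation exceeds dl. *)
Lemma stoch_sum_lenglart (dl e : R) : 0 < dl -> 0 < e ->
  Pr [set w | e <= `|stoch_sum W c u n w|] <=
  Pr [set w | dl < \sum_(i < n) c i w ^+ 2 * (u i.+1 - u i)] + 130 * dl / e ^+ 2.
Proof.
move=> dl0 e0.
(* The index i.+1 includes the i-th term itself, so the stopped variation never exceeds [dl];
   predictability still makes the indicator an admissible factor at time [u i]. *)
pose A i := [set w | Q i.+1 w <= dl].
pose c' i w := c i w * \1_(A i) w.
have A_meas i : (i < n)%N -> F (u i) (A i).
  move=> ni; have := @Q_meas i.+1 i ni (leqnn _).
  move=> /(_ `]-oo, dl]%classic (measurable_itv _)).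
  rewrite (_ : Q i.+1 @^-1` `]-oo, dl]%classic = A i)//.
have c'_meas i : (i < n)%N -> sub_measurable (F (u i)) (c' i).
  move=> ni; apply: sub_measurableM; first exact: c_meas.
  by apply: sub_measurable_indic; exact: A_meas.
have ind01 (B : set Omega) w : \1_B w = 0 :> R \/ \1_B w = 1 :> R.
  by rewrite indicE; case: (_ \in _); [right|left].
have c'_le i w : `|c' i w| <= `|c i w|.
  by rewrite /c' normrM; case: (ind01 (A i) w) => ->; rewrite ?normr0 ?normr1 ?mulr0 ?mulr1.
have c'_bnd i : (i < n)%N -> exists M : R, forall w, `|c' i w| <= M.
  by move=> /c_bnd[M cM]; exists M => w; exact: le_trans (cM w).
have Q'_le m w : (m <= n)%N -> \sum_(i < m) c' i w ^+ 2 * (u i.+1 - u i) <= dl.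
  elim: m => [_|m IH mn]; first by rewrite big_ord0 ltW.
  have [Am|Am] := pselect (A m w).
    apply: le_trans Am; apply: ler_sum => i _.
    have mi : (i < n)%N by exact: leq_trans mn.
    rewrite ler_wpM2r ?subr_ge0 ?u_mono//.
    by rewrite -[leLHS]real_normK ?num_real// -[leRHS]real_normK ?num_real// ler_sqr ?nnegrE.
  rewrite big_ord_recr/= {2}/c' indicE memNset// mulr0 expr0n/= mul0r addr0.
  exact: IH (ltnW mn).
have S_eq w : ~ dl < Q n w -> stoch_sum W c u n w = stoch_sum W c' u n w.
  move=> /negP; rewrite -leNgt => Qw; apply: eq_bigr => i _; rewrite /c'.
  rewrite indicE mem_set ?mulr1// /A /=; apply: le_trans Qw; exact: Q_le.
have [i2 e2] := stoch_sum_isometry hW u0 u_mono c'_meas c'_bnd (leqnn n).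
have mS := sub_measurable_measurable (stoch_sum_measurable u0 u_mono c_meas (leqnn n)).
have mS' := sub_measurable_measurable (stoch_sum_measurable u0 u_mono c'_meas (leqnn n)).
have mQ : measurable_fun setT (Q n).
  case: (posnP n) => [n0|n0].
    by rewrite (_ : Q n = fun=> 0)//; apply/funext => w; rewrite /Q n0 big_ord0.
  have nn : (n.-1 < n)%N by rewrite prednK.
  by apply: (sub_measurable_measurable (Q_meas nn _)); rewrite prednK.
have mabs (g : Omega -> R) : measurable_fun setT g -> measurable_fun setT (fun w => `|g w|).
  by move=> mg; exact: (measurableT_comp (@normr_measurable _ setT)).
apply: (@le_trans _ _ (Pr ([set w | dl < Q n w] `|` [set w | e <= `|stoch_sum W c' u n w|]))).
  apply: Pr_le.
  - by apply: measurable_ge; exact: mabs.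
  - apply: measurableU; first exact: measurable_gt.
    by apply: measurable_ge; exact: mabs.
  - move=> w /= ew; have [|Qw] := pselect (dl < Q n w); first by left.
    by right; rewrite /= -S_eq.
apply: (le_trans (PrU _ _ _)).
- exact: measurable_gt.
- by apply: measurable_ge; exact: mabs.
rewrite lerD2l (le_trans (markov_sqr mS' i2 e0))//.
rewrite ler_wpM2r ?invr_ge0 ?sqr_ge0// (le_trans e2)// ler_pM2l//.
rewrite -[leRHS](Ex_cst P).
have iQ' : L1 (fun w => \sum_(i < n) c' i w ^+ 2 * (u i.+1 - u i)).
  apply: (@L1_bounded _ _ _ _ _ dl).
    apply: measurable_sum => i.
    apply: measurable_funM => //; apply: measurable_funX.
    exact: (sub_measurable_measurable (c'_meas i (ltn_ord i))).
  move=> w; rewrite ger0_norm ?Q'_le//; apply: sumr_ge0 => i _.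
  by rewrite mulr_ge0 ?sqr_ge0// subr_ge0 u_mono.
by apply: Ex_le => //; [exact: L1_cst|move=> w; exact: Q'_le].
Qed.

End truncation.

Section step_function.
Variables (u : nat -> R) (n : nat).
Hypothesis u_mono : forall i, (i < n)%N -> u i <= u i.+1.

(** The sum is the integral over the half-open interval ]u 0, u n], summed cell by cell; passing to
    the closed interval can only increase it. *)
Lemma step_integral_ge (c : nat -> R) (v : R -> R) :
  measurable_fun [set: measurableTypeR R] (v : measurableTypeR R -> R) ->
  (forall i s, (i < n)%N -> u i < s <= u i.+1 -> v s = c i) ->
  ((\sum_(i < n) c i ^+ 2 * (u i.+1 - u i))%:E <=
   \int[lebesgue_measure]_(s in `[u 0%N, u n]) ((v s) ^+ 2)%:E)%E.
Proof.
move=> mv vc.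
have mv2 : measurable_fun [set: measurableTypeR R] (fun s : measurableTypeR R => (v s ^+ 2)%:E).
  by apply/measurable_EFinP; exact: measurable_funX.
suff H m : (m <= n)%N -> ((\sum_(i < m) c i ^+ 2 * (u i.+1 - u i))%:E =
   \int[lebesgue_measure]_(s in `]u 0%N, u m]) ((v s) ^+ 2)%:E)%E.
  rewrite H//; apply: ge0_subset_integral => //.
  - exact: measurable_funTS.
  - by move=> s _; rewrite lee_fin sqr_ge0.
  - by move=> s /=; rewrite !in_itv/= => /andP[/ltW-> ->].
elim: m => [_|m IH mn].
  by rewrite big_ord0 set_itvoc0 integral_set0.
rewrite big_ord_recr/= EFinD (IH (ltnW mn)).
have u0m : u 0%N <= u m by apply: (mesh_le u_mono) => //; exact: ltnW.
rewrite (@itv_bndbnd_setU _ _ (BRight (u 0%N)) (BRight (u m)) (BRight (u m.+1))) ?bnd_simp ?u_mono//.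
rewrite ge0_integral_setU//=.
- congr (_ + _)%E.
  rewrite (eq_integral (fun=> (c m ^+ 2)%:E)); last first.
    by move=> s; rewrite inE/= in_itv/= => us; rewrite (vc m).
  rewrite integral_cst// EFinM; congr (_ * _)%E.
  transitivity (@lebesgue_measure R `]u m, u m.+1]%classic); last by [].
  rewrite lebesgue_measure_itv/= lte_fin.
  case: ltP => // h.
  by rewrite (_ : u m.+1 = u m) ?subrr//; apply/eqP; rewrite eq_le h u_mono.
- exact: measurable_funTS.
- by move=> s _; rewrite lee_fin sqr_ge0.
- apply/disj_setPS => y [/=]; rewrite !in_itv/= => /andP[_ yx] /andP[xy _].
  by move: xy; rewrite ltNge yx.
Qed.

End step_function.
End lenglart.

Lemma indic_itvoc (R : realType) (a b x : R) :
  \1_(`]a, b]) x = (if a < x <= b then 1 else 0) :> R.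
Proof. by rewrite indicE mem_setE in_itv/=; case: ifP. Qed.

(** * Linear combinations of simple processes on different partitions *)

Section merge.
Context {R : realType} {d : measure_display} {Omega : measurableType d}.
Variables (P : probability Omega R) (W : R -> {RV P >-> R}).
Hypothesis hW : wiener_process W.
Notation F := (augmented_filtration P W).
Local Notation process := (@simple_process R d Omega).
Variables (t : R) (hs : seq (R * process)).
Hypothesis t0 : 0 <= t.
Hypothesis hsF : forall p, List.In p hs -> simple_on F t p.2.

(** Lenglart's inequality must hit the difference of several simple processes at once, each with its
    own partition. Membership is [List.In] because simple processes carry no decidable equality. *)
Definition comb_value (s : R) (w : Omega) : R :=
  \sum_(p <- hs) p.1 * simple_value p.2 s w.
Definition comb_integral (w : Omega) : R :=
  \sum_(p <- hs) p.1 * simple_integral W p.2 w.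

(* The common refinement of the partitions underlying the processes in hs. *)
Let pts : seq R := 0 :: t :: flatten [seq mkseq (sp_time p.2) (sp_size p.2).+1 | p <- hs].
Let L : seq R := sort <=%R pts.
Let u (k : nat) : R := nth 0 L k.
Let N := (size L).-1.

Let sizeL : size L = N.+1.
Proof. by rewrite /N /L size_sort. Qed.

Let simple_time_le (p : R * process) i j : List.In p hs -> (i <= j)%N ->
  (j <= sp_size p.2)%N -> sp_time p.2 i <= sp_time p.2 j.
Proof.
move=> /hsF[_ _ h]; elim: j => [|j IH]; first by rewrite leqn0 => /eqP->.
rewrite leq_eqVlt => /predU1P[->//|ij jn].
by rewrite (le_trans (IH _ (ltnW jn)))//; have [] := h _ jn.
Qed.

Let ptsP x : x \in pts -> 0 <= x <= t.
Proof.
rewrite !inE => /or3P[/eqP->|/eqP->|]; rewrite ?lexx ?t0//.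
move: hsF simple_time_le; rewrite /pts; elim: hs => [//|p s IH] H1 H2.
rewrite map_cons (_ : flatten (_ :: _) = mkseq (sp_time p.2) (sp_size p.2).+1 ++ flatten [seq mkseq (sp_time q.2) (sp_size q.2).+1 | q <- s])// mem_cat => /orP[|]; last first.
  by apply: IH => [q sq|q i j sq]; [apply: H1; right|apply: H2; right].
case/mapP => i; rewrite mem_iota add0n ltnS => /andP[_ ip] ->.
have [<- <- _] := H1 p (or_introl erefl).
by rewrite !H2//; left.
Qed.

Let u_mono k : (k < N)%N -> u k <= u k.+1.
Proof.
move=> kN; have sL : sorted <=%R L by apply: sort_sorted; exact: le_total.
by apply: (sorted_leq_nth le_trans le_refl 0 sL) => //; rewrite inE sizeL ltnS// ltnW.
Qed.

Let u_le i j : (i <= j)%N -> (j <= N)%N -> u i <= u j.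
Proof. exact: (mesh_le u_mono). Qed.

Let uP x : x \in pts -> exists2 k, (k <= N)%N & u k = x.
Proof.
rewrite -(mem_sort <=%R) -/L => xL; exists (index x L); last exact: nth_index.
by rewrite -ltnS -sizeL index_mem.
Qed.

Let u_pts k : (k <= N)%N -> 0 <= u k <= t.
Proof.
by move=> kN; apply: ptsP; rewrite -(mem_sort <=%R) mem_nth// -/L sizeL ltnS.
Qed.

Let u0 : u 0%N = 0.
Proof.
have [k kN uk] := @uP 0 (mem_head _ _).
apply/eqP; rewrite eq_le -{1}uk u_le//=.
by have /andP[] := u_pts (leq0n N).
Qed.

Let uN : u N = t.
Proof.
have [|k kN uk] := @uP t; first by rewrite !inE eqxx orbT.
apply/eqP; rewrite eq_le -{2}uk u_le// andbT.
by have /andP[] := u_pts (leqnn N).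
Qed.

Let u_time p i : List.In p hs -> (i <= sp_size p.2)%N ->
  exists2 k, (k <= N)%N & u k = sp_time p.2 i.
Proof.
move=> hp ip; apply: uP; rewrite !inE; apply/orP; right; apply/orP; right.
elim: hs hp => [//|q s IH] qs.
rewrite map_cons (_ : flatten (_ :: _) = mkseq (sp_time q.2) (sp_size q.2).+1 ++
  flatten [seq mkseq (sp_time q.2) (sp_size q.2).+1 | q <- s])// mem_cat; apply/orP.
case: qs => [->|sp]; last by right; exact: IH.
by left; apply/mapP; exists i => //; rewrite mem_iota.
Qed.

(** No point of the refined partition lies strictly inside one of its cells. *)
Let mesh_gap a k : (exists2 j, (j <= N)%N & u j = a) -> (k < N)%N ->
  a < u k.+1 -> a <= u k.
Proof.
move=> [j jN <-] kN juk; apply: u_le; last exact: ltnW.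
by rewrite leqNgt; apply/negP => kj; move: juk; rewrite ltNge u_le.
Qed.

Let indic_mesh p i k s : List.In p hs -> (i < sp_size p.2)%N -> (k < N)%N ->
  u k < s <= u k.+1 ->
  \1_(`]sp_time p.2 i, sp_time p.2 i.+1]) s = \1_(`]sp_time p.2 i, sp_time p.2 i.+1]) (u k.+1) :> R.
Proof.
move=> hp ip kN /andP[us su].
rewrite !indic_itvoc; congr (if _ then _ else _).
apply/idP/idP => /andP[h1 h2]; apply/andP; split.
- exact: lt_le_trans su.
- rewrite leNgt; apply/negP => h; have := mesh_gap (u_time hp ip) kN h.
  by rewrite leNgt (lt_le_trans us h2).
- exact: (le_lt_trans (mesh_gap (u_time hp (ltnW ip)) kN h1)).
- exact: le_trans h2.
Qed.

Let comb_value_mesh k s w : (k < N)%N -> u k < s <= u k.+1 ->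
  comb_value s w = comb_value (u k.+1) w.
Proof.
move=> kN us; rewrite /comb_value.
have : forall p, List.In p hs -> simple_value p.2 s w = simple_value p.2 (u k.+1) w.
  move=> p hp; apply: eq_bigr => i _; congr (_ * _).
  exact: (indic_mesh hp (ltn_ord i) kN us).
elim: hs => [|p l IH] H; first by rewrite !big_nil.
by rewrite !big_cons H ?IH//; [move=> q hq; apply: H; right|left].
Qed.

(** Freezing the argument of f outside [a, b] kills the increments over the cells that the indicator
    discards, and the sum telescopes. *)
Let telescope_mesh (f : R -> R) a b : (exists2 j, (j <= N)%N & u j = a) ->
  (exists2 j, (j <= N)%N & u j = b) -> a <= b ->
  \sum_(k < N) \1_(`]a, b]) (u k.+1) * (f (u k.+1) - f (u k)) = f b - f a.
Proof.
move=> ja jb ab.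
pose g x := f (Order.min (Order.max x a) b).
transitivity (\sum_(k < N) (g (u k.+1) - g (u k))).
  apply: eq_bigr => k _; rewrite indic_itvoc.
  have uk := u_mono (ltn_ord k).
  case: ifPn => [/andP[au ub]|].
    rewrite mul1r /g.
    have ak := mesh_gap ja (ltn_ord k) au.
    rewrite (max_idPl (ltW au)) (min_idPl ub) (max_idPl ak) (min_idPl _)//.
    exact: le_trans ub.
  rewrite mul0r negb_and -leNgt -ltNge => /orP[ua|bu].
    by rewrite /g (max_idPr ua) (max_idPr (le_trans uk ua)) subrr.
  have bk := mesh_gap jb (ltn_ord k) bu.
  rewrite /g (min_idPr _); last by rewrite le_max (ltW bu).
  by rewrite (min_idPr _) ?subrr// le_max bk.
rewrite -(big_mkord xpredT (fun k => g (u k.+1) - g (u k))) telescope_sumr//.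
rewrite u0 uN /g; congr (f _ - f _).
  case: jb => j jN ju; have /andP[_ bt] := u_pts jN.
  by rewrite (min_idPr _)// le_max -ju bt.
case: ja => j jN ju; have /andP[a0 _] := u_pts jN.
by rewrite (max_idPr _) ?(min_idPl ab)// -ju.
Qed.

Let comb_integral_mesh w :
  comb_integral w = stoch_sum W (fun k => comb_value (u k.+1)) u N w.
Proof.
rewrite /comb_integral /stoch_sum.
have H p : List.In p hs -> simple_integral W p.2 w =
    \sum_(k < N) simple_value p.2 (u k.+1) w * (W (u k.+1) w - W (u k) w).
  move=> hp; under eq_bigr do rewrite /simple_value mulr_suml.
  rewrite exchange_big/=; apply: eq_bigr => i _.
  under eq_bigr do rewrite -mulrA; rewrite -mulr_sumr; congr (_ * _).
  rewrite (@telescope_mesh (fun s => W s w))//.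
  - by apply: u_time => //; exact: ltnW.
  - exact: u_time.
  - by apply: simple_time_le.
rewrite /comb_value; under [RHS]eq_bigr do rewrite mulr_suml.
rewrite exchange_big/=.
elim: hs H => [|p l IH] H; first by rewrite !big_nil.
rewrite !big_cons IH ?H//; first by rewrite mulr_sumr; congr (_ + _); apply: eq_bigr => k _; rewrite mulrA.
- by left.
- by move=> q hq; apply: H; right.
Qed.

(** The value on a cell is read at its right end because the intervals are left-open. It is
    nevertheless known at the left end: an interval containing [u k.+1] starts no later than
    [u k]. *)
Let comb_value_meas k : (k < N)%N -> sub_measurable (F (u k)) (comb_value (u k.+1)).
Proof.
move=> kN.
have H p : List.In p hs -> sub_measurable (F (u k)) (simple_value p.2 (u k.+1)).
  move=> hp.
  apply: (@sub_measurable_sum _ _ _ _ _ _ _ (fun i w => sp_coef p.2 i w *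
    \1_(`]sp_time p.2 i, sp_time p.2 i.+1]) (u k.+1))) => i ip.
  have [_ _ /(_ i ip)[_ mc _]] := hsF hp.
  rewrite indic_itvoc; case: ifPn => [/andP[tu _]|_]; last first.
    rewrite (_ : (fun w => _) = fun=> 0); first exact: sub_measurable_cst.
    by apply/funext => w; rewrite mulr0.
  apply: sub_measurableM; last exact: sub_measurable_cst.
  apply: sub_measurableS mc; apply: (mesh_gap _ kN tu).
  by apply: u_time => //; exact: ltnW.
rewrite /comb_value; elim: hs H => [|p l IH] H.
  rewrite (_ : (fun w => _) = fun=> 0); first exact: sub_measurable_cst.
  by apply/funext => w; rewrite big_nil.
rewrite (_ : (fun w => _) = (fun w => p.1 * simple_value p.2 (u k.+1) w +
  \sum_(q <- l) q.1 * simple_value q.2 (u k.+1) w)); last first.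
  by apply/funext => w; rewrite big_cons.
apply: sub_measurableD; last by apply: IH => q hq; apply: H; right.
by apply: sub_measurableM; [exact: sub_measurable_cst|apply: H; left].
Qed.

Let comb_value_bnd k : exists M : R, forall w, `|comb_value (u k.+1) w| <= M.
Proof.
have H p : List.In p hs -> exists M : R, forall w, `|simple_value p.2 (u k.+1) w| <= M.
  move=> hp; have [_ _ h] := hsF hp; rewrite /simple_value.
  elim: (sp_size p.2) h => [|n IH] h.
    by exists 0 => w; rewrite big_ord0 normr0.
  have [|M HM] := IH; first by move=> i ni; apply: h; exact: ltnW.
  have [_ _ [M' HM']] := h n (leqnn _).
  exists (M + M') => w; rewrite big_ord_recr/= (le_trans (ler_normD _ _))// lerD//.
  rewrite normrM (le_trans _ (HM' w))// ler_piMr// indicE.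
  by case: (_ \in _); rewrite ?normr1 ?normr0.
rewrite /comb_value; elim: hs H => [|p l IH] H.
  by exists 0 => w; rewrite big_nil normr0.
have [|M HM] := IH; first by move=> q hq; apply: H; right.
have [|M' HM'] := H p; first by left.
exists (`|p.1| * M' + M) => w; rewrite big_cons (le_trans (ler_normD _ _))// lerD//.
by rewrite normrM ler_wpM2l.
Qed.

Lemma comb_value_measurable w :
  measurable_fun [set: measurableTypeR R] (comb_value ^~ w : measurableTypeR R -> R).
Proof.
rewrite /comb_value; apply: measurable_sum => p.
apply: measurable_funM => //; apply: measurable_sum => i.
by apply: measurable_funM => //; exact: measurable_indic.
Qed.

Lemma comb_integral_measurable : measurable_fun setT comb_integral.
Proof.
rewrite (_ : comb_integral = stoch_sum W (fun k => comb_value (u k.+1)) u N); last first.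
  by apply/funext => w; exact: comb_integral_mesh.
apply: (@sub_measurable_measurable _ _ _ _ W (u N)).
apply: (@stoch_sum_measurable _ _ _ _ _ _ _ N) => //; first by rewrite u0.
Qed.

(** [stoch_sum_lenglart] on the common refinement, where [step_integral_ge] replaces the discrete
    quadratic variation by the time integral. *)
Lemma comb_lenglart (dl e : R) : 0 < dl -> 0 < e ->
  (P [set w | (e <= `|comb_integral w|)%R] <=
   mu_ext P [set w | (dl%:E < \int[lebesgue_measure]_(s in `[0%R, t]) ((comb_value s w ^+ 2)%R)%:E)%E]
   + ((130 * dl / e ^+ 2)%R)%:E)%E.
Proof.
move=> dl0 e0.
have mS := comb_integral_measurable.
have u00 : 0 <= u 0%N by rewrite u0.
have := @stoch_sum_lenglart _ _ _ _ _ hW _ u N u00 u_mono comb_value_meas (fun i _ => comb_value_bnd i) dl e dl0 e0.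
set A := [set w | e <= _]; set B := [set w | dl < _] => AB.
have AE : A = [set w | e <= `|comb_integral w|].
  by apply/seteqP; split => w; rewrite /A /= comb_integral_mesh.
have mA : measurable A.
  by rewrite AE; apply: measurable_ge; exact: (measurableT_comp (@normr_measurable _ setT)).
have mB : measurable B.
  apply: measurable_gt; apply: measurable_sum => i; apply: measurable_funM => //.
  apply: measurable_funX; exact: (sub_measurable_measurable (comb_value_meas (ltn_ord i))).
rewrite -AE (PrE _ mA).
apply: (@le_trans _ _ ((Pr P B)%:E + (130 * dl / e ^+ 2)%:E)%E).
  by rewrite -EFinD lee_fin.
rewrite leeD2r// -PrE// -measurable_mu_extE//; apply: le_mu_ext => w.
rewrite /B /= -lte_fin => /lt_le_trans; apply.
have := @step_integral_ge _ u N u_mono (fun i => comb_value (u i.+1) w) (comb_value ^~ w)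
  (comb_value_measurable w) (fun i s iN us => comb_value_mesh w iN us).
by rewrite u0 uN.
Qed.

End merge.

Section outer.
Context {R : realType} {d : measure_display} {Omega : measurableType d}.
Variables (P : probability Omega R).
Notation Po := (mu_ext P).

Lemma outer_le (A B : set Omega) : A `<=` B -> (Po A <= Po B)%E.
Proof. exact: le_mu_ext. Qed.

Lemma outerU (A B : set Omega) : (Po (A `|` B) <= Po A + Po B)%E.
Proof. exact: outer_measureU2. Qed.

Lemma outerE (A : set Omega) : measurable A -> Po A = P A.
Proof. exact: measurable_mu_extE. Qed.

Lemma outer_negligible (A : set Omega) : P.-negligible A -> Po A = 0%E.
Proof.
move=> [B [mB PB AB]]; apply/eqP; rewrite eq_le mu_ext_ge0// andbT.
by rewrite (le_trans (outer_le AB))// outerE// PB.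
Qed.

Lemma cvg0_lt (f : nat -> \bar R) (e : R) : 0 < e -> f @ \oo --> 0%E ->
  \forall k \near \oo, (f k < e%:E)%E.
Proof.
move=> e0 f0; have : nbhs 0%E [set x : \bar R | (x < e%:E)%E].
  apply: open_nbhs_nbhs; split; first exact: open_ereal_lt_ereal.
  by rewrite /= lte_fin.
by move=> /f0.
Qed.

End outer.

(** * Passage from simple integrands to Ito integrals *)

Section lenglart_ito.
Context {R : realType} {d : measure_display} {Omega : measurableType d}.
Variables (P : probability Omega R) (W : R -> {RV P >-> R}).
Hypothesis hW : wiener_process W.
Notation F := (augmented_filtration P W).
Notation Po := (mu_ext P).
Notation mu := (@lebesgue_measure R).

Lemma simple_value_measurable (h : @simple_process R d Omega) w :
  measurable_fun [set: measurableTypeR R] (fun s : measurableTypeR R => simple_value h s w).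
Proof.
apply: measurable_sum => i.
by apply: measurable_funM => //; exact: measurable_indic.
Qed.

(** (x - y - z)^2 <= 3 (x^2 + y^2 + z^2) with x the error against the integrands and y, z those of
    their approximations. Dividing [dl] by a^2 + 1 absorbs the coefficients, so each of the three
    integrals is at most [dl]: hence 9 = 3 * 3. *)
Lemma integral_sqr_comb_le (t a1 a2 dl : R) (e h g H1 H2 : R -> R) : 0 < dl ->
  measurable_fun [set: measurableTypeR R] (e : measurableTypeR R -> R) ->
  measurable_fun [set: measurableTypeR R] (h : measurableTypeR R -> R) ->
  measurable_fun [set: measurableTypeR R] (g : measurableTypeR R -> R) ->
  measurable_fun `[0, t] (H1 : measurableTypeR R -> R) ->
  measurable_fun `[0, t] (H2 : measurableTypeR R -> R) ->
  (\int[mu]_(s in `[0%R, t]) ((e s - (a1 * H1 s + a2 * H2 s)) ^+ 2)%:E < dl%:E)%E ->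
  (\int[mu]_(s in `[0%R, t]) ((h s - H1 s) ^+ 2)%:E < (dl / (a1 ^+ 2 + 1))%:E)%E ->
  (\int[mu]_(s in `[0%R, t]) ((g s - H2 s) ^+ 2)%:E < (dl / (a2 ^+ 2 + 1))%:E)%E ->
  (\int[mu]_(s in `[0%R, t]) ((e s - a1 * h s - a2 * g s) ^+ 2)%:E <= (9 * dl)%:E)%E.
Proof.
move=> dl0 me mh mg mH1 mH2 I0 I1 I2.
have me' := measurable_funTS me; have mh' := measurable_funTS mh; have mg' := measurable_funTS mg.
pose D := `[0, t]%classic : set (measurableTypeR R).
have mA : measurable_fun D (fun s => ((e s - (a1 * H1 s + a2 * H2 s)) ^+ 2)%:E).
  apply/measurable_EFinP/measurable_funX; apply: measurable_funB; first exact: me'.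
  by apply: measurable_funD; exact: measurable_funM.
have mB (h' H' : R -> R) : measurable_fun D h' -> measurable_fun D H' ->
    measurable_fun D (fun s => ((h' s - H' s) ^+ 2)%:E).
  by move=> ? ?; apply/measurable_EFinP/measurable_funX; exact: measurable_funB.
have mZ (c : R) (f : R -> \bar R) : measurable_fun D f -> measurable_fun D (fun s => c%:E * f s)%E.
  by move=> ?; exact: emeasurable_funM.
apply: (@le_trans _ _ (\int[mu]_(s in D) (3%:E * (((e s - (a1 * H1 s + a2 * H2 s)) ^+ 2)%:E +
   ((a1 ^+ 2)%:E * ((h s - H1 s) ^+ 2)%:E + (a2 ^+ 2)%:E * ((g s - H2 s) ^+ 2)%:E))))%E).
  apply: ge0_le_integral => //.
  - by move=> s _; rewrite lee_fin sqr_ge0.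
  - apply/measurable_EFinP/measurable_funX; apply: measurable_funB; last by apply: measurable_funM => //; exact: mg'.
    by apply: measurable_funB; [exact: me'|apply: measurable_funM => //; exact: mh'].
  - apply: (mZ); apply: emeasurable_funD => //; apply: emeasurable_funD; apply: (mZ); apply: (mB) => //.
  - move=> s _.
    rewrite -[leRHS]/((3 * ((e s - (a1 * H1 s + a2 * H2 s)) ^+ 2 +
      (a1 ^+ 2 * (h s - H1 s) ^+ 2 + a2 ^+ 2 * (g s - H2 s) ^+ 2)))%:E) lee_fin.
    set x := e s - (a1 * H1 s + a2 * H2 s); set y := h s - H1 s; set z := g s - H2 s.
    have -> : e s - a1 * h s - a2 * g s = x - a1 * y - a2 * z by rewrite /x /y /z; ring.
    rewrite -!exprMn; set y' := a1 * y; set z' := a2 * z.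
    have := sqr_ge0 (x + y'); have := sqr_ge0 (x + z'); have := sqr_ge0 (y' - z'); nra.
have s0 (x : R) : (0 <= (x ^+ 2)%:E)%E by rewrite lee_fin sqr_ge0.
have m1 : measurable_fun D (fun s => ((h s - H1 s) ^+ 2)%:E) by apply: (mB).
have m2 : measurable_fun D (fun s => ((g s - H2 s) ^+ 2)%:E) by apply: (mB).
have n1 s : (0 <= (a1 ^+ 2)%:E * ((h s - H1 s) ^+ 2)%:E)%E by rewrite mule_ge0.
have n2 s : (0 <= (a2 ^+ 2)%:E * ((g s - H2 s) ^+ 2)%:E)%E by rewrite mule_ge0.
have m12 : measurable_fun D (fun s => (a1 ^+ 2)%:E * ((h s - H1 s) ^+ 2)%:E +
    (a2 ^+ 2)%:E * ((g s - H2 s) ^+ 2)%:E)%E.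
  by apply: emeasurable_funD; apply: (mZ).
have n12 s : (0 <= (a1 ^+ 2)%:E * ((h s - H1 s) ^+ 2)%:E +
    (a2 ^+ 2)%:E * ((g s - H2 s) ^+ 2)%:E)%E by rewrite adde_ge0.
have mD : measurable D by exact: measurable_itv.
rewrite ge0_integralZl; [|exact: mD|exact: emeasurable_funD|by move=> s _; exact: adde_ge0|by rewrite lee_fin].
rewrite ge0_integralD; [|exact: mD|by move=> s _|exact: mA|by move=> s _|exact: m12].
rewrite ge0_integralD; [|exact: mD|by move=> s _|exact: mZ|by move=> s _|exact: mZ].
rewrite !ge0_integralZl//.
have bnd (a : R) (I : \bar R) : (0 <= I)%E -> (I < (dl / (a ^+ 2 + 1))%:E)%E ->
    ((a ^+ 2)%:E * I <= dl%:E)%E.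
  move=> I0' Ilt; have a1p : 0 < a ^+ 2 + 1 by rewrite ltr_wpDl ?sqr_ge0.
  apply: (@le_trans _ _ ((a ^+ 2)%:E * (dl / (a ^+ 2 + 1))%:E)%E).
    by apply: lee_wpmul2l => //; exact: ltW.
  rewrite -EFinM lee_fin mulrA ler_pdivrMr// mulrC ler_wpM2l ?(ltW dl0)//.
  by rewrite lerDl.
have -> : (9 * dl)%:E = (3%:E * (dl%:E + (dl%:E + dl%:E)))%E.
  by rewrite -!EFinD -EFinM; congr EFin; ring.
apply: lee_wpmul2l; first by rewrite lee_fin.
apply: leeD; first exact: ltW.
by apply: leeD; apply: bnd => //; apply: integral_ge0 => s _.
Qed.

(** Both integrals are replaced by simple ones at the cost of an arbitrarily small [eta], and half
    of 2 c is spent on that replacement. Two integrals are treated together because the noise of the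
    difference process is a combination of two, which spares the linearity of the Ito integral. *)
Lemma lenglart_ito (t a1 a2 : R) (H1 H2 : R -> Omega -> R) (Z1 Z2 : Omega -> R)
    (e : simple_process) (dl c : R) : 0 <= t -> 0 < dl -> 0 < c ->
  ito_integral W t H1 Z1 -> ito_integral W t H2 Z2 -> simple_on F t e ->
  (Po [set w | (2 * c <= `|simple_integral W e w - (a1 * Z1 w + a2 * Z2 w)|)%R] <=
   Po [set w | dl%:E <= \int[mu]_(s in `[0%R, t])
      (((simple_value e s w - (a1 * H1 s w + a2 * H2 s w)) ^+ 2)%R)%:E] +
   ((130 * (9 * dl) / c ^+ 2)%R)%:E)%E.
Proof.
move=> t0 dl0 c0 [_ mH1 _ [h [hF hH hZ]]] [_ mH2 _ [g [gF gH gZ]]] eF.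
set A := [set w | (2 * c <= _)%R]; set B := [set w | (dl%:E <= _)%E].
apply/lee_addgt0Pr => eta eta0.
(* Chosen so that |a| r <= c / 2: the two approximation errors then use up c. Likewise [q] below
   satisfies a^2 q <= dl. *)
pose r (a : R) := c / (2 * (`|a| + 1)).
have a1p (a : R) : 0 < `|a| + 1 by rewrite ltr_wpDl.
have r0 a : 0 < r a by rewrite divr_gt0// mulr_gt0.
pose q (a : R) := dl / (a ^+ 2 + 1).
have q0 a : 0 < q a by rewrite divr_gt0// ltr_wpDl ?sqr_ge0.
have eta4 : 0 < eta / 4 by rewrite divr_gt0.
have [k [hHk hZk gHk gZk]] : exists k,
  [/\ (Po [set w | (q a1)%:E <= \int[mu]_(s in `[0%R, t]) ((simple_value (h k) s w - H1 s w) ^+ 2)%:E] < (eta / 4)%:E)%E,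
      (Po [set w | (r a1)%:E <= `|simple_integral W (h k) w - Z1 w|%:E] < (eta / 4)%:E)%E,
      (Po [set w | (q a2)%:E <= \int[mu]_(s in `[0%R, t]) ((simple_value (g k) s w - H2 s w) ^+ 2)%:E] < (eta / 4)%:E)%E &
      (Po [set w | (r a2)%:E <= `|simple_integral W (g k) w - Z2 w|%:E] < (eta / 4)%:E)%E].
  near \oo => k; exists k; split; near: k.
  - exact: (cvg0_lt eta4 (hH _ (q0 a1))).
  - exact: (cvg0_lt eta4 (hZ _ (r0 a1))).
  - exact: (cvg0_lt eta4 (gH _ (q0 a2))).
  - exact: (cvg0_lt eta4 (gZ _ (r0 a2))).
set h1 := [set w | _] in hHk; set h2 := [set w | _] in hZk.
set g1 := [set w | _] in gHk; set g2 := [set w | _] in gZk.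
pose hs := [:: (1, e); (- a1, h k); (- a2, g k)].
have hsF p : List.In p hs -> simple_on F t p.2.
  by move=> [<-|[<-|[<-|[]]]]; rewrite /=.
have d9 : 0 < 9 * dl by rewrite mulr_gt0.
have := comb_lenglart hW t0 hsF d9 c0.
set A' := [set w | _]; set B' := [set w | (_ < _)%E] => AB.
have mA' : measurable A'.
  apply: measurable_ge; apply: (measurableT_comp (@normr_measurable _ setT)).
  exact: comb_integral_measurable t0 hsF.
pose Nl := [set w | ~ (measurable_fun `[0, t] (H1 ^~ w) /\ measurable_fun `[0, t] (H2 ^~ w))].
have Nl0 : Po Nl = 0%E.
  apply: outer_negligible.
  exact: (@filterI _ (almost_everywhere P) _ _ _ mH1 mH2).
have sub1 : A `<=` A' `|` (h2 `|` g2).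
  move=> w Aw; have [|nh] := pselect (h2 w); first by right; left.
  have [|ng] := pselect (g2 w); first by right; right.
  left; rewrite /A' /= /comb_integral /hs !big_cons big_nil /= addr0 mul1r.
  move: nh ng => /negP; rewrite lee_fin -ltNge => nh /negP; rewrite lee_fin -ltNge => ng.
  have bnd a (x : R) : `|x| < r a -> `|a * x| <= c / 2.
    move=> xr; rewrite normrM; apply: (@le_trans _ _ (`|a| * r a)).
      by rewrite ler_wpM2l// ltW.
    rewrite /r mulrA ler_pdivrMr ?mulr_gt0//.
    by have := normr_ge0 a; nra.
  have b1 := bnd _ _ nh; have b2 := bnd _ _ ng.
  move: Aw; rewrite /A /=.
  set E := simple_integral W e w; set Hk := simple_integral W (h k) w in b1 *; set G := simple_integral W (g k) w in b2 *.
  have -> : E - (a1 * Z1 w + a2 * Z2 w) = (E + (- a1 * Hk + - a2 * G)) + (a1 * (Hk - Z1 w) + a2 * (G - Z2 w)) by ring.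
  move=> le2c; have := le_trans le2c (le_trans (ler_normD _ _) (lerD (lexx _) (ler_normD _ _))).
  lra.
have sub2 : B' `<=` B `|` (h1 `|` (g1 `|` Nl)).
  move=> w Bw; have [|nB] := pselect (B w); first by left.
  have [|nh] := pselect (h1 w); first by right; left.
  have [|ng] := pselect (g1 w); first by right; right; left.
  have [|/contrapT[m1 m2]] := pselect (Nl w); first by right; right; right.
  exfalso; move: nB nh ng => /negP; rewrite -ltNge => nB /negP; rewrite -ltNge => nh /negP; rewrite -ltNge => ng.
  have := @integral_sqr_comb_le t a1 a2 dl (simple_value e ^~ w) (simple_value (h k) ^~ w) (simple_value (g k) ^~ w) (H1 ^~ w) (H2 ^~ w)
    dl0 (simple_value_measurable _ _) (simple_value_measurable _ _) (simple_value_measurable _ _) m1 m2 nB nh ng.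
  apply/negP; rewrite -ltNge; apply: (lt_le_trans Bw).
  rewrite le_eqVlt; apply/orP; left; apply/eqP; apply: eq_integral => s _.
  congr (_ ^+ 2)%:E; rewrite /comb_value /hs !big_cons big_nil /=; ring.
apply: (le_trans (outer_le P sub1)).
apply: (le_trans (outerU P _ _)); rewrite outerE//.
apply: (le_trans (leeD AB (outerU P _ _))).
apply: (le_trans (leeD (leeD (outer_le P sub2) (lexx _)) (lexx _))).
have -> : eta%:E = ((eta / 4)%:E + (eta / 4)%:E + ((eta / 4)%:E + (eta / 4)%:E))%E.
  by rewrite -!EFinD; congr EFin; lra.
have U4 : (Po (B `|` (h1 `|` (g1 `|` Nl))) <= Po B + ((eta / 4)%:E + (eta / 4)%:E))%E.
  apply: (le_trans (outerU P _ _)); rewrite leeD2l//.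
  apply: (le_trans (outerU P _ _)); apply: leeD; first exact: ltW.
  apply: (le_trans (outerU P _ _)); rewrite Nl0 adde0; exact: ltW.
apply: (le_trans (leeD (leeD U4 (lexx _)) (leeD (ltW hZk) (ltW gZk)))).
by rewrite (addeAC (Po B)) -[leLHS]addeA.
Unshelve. all: by end_near. Qed.

End lenglart_ito.

(** * Continuous paths and the Euler scheme *)

Section paths.
Context {R : realType}.
Variables (f : R -> R) (t : R).
Hypothesis t0 : 0 < t.
Hypothesis cf : {within `[0, +oo[, continuous f}.

Lemma within_continuous_dist (s e : R) : 0 <= s -> 0 < e -> exists2 rho : R, 0 < rho &
  forall r : R, 0 <= r -> `|s - r| < rho -> `|f s - f r| < e.
Proof.
move=> s0 e0; have /subspace_continuousP /(_ s) := cf.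
rewrite /= in_itv/= andbT => /(_ s0) /cvgrPdist_lt /(_ e e0).
rewrite near_withinE => /nbhs_ballP[rho /= rho0 H]; exists rho => // r r0 sr.
by apply: H => //; rewrite /= in_itv/= r0.
Qed.

Lemma rat_approx (s e rho : R) : 0 <= s <= t -> 0 < e -> 0 < rho ->
  exists q : rat, [/\ 0 <= (ratr q : R) <= t, `|s - ratr q| < rho & `|f s - f (ratr q)| < e].
Proof.
move=> /andP[s0 st] e0 rho0.
have [r1 r10 H] := within_continuous_dist s0 e0.
pose r2 := Order.min rho r1.
have r20 : 0 < r2 by rewrite lt_min rho0 r10.
have /rat_in_itvoo[q] : Order.max 0 (s - r2) < Order.min t (s + r2).
  by rewrite gt_max !lt_min t0 ltr_pwDr//=; apply/andP; split; lra.
rewrite in_itv/= gt_max lt_min => /andP[/andP[q0 q1] /andP[q2 q3]].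
have sq : `|s - ratr q| < r2 by rewrite ltr_norml; lra.
move: (sq); rewrite {1}/r2 lt_min => /andP[sq1 sq2].
exists q; split => //; first by rewrite !ltW.
by apply: H => //; exact: ltW.
Qed.

(** Uniform continuity by compactness, scaled to a mesh t / m. The strict bound by 2 t leaves room
    on two sides: it includes pairs in one closed cell, and it survives a small move to rational
    times. *)
Lemma continuous_modulus (e : R) : 0 < e -> \forall m \near \oo, forall s r : R,
  0 <= s <= t -> 0 <= r <= t -> `|s - r| * m%:R < 2 * t -> `|f s - f r| <= e.
Proof.
move=> e0.
pose Q (m : nat) (s : R) := forall r : R, 0 <= s <= t ->
  0 <= r <= t -> `|s - r| * m%:R < 2 * t -> `|f s - f r| <= e.
have cK : compact (`[0, t] : set R) by exact: segment_compact.
have /compact_near_coveringP /(_ nat \oo Q _) cov := cK.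
have : \forall m \near \oo, (`[0, t] : set R) `<=` Q m.
  apply: cov => x /=; rewrite in_itv/= => /andP[x0 xt].
  have e20 : 0 < e / 2 by rewrite divr_gt0.
  have [rho rho0 H] := within_continuous_dist x0 e20.
  have rho20 : 0 < rho / 2 by rewrite divr_gt0.
  near=> s m => /= r /andP[s0 st] /andP[r0 rt] srm.
  have xs : `|x - s| < rho / 2 by near: s; exact: (nbhsx_ballx x _ rho20).
  have m0 : 0 < m%:R :> R by rewrite ltr0n; near: m; exact: nbhs_infty_gt.
  have mbig : 2 * t / (rho / 2) < m%:R by near: m; exact: nbhs_infty_gtr.
  have sr : `|s - r| < rho / 2.
    rewrite -(ltr_pM2r m0) (lt_trans srm)//.
    by move: mbig; rewrite ltr_pdivrMr// [m%:R * _]mulrC.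
  have xr : `|x - r| < rho.
    rewrite (_ : x - r = (x - s) + (s - r)); last by ring.
    by rewrite (le_lt_trans (ler_normD _ _))//; lra.
  have h1 : `|f x - f s| < e / 2 by apply: H => //; lra.
  have h2 : `|f x - f r| < e / 2 by exact: H.
  rewrite (_ : f s - f r = - (f x - f s) + (f x - f r)); last by ring.
  by rewrite (le_trans (ler_normD _ _))// normrN; lra.
by apply: filterS => m H s r st rt sr; apply: (H s) => //.
Unshelve. all: by end_near. Qed.

(** Chaining: [0, t] is crossed in k.+1 steps on each of which f varies by at most 1. *)
Lemma continuous_bounded : \forall m \near \oo, forall s : R,
  0 <= s <= t -> `|f s| <= m%:R.
Proof.
have [k _ /(_ k (leqnn k)) H] := @continuous_modulus 1 ltr01.
have H' (s r : R) : 0 <= s <= t -> 0 <= r <= t -> `|s - r| * k.+1%:R <= t -> `|f s - f r| <= 1.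
  move=> st rt sr; apply: H => //.
  have t2 : t < 2 * t by rewrite ltr_pMl// ltr1n.
  apply: le_lt_trans t2.
  by apply: le_trans sr; rewrite ler_wpM2l// ler_nat.
pose g i := i%:R * t / k.+1%:R : R.
have k0 : 0 < k.+1%:R :> R by rewrite ltr0n.
have gt i : (i <= k.+1)%N -> 0 <= g i <= t.
  move=> ik; rewrite /g; apply/andP; split.
    by rewrite divr_ge0 ?mulr_ge0// ltW.
  by rewrite ler_pdivrMr// mulrC ler_wpM2l ?ler_nat// ltW.
have gS i : g i.+1 = g i + t / k.+1%:R by rewrite /g -natr1; field; rewrite gt_eqF.
have B i : (i <= k.+1)%N -> `|f (g i)| <= `|f 0| + i%:R.
  elim: i => [_|i IH ik]; first by rewrite /g !mul0r addr0.
  have := H' (g i.+1) (g i) (gt _ ik) (gt _ (ltnW ik)).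
  rewrite gS addrAC subrr add0r gtr0_norm ?divr_gt0// divfK ?gt_eqF// => /(_ (lexx _)) h.
  rewrite -gS in h *; rewrite -natr1 addrA.
  rewrite (_ : f (g i.+1) = f (g i) + (f (g i.+1) - f (g i))); last by ring.
  by rewrite (le_trans (ler_normD _ _))// lerD// IH// ltnW.
have C : \forall m \near \oo, `|f 0| + k.+1%:R + 1 < m%:R by exact: nbhs_infty_gtr.
apply: filterS C => m mB s st.
pose i := Num.trunc (s * k.+1%:R / t).
have sk0 : 0 <= s * k.+1%:R / t.
  by case/andP: st => s0 _; rewrite divr_ge0 ?mulr_ge0// ltW.
have /andP[i1 i2] := truncn_itv sk0.
have ik : (i <= k.+1)%N.
  rewrite -(ler_nat R) (le_trans i1)// ler_pdivrMr// mulrC ler_wpM2l ?(ltW k0)//.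
  by case/andP: st.
have gs : g i <= s < g i.+1.
  rewrite /g ler_pdivrMr// ltr_pdivlMr//.
  by rewrite -ler_pdivlMr// -ltr_pdivrMr// i1 i2.
have sg : `|s - g i| * k.+1%:R <= t.
  case/andP: gs => g1 g2; rewrite ger0_norm ?subr_ge0//.
  by rewrite -ler_pdivlMr// lerBlDl -gS ltW.
have h := H' s (g i) st (gt _ ik) sg.
rewrite (_ : f s = (f s - f (g i)) + f (g i)); last by ring.
rewrite (le_trans (ler_normD _ _))// (le_trans (lerD h (B _ ik)))//.
have ik' : i%:R <= k.+1%:R :> R by rewrite ler_nat.
lra.
Unshelve. all: by end_near. Qed.

End paths.

Section path_events.
Context {R : realType} {d : measure_display} {Omega : measurableType d}.
Variable P : probability Omega R.
Notation Po := (mu_ext P).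
Variables (f : R -> Omega -> R) (t : R).
Hypothesis t0 : 0 < t.
Hypothesis mf : forall s : R, 0 <= s -> measurable_fun setT (f s).
Hypothesis cf : continuous_paths P f.

Lemma countable_bigcup_measurable (I : countType) (A : set I) (E : I -> set Omega) :
  (forall i, A i -> measurable (E i)) ->
  measurable (\bigcup_(i in A) E i).
Proof.
move=> mE; rewrite bigcup_mkcond; apply: countable_bigcupT_measurable => [|i].
  exact: countableP.
by case: ifPn => // /set_mem; exact: mE.
Qed.

(* Only rational times are used, to make these events measurable; this loses
   nothing on continuous paths. *)
Definition exceeds (m : nat) : set Omega :=
  \bigcup_(q in [set q : rat | 0 <= (ratr q : R) <= t]) [set w | m%:R < `|f (ratr q) w|].

Definition oscillates (e : R) (m : nat) : set Omega :=
  \bigcup_(q in [set q : rat * rat | [/\ 0 <= (ratr q.1 : R) <= t, 0 <= (ratr q.2 : R) <= t &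
     `|ratr q.1 - ratr q.2 : R| * m%:R < 2 * t]])
   [set w | e < `|f (ratr q.1) w - f (ratr q.2) w|].

Lemma exceeds_measurable m : measurable (exceeds m).
Proof.
apply: countable_bigcup_measurable => q /= /andP[q0 _].
by apply: measurable_gt; apply: (measurableT_comp (@normr_measurable _ setT)); exact: mf.
Qed.

Lemma oscillates_measurable e m : measurable (oscillates e m).
Proof.
apply: countable_bigcup_measurable => q /= [/andP[q0 _] /andP[q1 _] _].
apply: measurable_gt; apply: (measurableT_comp (@normr_measurable _ setT)).
by apply: measurable_funB; exact: mf.
Qed.

Lemma exceedsN w m : {within `[0, +oo[, continuous (f ^~ w)} -> ~ exceeds m w ->
  forall s : R, 0 <= s <= t -> `|f s w| <= m%:R.
Proof.
move=> cw nE s st; rewrite leNgt; apply/negP => h.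
have e0 : 0 < `|f s w| - m%:R by rewrite subr_gt0.
have [q [qt _ fq]] := rat_approx t0 cw st e0 ltr01.
apply: nE; exists q => //=.
have := ler_normD (f s w - f (ratr q) w) (f (ratr q) w); rewrite subrK; lra.
Qed.

Lemma oscillatesN w (e : R) m : {within `[0, +oo[, continuous (f ^~ w)} -> ~ oscillates e m w ->
  forall s r : R, 0 <= s <= t -> 0 <= r <= t -> `|s - r| * m%:R < 2 * t ->
  `|f s w - f r w| <= e.
Proof.
move=> cw nE s r st rt sr; rewrite leNgt; apply/negP => h.
pose e' := (`|f s w - f r w| - e) / 2.
have e'0 : 0 < e' by rewrite divr_gt0// subr_gt0.
(* Moving both times by less than [rho] costs at most 2 rho m, which is below the slack 2 t - |s -
   r| m; the + 1 covers m = 0. *)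
pose rho := (2 * t - `|s - r| * m%:R) / (2 * (m%:R + 1)).
have m0 : 0 <= m%:R :> R by exact: ler0n.
have rho0 : 0 < rho by rewrite divr_gt0 ?subr_gt0// mulr_gt0// ltr_wpDl.
have [q1 [q1t q1s q1f]] := rat_approx t0 cw st e'0 rho0.
have [q2 [q2t q2r q2f]] := rat_approx t0 cw rt e'0 rho0.
apply: nE; exists (q1, q2); rewrite /=.
  split => //.
  have h1 : `|ratr q1 - ratr q2 : R| <= `|s - r| + 2 * rho.
    rewrite (_ : ratr q1 - ratr q2 = - (s - ratr q1) + ((s - r) + (r - ratr q2))); last by ring.
    have := ler_normD (- (s - ratr q1)) ((s - r) + (r - ratr q2)).
    have := ler_normD (s - r) (r - ratr q2); rewrite normrN; lra.
  have h2 : 2 * rho * m%:R < 2 * t - `|s - r| * m%:R.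
    rewrite (_ : _ * _ = (2 * t - `|s - r| * m%:R) * (m%:R / (m%:R + 1))); last first.
      by rewrite /rho; field; rewrite gt_eqF// ltr_wpDl.
    rewrite gtr_pMr ?subr_gt0//.
    by rewrite ltr_pdivrMr ?ltr_wpDl// mul1r ltrDl.
  have := ler_wpM2r m0 h1; rewrite mulrDl; lra.
have : `|f s w - f r w| <= `|f s w - f (ratr q1) w| + (`|f (ratr q1) w - f (ratr q2) w| + `|f r w - f (ratr q2) w|).
  rewrite {1}(_ : f s w - f r w = (f s w - f (ratr q1) w) + ((f (ratr q1) w - f (ratr q2) w) - (f r w - f (ratr q2) w))); last by ring.
  by rewrite (le_trans (ler_normD _ _))// lerD2l ler_normB.
rewrite /e' in q1f q2f; lra.
Qed.

Lemma cvg_measure0 (E : nat -> set Omega) : (forall m, measurable (E m)) ->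
  (forall m, E m.+1 `<=` E m) -> {ae P, forall w, \forall m \near \oo, ~ E m w} ->
  P (E m) @[m --> \oo] --> 0%E.
Proof.
move=> mE dE aeE.
have mI : measurable (\bigcap_m E m) by exact: bigcapT_measurable.
have <- : P (\bigcap_m E m) = 0%E.
  apply: measure_negligible => //.
  apply: negligibleS aeE => w Ew /= [k _ /(_ k (leqnn k))]; apply.
  exact: Ew.
apply: nonincreasing_cvg_mu => //.
- by rewrite -ge0_fin_numE// fin_num_measure.
- apply/nonincreasing_seqP => m; exact/subsetPset.
Qed.

Lemma exceeds_cvg : P (exceeds m) @[m --> \oo] --> 0%E.
Proof.
apply: cvg_measure0.
- exact: exceeds_measurable.
- move=> m w [q qt /= h]; exists q => //=; apply: le_lt_trans h.
  by rewrite ler_nat.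
- apply: filterS cf => w cw; have := continuous_bounded t0 cw.
  by apply: filterS => m H [q qt /=]; rewrite ltNge H.
Qed.

Lemma oscillates_cvg (e : R) : 0 < e -> P (oscillates e m) @[m --> \oo] --> 0%E.
Proof.
move=> e0; apply: cvg_measure0.
- exact: oscillates_measurable.
- move=> m w [q [q1 q2 q12] /= h]; exists q => //=; split => //.
  by apply: le_lt_trans q12; rewrite ler_wpM2l// ler_nat.
- apply: filterS cf => w cw; have := continuous_modulus t cw e0.
  by apply: filterS => m H [q [q1 q2 q12] /=]; rewrite ltNge H.
Qed.

End path_events.

(** * The uniform grid, clipping and Riemann sums *)

Section grid.
Context {R : realType}.
Variable t : R.
Hypothesis t0 : 0 < t.

Definition grid (m i : nat) : R := i%:R * t / m%:R.

Definition clip (N x : R) : R := Order.max (- N) (Order.min N x).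

Lemma clip_id N x : `|x| <= N -> clip N x = x.
Proof.
by rewrite ler_norml /clip => /andP[h1 h2]; rewrite (min_idPr h2) (max_idPr h1).
Qed.

Lemma clip_le N x : 0 <= N -> `|clip N x| <= N.
Proof.
move=> N0; rewrite /clip ler_norml le_max lexx/= ge_max ge_min lexx/= andbT.
by lra.
Qed.

Lemma measurable_clip N : measurable_fun setT (clip N).
Proof. by apply: measurable_maxr => //; exact: measurable_minr. Qed.

Lemma grid0 m : grid m 0 = 0.
Proof. by rewrite /grid !mul0r. Qed.

Lemma gridS m i : grid m i.+1 = grid m i + t / m%:R.
Proof. by rewrite /grid -natr1 !mulrDl mul1r. Qed.

Lemma grid_ge0 m i : 0 <= grid m i.
Proof. by rewrite /grid divr_ge0// mulr_ge0// ltW. Qed.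

Lemma grid_le m i j : (i <= j)%N -> grid m i <= grid m j.
Proof.
by move=> ij; rewrite /grid ler_wpM2r ?invr_ge0// ler_wpM2r ?(ltW t0)// ler_nat.
Qed.

Lemma gridm m : (0 < m)%N -> grid m m = t.
Proof. by move=> m0; rewrite /grid mulrAC divff ?mul1r// pnatr_eq0 -lt0n. Qed.

Lemma grid_in m i : (0 < m)%N -> (i <= m)%N -> 0 <= grid m i <= t.
Proof. by move=> m0 im; rewrite grid_ge0/= -(gridm m0) grid_le. Qed.

Lemma grid_cell m i s : 0 < s <= grid m i ->
  exists2 j, (j < i)%N & grid m j < s <= grid m j.+1.
Proof.
elim: i => [|i IH]; first by rewrite grid0 => /andP[s0 /(lt_le_trans s0)]; rewrite ltxx.
move=> /andP[s0 si]; have [si'|si'] := leP s (grid m i).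
  by have [j ji] := IH (introT andP (conj s0 si')); exists j => //; exact: leqW.
by exists i => //; rewrite si'.
Qed.

Section riemann.
Variables (f : R -> R) (m : nat) (e : R).
Hypothesis m0 : (0 < m)%N.
Hypothesis e0 : 0 <= e.
Hypothesis cf : {within `[0, +oo[, continuous f}.
Hypothesis osc : forall j s, (j < m)%N -> grid m j <= s <= grid m j.+1 ->
  `|f s - f (grid m j)| <= e.
Notation mu := (@lebesgue_measure R).

Lemma continuous_path_integrable s : 0 <= s -> mu.-integrable `[0, s] (EFin \o f).
Proof.
move=> s0; apply: continuous_compact_integrable; first exact: segment_compact.
apply: continuous_subspaceW cf => x /=; rewrite !in_itv/= andbT.
by move=> /andP[].
Qed.

Lemma continuous_path_measurable s :
  measurable_fun (`[0, s]%classic : set (measurableTypeR R)) (f : measurableTypeR R -> R).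
Proof.
have [s0|s0] := leP 0 s.
  by have /measurable_int/measurable_EFinP := continuous_path_integrable s0.
by rewrite set_itv_ge ?bnd_simp -?ltNge//; exact: measurable_fun_set0.
Qed.

Lemma riemann_sum i : (i <= m)%N ->
  `|\int[mu]_(s in `[0, grid m i]) f s - \sum_(j < i) f (grid m j) * (t / m%:R)|
  <= grid m i * e.
Proof.
elim: i => [_|i IH im].
  by rewrite grid0 set_itv1 Rintegral_set1 big_ord0 subrr normr0 mul0r.
have gi := grid_ge0 m i.
have ii := continuous_path_integrable (grid_ge0 m i.+1).
have gii : grid m i <= grid m i.+1 by exact: grid_le.
have D0 : 0 <= t / m%:R by rewrite divr_ge0// ltW.
have E : \int[mu]_(s in `[0, grid m i.+1]) f s =
    \int[mu]_(s in `[0, grid m i]) f s + \int[mu]_(s in `]grid m i, grid m i.+1]) f s.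
  by rewrite -(Rintegral_itvB (x := grid m i) ii) ?bnd_simp// addrCA subrr addr0.
rewrite E big_ord_recr/=.
have I1 : mu.-integrable `]grid m i, grid m i.+1] (EFin \o f).
  apply: integrableS ii => // x /=; rewrite !in_itv/= => /andP[xi ->].
  by rewrite (le_trans gi (ltW xi)).
have lm : fine (mu `]grid m i, grid m i.+1]%classic) = t / m%:R.
  rewrite lebesgue_measure_itv/= lte_fin gridS ltrDl divr_gt0 ?ltr0n//=.
  by rewrite addrAC subrr add0r.
have lmy : (mu `]grid m i, grid m i.+1]%classic < +oo)%E.
  by rewrite lebesgue_measure_itv/=; case: ifP => _; rewrite ?ltry.
have Ic (c : R) : mu.-integrable `]grid m i, grid m i.+1] (EFin \o cst c).
  apply/integrableP; split; first by apply/measurable_EFinP; exact: measurable_cst.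
  rewrite (eq_integral (cst (`|c|%:E))) ?integral_cst//.
  by rewrite lte_mul_pinfty// lee_fin.
have mD : measurable (`]grid m i, grid m i.+1]%classic : set (measurableTypeR R)).
  exact: measurable_itv.
have C : `|\int[mu]_(s in `]grid m i, grid m i.+1]) f s - f (grid m i) * (t / m%:R)| <=
    (t / m%:R) * e.
  rewrite -lm -(Rintegral_cst mu mD) -RintegralB//; last exact: Ic.
  apply: (le_trans (le_normr_Rintegral _ _)) => //.
    by have := integrableB mD I1 (Ic (f (grid m i))).
  apply: (@le_trans _ _ (\int[mu]_(s in `]grid m i, grid m i.+1]) e)); last first.
    by rewrite Rintegral_cst// lm mulrC.
  apply: le_Rintegral => //.
  - by have := integrable_norm (integrableB mD I1 (Ic (f (grid m i)))).
  - exact: Ic.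
  - by move=> s /=; rewrite in_itv/= => /andP[s1 s2]; apply: osc => //; rewrite s2 ltW.
set A := \int[mu]_(s in `[0, grid m i]) f s; set B := \int[mu]_(s in `]grid m i, _]) f s in C *.
set S := \sum_(j < i) _.
rewrite (_ : A + B - _ = (A - S) + (B - f (grid m i) * (t / m%:R))); last by ring.
by rewrite (le_trans (ler_normD _ _))// gridS mulrDl lerD// IH// ltnW.
Qed.

(** Closeness is asked for s > 0 only, since left-open cells leave time 0 uncovered; this single
    point has measure zero. *)
Lemma step_sqr_integral (v : R -> R) i : (i <= m)%N ->
  measurable_fun [set: measurableTypeR R] (v : measurableTypeR R -> R) ->
  (forall s, 0 < s <= grid m i -> `|v s - f s| <= e) ->
  (\int[mu]_(s in `[0%R, grid m i]) ((v s - f s) ^+ 2)%:E <= (t * e ^+ 2)%:E)%E.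
Proof.
move=> im mv ve.
have mvf : measurable_fun (`]0, grid m i]%classic : set (measurableTypeR R))
    (fun s => (v s - f s) ^+ 2).
  apply: measurable_funX; apply: measurable_funB; first exact: measurable_funTS.
  apply: (measurable_funS _ _ (@continuous_path_measurable (grid m i))); first exact: measurable_itv.
  by move=> x /=; rewrite !in_itv/= => /andP[/ltW-> ->].
rewrite -integral_itv_obnd_cbnd; last exact/measurable_EFinP.
apply: (@le_trans _ _ (\int[mu]_(s in `]0%R, grid m i]) (e ^+ 2)%:E)%E).
  apply: ge0_le_integral => //.
  - by move=> s _; rewrite lee_fin sqr_ge0.
  - exact/measurable_EFinP.
  - move=> s /=; rewrite in_itv/= lee_fin => /ve h.
    by rewrite -[leLHS]real_normK ?num_real// ler_sqr ?nnegrE.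
rewrite integral_cst//= lebesgue_measure_itv/= lte_fin.
have /andP[g0 gt] := grid_in m0 im.
case: ifP => _; last by rewrite mule0 lee_fin mulr_ge0 ?sqr_ge0// ltW.
by rewrite -EFinD -EFinM lee_fin subr0 mulrC ler_wpM2r// sqr_ge0.
Qed.

End riemann.
End grid.

(** * The clipped Euler scheme and its convergence in probability *)

Section euler.
Context {R : realType} {d : measure_display} {Omega : measurableType d}.
Variables (P : probability Omega R) (W : R -> {RV P >-> R}).
Notation F := (augmented_filtration P W).
Notation Po := (mu_ext P).
Notation mu := (@lebesgue_measure R).
Variables (x0 : R) (al be M D : R -> Omega -> R) (kap : R).
Hypothesis kap0 : 0 < kap.
Hypothesis al_adapted : adapted F al.
Hypothesis be_adapted : adapted F be.
Hypothesis D_adapted : adapted F D.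
Hypothesis al_cont : continuous_paths P al.
Hypothesis be_cont : continuous_paths P be.
(* All that is needed to know about the stochastic integral M of be. *)
Hypothesis M_lenglart : forall s (e : simple_process) dl c, 0 <= s -> 0 < dl -> 0 < c ->
  simple_on F s e ->
  (Po [set w | (2 * c <= `|simple_integral W e w - M s w|)%R] <=
   Po [set w | dl%:E <= \int[mu]_(r in `[0%R, s])
      (((simple_value e r w - be r w) ^+ 2)%R)%:E] +
   ((kap * dl / c ^+ 2)%R)%:E)%E.
Hypothesis D_eq : {ae P, forall w, forall s, 0 <= s ->
  D s w = x0 + \int[mu]_(r in `[0, s]) al r w + M s w}.
Variable t : R.
Hypothesis t0 : 0 < t.

Definition euler (a c : nat -> Omega -> R) (m i : nat) (w : Omega) : R :=
  x0 + \sum_(j < i) (a j w * (t / m%:R) + c j w * (W (grid t m j.+1) w - W (grid t m j) w)).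

(** Clipping at m makes the noise coefficients bounded, as a simple process requires. It does
    nothing to paths bounded by m on [0, t], whose probability tends to 1. *)
Definition clipped_euler (m : nat) : nat -> Omega -> R :=
  euler (fun j w => clip m%:R (al (grid t m j) w)) (fun j w => clip m%:R (be (grid t m j) w)) m.

Lemma eulerS a c m i w : euler a c m i.+1 w = euler a c m i w +
  (a i w * (t / m%:R) + c i w * (W (grid t m i.+1) w - W (grid t m i) w)).
Proof. by rewrite /euler big_ord_recr/= addrA. Qed.

Lemma euler_adapted a c m i :
  (forall j, (j < i)%N -> sub_measurable (F (grid t m j)) (a j)) ->
  (forall j, (j < i)%N -> sub_measurable (F (grid t m j)) (c j)) ->
  sub_measurable (F (grid t m i)) (euler a c m i).
Proof.
move=> ma mc; apply: sub_measurableD; first exact: sub_measurable_cst.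
apply: (@sub_measurable_sum _ _ _ _ _ _ _ (fun j w => a j w * (t / m%:R) +
  c j w * (W (grid t m j.+1) w - W (grid t m j) w))) => j ji.
have le1 : grid t m j <= grid t m i by apply: grid_le => //; exact: ltnW.
apply: sub_measurableD.
  by apply: sub_measurableM; [exact: sub_measurableS (ma _ ji)|exact: sub_measurable_cst].
apply: sub_measurableM; first exact: sub_measurableS (mc _ ji).
by apply: sub_measurableB; apply: wiener_adapted => //; [exact: grid_ge0|exact: grid_le|exact: grid_ge0].
Qed.

Lemma clipped_euler_adapted m i :
  sub_measurable (F (grid t m i)) (clipped_euler m i).
Proof.
apply: euler_adapted => j _; apply: sub_measurable_comp; do ?[exact: measurable_clip].
- by apply: al_adapted; exact: grid_ge0.
- by apply: be_adapted; exact: grid_ge0.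
Qed.

Lemma clipped_euler_error_measurable m i (c : R) :
  measurable [set w | c <= `|clipped_euler m i w - D (grid t m i) w|].
Proof.
apply: measurable_ge; apply: (measurableT_comp (@normr_measurable _ setT)).
apply: measurable_funB; first exact: (sub_measurable_measurable (@clipped_euler_adapted m i)).
apply: (sub_measurable_measurable (P := P) (W := W) (t := grid t m i)).
by apply: D_adapted; exact: grid_ge0.
Qed.

(** Off an event of small probability no coefficient is clipped and both vary by at most [e] on each
    cell. The drift error is then that of a Riemann sum, and the noise error is controlled by
    [M_lenglart] with a squared error below [dl]. *)
Lemma clipped_euler_close (c eta : R) : 0 < c -> 0 < eta ->
  \forall m \near \oo, forall i, (i <= m)%N ->
  Pr P [set w | c <= `|clipped_euler m i w - D (grid t m i) w|] <= eta.
Proof.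
move=> c0 eta0.
(* Of c = 3 c', the noise may use 2 c', and the drift error t e is at most c' / 2. [dl] makes kap dl
   / c'^2 equal to eta / 2, and e <= 1 gives t e^2 <= t e < dl. *)
pose c' := c / 3; have c'0 : 0 < c' by rewrite divr_gt0.
pose dl := eta * c' ^+ 2 / (2 * kap).
have dl0 : 0 < dl by rewrite divr_gt0 ?mulr_gt0// exprn_gt0.
pose e := Order.min 1 (Order.min c' dl / (2 * t)).
have e0 : 0 < e.
  by rewrite lt_min ltr01/= divr_gt0 ?mulr_gt0// lt_min c'0.
have e1 : e <= 1 by rewrite ge_min lexx.
have te : t * e <= Order.min c' dl / 2.
  apply: (@le_trans _ _ (t * (Order.min c' dl / (2 * t)))).
    by rewrite ler_pM2l// ge_min lexx orbT.
  by rewrite le_eqVlt; apply/orP; left; apply/eqP; field; rewrite gt_eqF.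
have minc : Order.min c' dl <= c' by rewrite ge_min lexx.
have mind : Order.min c' dl <= dl by rewrite ge_min lexx orbT.
have te2 : t * e ^+ 2 <= t * e by rewrite ler_pM2l// expr2 ler_piMl// ltW.
have mal s : 0 <= s -> measurable_fun setT (al s).
  by move=> s0; apply: (sub_measurable_measurable (P := P) (W := W) (t := s)); exact: al_adapted.
have mbe s : 0 <= s -> measurable_fun setT (be s).
  by move=> s0; apply: (sub_measurable_measurable (P := P) (W := W) (t := s)); exact: be_adapted.
(* Four bad events give eta / 4, counted twice: once directly, once inside the Lenglart bound, whose
   last term is eta / 2. *)
have eta16 : 0 < eta / 16 by rewrite divr_gt0.
have n1 := cvg0_lt eta16 (exceeds_cvg t0 mal al_cont).
have n2 := cvg0_lt eta16 (exceeds_cvg t0 mbe be_cont).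
have n3 := cvg0_lt eta16 (oscillates_cvg t mal al_cont e0).
have n4 := cvg0_lt eta16 (oscillates_cvg t mbe be_cont e0).
near=> m => i im.
have p1 : (P (exceeds al t m) < (eta / 16)%:E)%E by near: m.
have p2 : (P (exceeds be t m) < (eta / 16)%:E)%E by near: m.
have p3 : (P (oscillates al t e m) < (eta / 16)%:E)%E by near: m.
have p4 : (P (oscillates be t e m) < (eta / 16)%:E)%E by near: m.
have m0 : (0 < m)%N by near: m; exact: nbhs_infty_gt.
pose B1 := exceeds al t m; pose B2 := exceeds be t m.
pose B3 := oscillates al t e m; pose B4 := oscillates be t e m.
pose Nl := [set w | ~ ({within `[0, +oo[, continuous (al ^~ w)} /\
   ({within `[0, +oo[, continuous (be ^~ w)} /\
   forall s, 0 <= s -> D s w = x0 + \int[mu]_(r in `[0, s]) al r w + M s w))].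
have Nl0 : Po Nl = 0%E.
  apply: outer_negligible.
  exact: (@filterI _ (almost_everywhere P) _ _ _ al_cont (@filterI _ (almost_everywhere P) _ _ _ be_cont D_eq)).
pose Bad := (B1 `|` B2) `|` ((B3 `|` B4) `|` Nl).
have PB : (Po Bad <= (eta / 4)%:E)%E.
  have h1 : (Po B1 <= (eta / 16)%:E)%E.
    by rewrite outerE; [exact: ltW p1|exact: exceeds_measurable].
  have h2 : (Po B2 <= (eta / 16)%:E)%E.
    by rewrite outerE; [exact: ltW p2|exact: exceeds_measurable].
  have h3 : (Po B3 <= (eta / 16)%:E)%E.
    by rewrite outerE; [exact: ltW p3|exact: oscillates_measurable].
  have h4 : (Po B4 <= (eta / 16)%:E)%E.
    by rewrite outerE; [exact: ltW p4|exact: oscillates_measurable].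
  have -> : (eta / 4)%:E = ((eta / 16)%:E + (eta / 16)%:E + ((eta / 16)%:E + (eta / 16)%:E + 0))%E.
    by rewrite adde0 -!EFinD; congr EFin; lra.
  apply: (le_trans (outerU P _ _)); apply: leeD.
    by apply: (le_trans (outerU P _ _)); exact: leeD.
  apply: (le_trans (outerU P _ _)); apply: leeD; last by rewrite Nl0.
  by apply: (le_trans (outerU P _ _)); exact: leeD.
pose s := grid t m i.
have s0 : 0 <= s by exact: grid_ge0.
pose E := SimpleProcess i (grid t m) (fun j w => clip m%:R (be (grid t m j) w)).
have EF : simple_on F s E.
  split => //=; first exact: grid0.
  move=> j ji; split; first exact: grid_le.
    by apply: sub_measurable_comp; [exact: measurable_clip|apply: be_adapted; exact: grid_ge0].
  by exists m%:R => w; apply: clip_le; exact: ler0n.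
have st : s <= t by have /andP[] := grid_in t0 m0 im.
have D0 : 0 < t / m%:R by rewrite divr_gt0// ltr0n.
have cell (f : R -> Omega -> R) w : {within `[0, +oo[, continuous (f ^~ w)} ->
    ~ oscillates f t e m w -> forall j r, (j < m)%N -> grid t m j <= r <= grid t m j.+1 ->
    `|f r w - f (grid t m j) w| <= e.
  move=> cw no j r jm /andP[r1 r2].
  apply: (oscillatesN t0 cw no).
  - have /andP[_ h] := grid_in t0 m0 jm.
    by rewrite (le_trans (grid_ge0 t0 m j) r1) (le_trans r2 h).
  - by apply: grid_in => //; exact: ltnW.
  - rewrite ger0_norm ?subr_ge0//.
    apply: (@le_lt_trans _ _ (t / m%:R * m%:R)); last first.
      by rewrite divfK ?pnatr_eq0 -?lt0n// ltr_pMl// ltr1n.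
    by rewrite ler_wpM2r// lerBlDl -gridS.
pose L := [set w | (2 * c' <= `|simple_integral W E w - M s w|)%R].
have Lle := M_lenglart s0 dl0 c'0 EF.
set LI := [set w | (dl%:E <= _)%E] in Lle.
have good w : ~ Bad w -> [/\ {within `[0, +oo[, continuous (al ^~ w)},
   {within `[0, +oo[, continuous (be ^~ w)},
   D s w = x0 + \int[mu]_(r in `[0, s]) al r w + M s w &
   [/\ forall r, 0 <= r <= t -> `|al r w| <= m%:R, forall r, 0 <= r <= t -> `|be r w| <= m%:R,
    forall j r, (j < m)%N -> grid t m j <= r <= grid t m j.+1 -> `|al r w - al (grid t m j) w| <= e &
    forall j r, (j < m)%N -> grid t m j <= r <= grid t m j.+1 -> `|be r w - be (grid t m j) w| <= e]].
  move=> nB.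
  have /contrapT[ca [cb eD]] : ~ Nl w by move=> h; apply: nB; right; right.
  split => //; first exact: eD.
  split.
  - by apply: exceedsN => // h; apply: nB; left; left.
  - by apply: exceedsN => // h; apply: nB; left; right.
  - by apply: cell => // h; apply: nB; right; left; left.
  - by apply: cell => // h; apply: nB; right; left; right.
have sub1 : [set w | c <= `|clipped_euler m i w - D (grid t m i) w|] `<=` Bad `|` L.
  move=> w /= cw; have [|nB] := pselect (Bad w); first by left.
  have [ca cb eD [ba bb oa ob]] := good w nB.
  right; rewrite /L /=.
  have XE : clipped_euler m i w = x0 + \sum_(j < i) al (grid t m j) w * (t / m%:R) + simple_integral W E w.
    rewrite /clipped_euler /euler big_split/= addrA /simple_integral /=; congr (_ + _ + _).
    apply: eq_bigr => j _; rewrite clip_id//; apply: ba; apply: grid_in => //.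
    by rewrite ltnW// (leq_trans (ltn_ord j)).
  have := riemann_sum t0 m0 ca oa im.
  move: cw; rewrite XE -/s eD.
  set S := \sum_(j < i) _; set I := \int[mu]_(r in _) _; set J := simple_integral W E w.
  have -> : x0 + S + J - (x0 + I + M s w) = - (I - S) + (J - M s w) by ring.
  move=> h1 h2.
  have := le_trans h1 (ler_normD _ _); rewrite normrN.
  have : s * e <= t * e by rewrite ler_wpM2r// ltW.
  rewrite /c' in te minc *; lra.
have sub2 : LI `<=` Bad.
  move=> w /= LIw; apply: contrapT => nB.
  have [ca cb eD [ba bb oa ob]] := good w nB.
  have : (\int[mu]_(r in `[0%R, s]) ((simple_value E r w - be r w) ^+ 2)%:E <= (t * e ^+ 2)%:E)%E.
    apply: (step_sqr_integral t0 m0 (ltW e0) cb) => //; first exact: simple_value_measurable.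
    move=> r rs; have [j ji jr] := grid_cell rs.
    have jm : (j < m)%N by exact: leq_trans im.
    have -> : simple_value E r w = be (grid t m j) w.
      rewrite /simple_value /= (bigD1 (Ordinal ji))//= indic_itvoc jr mulr1.
      rewrite big1 ?addr0; first by rewrite clip_id// bb// grid_in// ltnW.
      move=> k kj; rewrite indic_itvoc; case: ifPn => [/andP[kr1 kr2]|_]; last by rewrite mulr0.
      exfalso; move: kj; rewrite -val_eqE/= neq_ltn => /orP[] lt.
        case/andP: jr => jr1 _; have := le_trans kr2 (grid_le t0 m lt).
        by rewrite leNgt jr1.
      case/andP: jr => _ jr2; have := le_trans jr2 (grid_le t0 m lt).
      by rewrite leNgt kr1.
    case/andP: jr => jr1 jr2; rewrite distrC; apply: ob => //.
    by rewrite (ltW jr1) jr2.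
  apply/negP; rewrite -ltNge; apply: lt_le_trans LIw.
  by rewrite lte_fin; move: mind te te2 dl0; lra.
rewrite -lee_fin -PrE; last exact: clipped_euler_error_measurable.
rewrite -outerE; last exact: clipped_euler_error_measurable.
apply: (le_trans (outer_le P sub1)); apply: (le_trans (outerU P _ _)).
apply: (le_trans (leeD PB Lle)).
have PLI : (Po LI <= (eta / 4)%:E)%E by exact: le_trans (outer_le P sub2) PB.
apply: (le_trans (leeD (lexx _) (leeD PLI (lexx _)))).
rewrite -!EFinD lee_fin.
have -> : kap * dl / c' ^+ 2 = eta / 2.
  by rewrite /dl; field; rewrite !gt_eqF.
lra.
Unshelve. all: by end_near. Qed.

End euler.

(** * The Yamada-Watanabe estimate *)

Lemma lipb_measurable (R : realType) (f : R -> R) : lipb f -> measurable_fun setT f.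
Proof.
move=> [K K0 [_ KL]]; apply: continuous_measurable_fun => x.
apply/cvgrPdist_lt => e e0.
have K1 : 0 < K + 1 by rewrite ltr_wpDl.
near=> y.
have xy : `|x - y| < e / (K + 1).
  by near: y; apply: (nbhsx_ballx x (e / (K + 1))); rewrite divr_gt0.
apply: (le_lt_trans (KL x y)); apply: (@le_lt_trans _ _ ((K + 1) * `|x - y|)).
  by rewrite ler_wpM2r// lerDl.
by rewrite mulrC -ltr_pdivlMr.
Unshelve. all: by end_near. Qed.

(** * One Euler step inside a test function *)

Section ito_step.
Context {R : realType} {d : measure_display} {Omega : measurableType d}.
Variables (P : probability Omega R) (W : R -> {RV P >-> R}).
Hypothesis hW : wiener_process W.
Notation F := (augmented_filtration P W).
Notation Ex := (Ex P).
Notation L1 := (L1 P).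
Variables (G p q : R -> R) (K L : R).
Hypothesis K0 : 0 <= K.
Hypothesis L0 : 0 <= L.
Hypothesis mG : measurable_fun setT G.
Hypothesis mp : measurable_fun setT p.
Hypothesis mq : measurable_fun setT q.
Hypothesis GL : forall x, `|G x| <= L.
Hypothesis pL : forall x, `|p x| <= L.
Hypothesis qL : forall x, 0 <= q x <= L.
Hypothesis taylor : forall x h,
  G (x + h) <= G x + p x * h + q x * (h ^+ 2 / 2) + K * `|h| ^+ 3.

(* The factor 130 in the second-order term is harmless: for the test functions of
   smooth_bounded_abs that term tends to 0. *)
Lemma ito_step (s h N : R) (xi a c : Omega -> R) :
  0 <= s -> 0 <= h <= 1 -> 0 <= N ->
  sub_measurable (F s) xi -> sub_measurable (F s) a -> sub_measurable (F s) c ->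
  (forall w, `|a w| <= N) -> (forall w, `|c w| <= N) ->
  Ex (fun w => G (xi w + (a w * h + c w * (W (s + h) w - W s w)))) <=
  Ex (fun w => G (xi w)) + h * Ex (fun w => p (xi w) * a w + 130 * (q (xi w) * c w ^+ 2)) +
  (L * N ^+ 2 + 524 * K * N ^+ 3) * (h * Num.sqrt h).
Proof.
move=> s0 /andP[h0 h1] N0 mxi ma mc aN cN.
have mxi1 := sub_measurable_measurable mxi.
have ma1 := sub_measurable_measurable ma.
have mc1 := sub_measurable_measurable mc.
have ssh : s <= s + h by rewrite lerDl.
have mpx : sub_measurable (F s) (fun w => p (xi w)) by exact: sub_measurable_comp.
have mqx : sub_measurable (F s) (fun w => q (xi w)) by exact: sub_measurable_comp.
have mc2 : sub_measurable (F s) (fun w => c w ^+ 2).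
  by apply: (@sub_measurable_comp _ _ _ _ _ _ (fun x => x ^+ 2)) => //; exact: measurable_funX.
have mpc : sub_measurable (F s) (fun w => p (xi w) * c w) by exact: sub_measurableM.
have mqc : sub_measurable (F s) (fun w => q (xi w) * c w ^+ 2) by exact: sub_measurableM.
have mpa : sub_measurable (F s) (fun w => p (xi w) * a w) by exact: sub_measurableM.
have c2N w : c w ^+ 2 <= N ^+ 2.
  by rewrite -[leLHS]real_normK ?num_real// ler_sqr ?nnegrE.
have ipc : L1 (fun w => p (xi w) * c w).
  apply: (@L1_bounded _ _ _ _ _ (L * N)); first exact: sub_measurable_measurable mpc.
  by move=> w; rewrite normrM ler_pM.
have ipa : L1 (fun w => p (xi w) * a w).
  apply: (@L1_bounded _ _ _ _ _ (L * N)); first exact: sub_measurable_measurable mpa.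
  by move=> w; rewrite normrM ler_pM.
have qc0 w : 0 <= q (xi w) * c w ^+ 2.
  by case/andP: (qL (xi w)) => q0 _; rewrite mulr_ge0// sqr_ge0.
have iqc : L1 (fun w => q (xi w) * c w ^+ 2).
  apply: (@L1_bounded _ _ _ _ _ (L * N ^+ 2)); first exact: sub_measurable_measurable mqc.
  move=> w; rewrite ger0_norm//; case/andP: (qL (xi w)) => q0 qle.
  by rewrite ler_pM// sqr_ge0.
have [i1 e1] := wiener_mart hW s0 ssh mpc ipc.
have [i2 e2] := @wiener_moment _ _ _ _ _ hW _ _ _ 2 s0 ssh isT mqc iqc qc0.
have C0 : 0 <= 4 * K * N ^+ 3 by rewrite !mulr_ge0// exprn_ge0.
have [i3 e3] := @wiener_moment _ _ _ _ _ hW _ _ (fun=> 4 * K * N ^+ 3) 3 s0 ssh isT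
  (@sub_measurable_cst _ _ _ _ _ _ _) (L1_cst P _) (fun=> C0).
rewrite addrAC subrr add0r in e2 e3.
rewrite sqr_sqrtr// in e2; rewrite Ex_cst in e3.
(* For the increment e = a h + c dW, e^2 / 2 <= (a h)^2 + (c dW)^2 and |e|^3 <= 4 (|a h|^3 + |c
   dW|^3). [B] collects the pure drift parts. The noise part of the cube costs 4 * 130 = 520 through
   the third moment, and 520 + 4 = 524. As h <= 1, everything is absorbed in h sqrt h. *)
pose B := L * N ^+ 2 * h ^+ 2 + 4 * K * N ^+ 3 * h ^+ 3.
have iG (f : Omega -> R) : measurable_fun setT f -> L1 (fun w => G (f w)).
  move=> mf; apply: (@L1_bounded _ _ _ _ _ L); first exact: (measurableT_comp mG).
  by move=> w; exact: GL.
have mW u : measurable_fun setT (W u) by [].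
have mnew : measurable_fun setT (fun w => xi w + (a w * h + c w * (W (s + h) w - W s w))).
  apply: measurable_funD => //; apply: measurable_funD; first exact: measurable_funM.
  by apply: measurable_funM => //; exact: measurable_funB.
pose U w := G (xi w) + h * (p (xi w) * a w) + p (xi w) * c w * (W (s + h) w - W s w) +
  q (xi w) * c w ^+ 2 * `|W (s + h) w - W s w| ^+ 2 +
  4 * K * N ^+ 3 * `|W (s + h) w - W s w| ^+ 3 + B.
have j1 := L1D (iG _ mxi1) (L1Z h ipa).
have j2 := L1D j1 i1.
have j3 := L1D j2 i2.
have j4 := L1D j3 i3.
have iU : L1 U by exact: (L1D j4 (L1_cst P B)).
apply: (@le_trans _ _ (Ex U)).
  apply: Ex_le => //; first exact: iG.
  move=> w; rewrite /U; set x := xi w; set D := W (s + h) w - W s w.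
  set e := a w * h + c w * D.
  apply: (le_trans (taylor x e)).
  have /andP[q0 qle] := qL x.
  have ah : `|a w * h| <= N * h by rewrite normrM (ger0_norm h0) ler_wpM2r.
  have cD : `|c w * D| <= N * `|D| by rewrite normrM ler_wpM2r.
  have sq : q x * (e ^+ 2 / 2) <= L * N ^+ 2 * h ^+ 2 + q x * c w ^+ 2 * `|D| ^+ 2.
    apply: (@le_trans _ _ (q x * ((a w * h) ^+ 2 + (c w * D) ^+ 2))).
      rewrite ler_wpM2l// /e; have := sqr_ge0 (a w * h - c w * D).
      set u := a w * h; set v := c w * D; nra.
    rewrite mulrDr real_normK ?num_real//.
    rewrite (_ : q x * (c w * D) ^+ 2 = q x * c w ^+ 2 * D ^+ 2); last by ring.
    rewrite lerD2r -mulrA.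
    apply: ler_pM; rewrite ?sqr_ge0// -[leLHS]real_normK ?num_real// -exprMn.
    by rewrite ler_sqr ?nnegrE ?mulr_ge0.
  have cub : K * `|e| ^+ 3 <= 4 * K * N ^+ 3 * h ^+ 3 + 4 * K * N ^+ 3 * `|D| ^+ 3.
    have el : `|e| <= N * h + N * `|D|.
      by rewrite (le_trans (ler_normD _ _))// lerD.
    have l3 : `|e| ^+ 3 <= (N * h + N * `|D|) ^+ 3 by rewrite lerXn2r ?nnegrE// addr_ge0// mulr_ge0.
    have u0 : 0 <= N * h by rewrite mulr_ge0.
    have v0 : 0 <= N * `|D| by rewrite mulr_ge0.
    have l4 : (N * h + N * `|D|) ^+ 3 <= 4 * ((N * h) ^+ 3 + (N * `|D|) ^+ 3).
      set u := N * h in u0 *; set v := N * `|D| in v0 *.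
      have : 0 <= (u + v) * (u - v) ^+ 2 by rewrite mulr_ge0 ?addr_ge0 ?sqr_ge0.
      rewrite -subr_ge0 => h3; rewrite -subr_ge0.
      rewrite (_ : _ - _ = 3 * ((u + v) * (u - v) ^+ 2 - 0)); last by ring.
      by rewrite mulr_ge0.
    apply: (le_trans (ler_wpM2l K0 (le_trans l3 l4))).
    by rewrite le_eqVlt; apply/orP; left; apply/eqP; ring.
  have -> : p x * e = h * (p x * a w) + p x * c w * D by rewrite /e; ring.
  rewrite /B; lra.
have -> : Ex U = Ex (fun w => G (xi w)) + h * Ex (fun w => p (xi w) * a w) + 0 +
   Ex (fun w => q (xi w) * c w ^+ 2 * `|W (s + h) w - W s w| ^+ 2) +
   Ex (fun w => 4 * K * N ^+ 3 * `|W (s + h) w - W s w| ^+ 3) + B.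
  rewrite /U (ExD j4 (L1_cst P B)) (ExD j3 i3) (ExD j2 i2) (ExD j1 i1).
  by rewrite (ExD (iG _ mxi1) (L1Z h ipa)) ExZ// e1 Ex_cst.
rewrite (ExD ipa (L1Z 130 iqc)) (ExZ 130 iqc) mulrDr.
set h2 := Num.sqrt h in e3 *.
have h20 : 0 <= h2 by exact: sqrtr_ge0.
have hE : h = h2 * h2 by rewrite -expr2 sqr_sqrtr.
have h21 : h2 <= 1 by rewrite -[leRHS]sqrtr1 ler_wsqrtr.
have e3' : Ex (fun w => 4 * K * N ^+ 3 * `|W (s + h) w - W s w| ^+ 3) <= 520 * K * N ^+ 3 * (h * h2).
  apply: (le_trans e3); rewrite le_eqVlt; apply/orP; left; apply/eqP.
  by rewrite hE; ring.
have B' : B <= (L * N ^+ 2 + 4 * K * N ^+ 3) * (h * h2).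
  have hle : h ^+ 2 <= h * h2 by rewrite expr2 ler_wpM2l// hE ler_piMl.
  have hle3 : h ^+ 3 <= h * h2.
    by rewrite (le_trans _ hle)// exprSr ler_piMr ?sqr_ge0.
  have LN0 : 0 <= L * N ^+ 2 by rewrite mulr_ge0// sqr_ge0.
  have f1 := ler_wpM2l LN0 hle; have f2 := ler_wpM2l C0 hle3.
  by rewrite [leRHS]mulrDl; exact: lerD.
have -> : (L * N ^+ 2 + 524 * K * N ^+ 3) * (h * h2) =
  520 * K * N ^+ 3 * (h * h2) + (L * N ^+ 2 + 4 * K * N ^+ 3) * (h * h2) by ring.
lra.
Qed.

End ito_step.

Lemma aeI (R : realType) (d : measure_display) (Omega : measurableType d)
    (P : probability Omega R) (A B : Omega -> Prop) :
  {ae P, forall w, A w} -> {ae P, forall w, B w} -> {ae P, forall w, A w /\ B w}.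
Proof. by move=> hA hB; exact: filterI. Qed.

Lemma capped_norm_measurable (R : realType) (eta : R) : 0 <= eta ->
  measurable_fun setT (fun x : R => `|x| / (1 + eta * `|x|)).
Proof.
move=> eta0; apply: measurable_funM; first exact: normr_measurable.
apply: lipb_measurable; apply: (lipb_inv_ge1 eta0) => [x|x y].
  by rewrite lerDl mulr_ge0.
rewrite opprD addrACA subrr add0r -mulrBr normrM ger0_norm// ler_wpM2l//.
exact: ler_dist_dist.
Qed.

Section yamada_watanabe.
Context {R : realType} {d : measure_display} {Omega : measurableType d}.
Variables (P : probability Omega R) (W : R -> {RV P >-> R}).
Hypothesis hW : wiener_process W.
Notation F := (augmented_filtration P W).
Notation Po := (mu_ext P).
Notation Ex := (Ex P).
Notation L1 := (L1 P).
Notation mu := (@lebesgue_measure R).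
Variables (x0 : R) (al be M D ga : R -> Omega -> R) (kap la : R).
Hypothesis kap0 : 0 < kap.
Hypothesis al_adapted : adapted F al.
Hypothesis be_adapted : adapted F be.
Hypothesis D_adapted : adapted F D.
Hypothesis al_cont : continuous_paths P al.
Hypothesis be_cont : continuous_paths P be.
Hypothesis M_lenglart : forall (s : R) (e : simple_process) (dl c : R), 0 <= s -> 0 < dl -> 0 < c ->
  simple_on F s e ->
  (Po [set w | (2 * c <= `|simple_integral W e w - M s w|)%R] <=
   Po [set w | dl%:E <= \int[mu]_(r in `[0%R, s])
      (((simple_value e r w - be r w) ^+ 2)%R)%:E] +
   ((kap * dl / c ^+ 2)%R)%:E)%E.
Hypothesis D_eq : {ae P, forall w, forall s : R, 0 <= s ->
  D s w = x0 + \int[mu]_(r in `[0, s]) al r w + M s w}.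

Section stopped_euler.
Variable t : R.
Hypothesis t0 : 0 < t.
Variables (N m : nat).
Hypothesis m0 : (0 < m)%N.
Hypothesis Nm : (N <= m)%N.
Notation g := (grid t m).

Definition bounded_until (j : nat) : set Omega :=
  [set w | forall l, (l <= j)%N -> `|al (g l) w| <= N%:R /\ `|be (g l) w| <= N%:R].

(** After an exceedance the scheme is frozen, so nothing is asked of its distance to [D] from then
    on; before it, the scheme agrees with the clipped one, as N <= m. *)
Definition stopped (f : R -> Omega -> R) (j : nat) (w : Omega) : R :=
  f (g j) w * \1_(bounded_until j) w.

Definition stopped_euler : nat -> Omega -> R := euler W x0 t (stopped al) (stopped be) m.

Lemma bounded_until_measurable j : F (g j) (bounded_until j).
Proof.
have one l : F (g l) [set w | `|al (g l) w| <= N%:R /\ `|be (g l) w| <= N%:R].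
  have mb (f : R -> Omega -> R) : adapted F f -> F (g l) [set w | `|f (g l) w| <= N%:R].
    move=> fF; have := @sub_measurable_comp _ _ _ P W (g l) (@Num.norm R R) (f (g l)) (@normr_measurable _ _) (fF _ (grid_ge0 t0 m l)).
    move=> /(_ `]-oo, N%:R]%classic (measurable_itv _)).
    by rewrite (_ : _ @^-1` _ = [set w | `|f (g l) w| <= N%:R])//; apply/seteqP; split => w /=; rewrite in_itv.
  have m1 : measurable ([set w | `|al (g l) w| <= N%:R] : set (augmented_space W (g l))) by exact: mb.
  have m2 : measurable ([set w | `|be (g l) w| <= N%:R] : set (augmented_space W (g l))) by exact: mb.
  exact: (measurableI _ _ m1 m2).
elim: j => [|j IH].
  rewrite (_ : bounded_until 0 = [set w | `|al (g 0%N) w| <= N%:R /\ `|be (g 0%N) w| <= N%:R])//.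
  apply/seteqP; split => w; first by apply.
  by move=> h l; rewrite leqn0 => /eqP->.
rewrite (_ : bounded_until j.+1 = bounded_until j `&`
   [set w | `|al (g j.+1) w| <= N%:R /\ `|be (g j.+1) w| <= N%:R]); last first.
  apply/seteqP; split => w.
    by move=> h; split; [move=> l lj; apply: h; exact: leqW|exact: h].
  move=> [h1 h2] l; rewrite leq_eqVlt => /predU1P[->//|]; exact: h1.
have m1 : measurable (bounded_until j : set (augmented_space W (g j.+1))).
  by apply: (augmented_filtrationS _ IH); exact: grid_le.
exact: (measurableI _ _ m1 (one j.+1)).
Qed.

Lemma stopped_le (f : R -> Omega -> R) j w :
  (forall w, bounded_until j w -> `|f (g j) w| <= N%:R) -> `|stopped f j w| <= N%:R.
Proof.
move=> h; rewrite /stopped indicE; case: (boolP (_ \in _)) => [|_].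
  by rewrite inE mulr1; exact: h.
by rewrite mulr0 normr0 ler0n.
Qed.

Lemma stopped_adapted (f : R -> Omega -> R) j : adapted F f ->
  sub_measurable (F (g j)) (stopped f j).
Proof.
move=> fF; apply: sub_measurableM; first by apply: fF; exact: grid_ge0.
by apply: sub_measurable_indic; exact: bounded_until_measurable.
Qed.

Lemma stopped_euler_adapted i : sub_measurable (F (g i)) (stopped_euler i).
Proof. by apply: euler_adapted => // j _; exact: stopped_adapted. Qed.

Lemma stopped_euler_clipped i w : (forall j, (j < i)%N -> bounded_until j w) ->
  stopped_euler i w = clipped_euler W x0 al be t m i w.
Proof.
move=> h; congr (_ + _); apply: eq_bigr => j _.
have bj := h _ (ltn_ord j).
have [h1 h2] := bj j (leqnn _).
have NM : N%:R <= m%:R :> R by rewrite ler_nat.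
rewrite /stopped indicE mem_set// !mulr1 !clip_id//.
- exact: le_trans NM.
- exact: le_trans NM.
Qed.

Lemma bounded_untilN_Pr :
  Pr P (~` bounded_until m) <= Pr P (exceeds al t N) + Pr P (exceeds be t N).
Proof.
have mal s : 0 <= s -> measurable_fun setT (al s).
  by move=> s0; apply: (sub_measurable_measurable (P := P) (W := W) (t := s)); exact: al_adapted.
have mbe s : 0 <= s -> measurable_fun setT (be s).
  by move=> s0; apply: (sub_measurable_measurable (P := P) (W := W) (t := s)); exact: be_adapted.
have m1 : measurable (exceeds al t N) by exact: exceeds_measurable.
have m2 : measurable (exceeds be t N) by exact: exceeds_measurable.
have m3 : measurable (bounded_until m).
  exact: (augmented_filtration_measurable (@bounded_until_measurable m)).
pose Nl := [set w | ~ ({within `[0, +oo[, continuous (al ^~ w)} /\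
   {within `[0, +oo[, continuous (be ^~ w)})].
have Nl0 : Po Nl = 0%E.
  by apply: outer_negligible; exact: (@filterI _ (almost_everywhere P) _ _ _ al_cont be_cont).
rewrite -lee_fin EFinD -!PrE//; last exact: measurableC.
rewrite -!outerE//; last exact: measurableC.
have sub : ~` bounded_until m `<=` (exceeds al t N `|` exceeds be t N) `|` Nl.
  move=> w nb; have [|/contrapT[ca cb]] := pselect (Nl w); first by right.
  left; apply: contrapT => /not_orP[h1 h2]; apply: nb => l lm; split.
    by apply: (exceedsN t0 ca h1); exact: grid_in.
  by apply: (exceedsN t0 cb h2); exact: grid_in.
apply: (le_trans (outer_le P sub)); apply: (le_trans (outerU P _ _)).
by rewrite Nl0 adde0; exact: outerU.
Qed.

End stopped_euler.

(** The case t = 0, which the estimate for t > 0 does not reach. Since [M 0] is known only through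
    [M_lenglart], the equality D 0 = x0 almost everywhere is read off from [clipped_euler_close] at
    the first grid point. *)
Lemma integral_norm_start : (\int[P]_w (`|D 0 w|)%:E <= `|x0|%:E)%E.
Proof.
have mD : measurable_fun setT (D 0).
  by apply: (sub_measurable_measurable (P := P) (W := W) (t := 0)); exact: D_adapted.
have mN c : measurable [set w | c <= `|x0 - D 0 w|].
  apply: measurable_ge; apply: (measurableT_comp (@normr_measurable _ setT)).
  exact: measurable_funB.
have small c : 0 < c -> P [set w | c <= `|x0 - D 0 w|] = 0%E.
  move=> c0; rewrite PrE//; congr EFin; apply/eqP; rewrite eq_le Pr_ge0 andbT.
  apply/ler_addgt0Pr => eta eta0; rewrite add0r.
  have [m _ /(_ m (leqnn m) 0%N (leq0n m))] := clipped_euler_close kap0 al_adapted be_adapted D_adapted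
    al_cont be_cont M_lenglart D_eq ltr01 c0 eta0.
  rewrite grid0 (_ : [set w | _] = [set w | c <= `|x0 - D 0 w|])//.
  by apply/seteqP; split => w; rewrite /= /clipped_euler /euler big_ord0 addr0.
have -> : `|x0|%:E = (\int[P]_w (`|x0|)%:E)%E.
  by rewrite (ExE (L1_cst P _)) Ex_cst.
apply: ae_ge0_le_integral => //.
- by apply/measurable_EFinP; exact: (measurableT_comp (@normr_measurable _ setT)).
have : P.-negligible (\bigcup_n [set w | n.+1%:R^-1 <= `|x0 - D 0 w|]).
  apply: negligible_bigcup => n; apply/negligibleP => //; exact: small.
apply: negligibleS => w /= h; apply: contrapT => nw; apply: h => _.
rewrite lee_fin; suff -> : D 0 w = x0 by [].
apply/esym/eqP; rewrite -subr_eq0 -normr_le0 leNgt; apply/negP => d0.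
apply: nw; exists (Num.trunc (`|x0 - D 0 w|^-1)) => //=.
by rewrite -[leRHS]invrK lef_pV2 ?posrE ?invr_gt0// ltW// truncnS_gt.
Qed.

Hypothesis be_le : {ae P, forall w, forall s : R, 0 <= s -> be s w ^+ 2 <= la * `|D s w|}.
Hypothesis al_le : {ae P, forall w, forall s : R, 0 <= s -> al s w * D s w <= ga s w * `|D s w|}.
Hypothesis ga0 : {ae P, forall w, forall s : R, 0 <= s -> 0 <= ga s w}.
Variables (t cc : R).
Hypothesis t0 : 0 < t.
Hypothesis ga_L1 : forall s : R, 0 <= s <= t -> L1 (ga s).
Hypothesis ga_Ex : forall s : R, 0 <= s <= t -> Ex (ga s) <= cc.
Hypothesis la0 : 0 <= la.

Section test_function.
Variables (G p q : R -> R) (K L ep : R).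
Hypothesis K0 : 0 <= K.
Hypothesis L0 : 0 <= L.
Hypothesis ep0 : 0 <= ep.
Hypothesis Gl : (forall x, `|G x| <= L) /\ (forall x y, `|G x - G y| <= L * `|x - y|).
Hypothesis pl : (forall x, `|p x| <= L) /\ (forall x y, `|p x - p y| <= L * `|x - y|).
Hypothesis ql : (forall x, `|q x| <= L) /\ (forall x y, `|q x - q y| <= L * `|x - y|).
Hypothesis p_le : forall x (a g : R), 0 <= g -> a * x <= g * `|x| -> p x * a <= g.
Hypothesis q_le : forall x, 0 <= q x /\ q x * `|x| <= ep.
Hypothesis taylor : forall x h,
  G (x + h) <= G x + p x * h + q x * (h ^+ 2 / 2) + K * `|h| ^+ 3.

Let mlip (f : R -> R) : (forall x, `|f x| <= L) /\ (forall x y, `|f x - f y| <= L * `|x - y|) ->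
  measurable_fun setT f.
Proof. by move=> [h1 h2]; apply: lipb_measurable; exists L. Qed.

Let D_meas s : 0 <= s -> measurable_fun setT (D s).
Proof.
by move=> s0; apply: (sub_measurable_measurable (P := P) (W := W) (t := s)); exact: D_adapted.
Qed.

(** The Lipschitz bound serves for points closer than r, twice the uniform bound otherwise; in
    expectation the indicator becomes a small probability. *)
Let lip_dist (f : R -> R) (r x y : R) :
  (forall x, `|f x| <= L) /\ (forall x y, `|f x - f y| <= L * `|x - y|) ->
  0 <= r -> `|f x - f y| <= L * r + 2 * L * (if r <= `|x - y| then 1 else 0).
Proof.
move=> [h1 h2] r0; case: (leP r `|x - y|) => xy.
  rewrite mulr1 (le_trans (ler_normB _ _))//.
  apply: (le_trans (lerD (h1 x) (h1 y))).
  have := mulr_ge0 L0 r0; lra.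
by rewrite mulr0 addr0 (le_trans (h2 _ _))// ler_wpM2l// ltW.
Qed.

(** [p] and [q] are moved from the scheme to [D] by [lip_dist], with coefficients bounded by N. At
    [D] the structure of the equation applies: p(D) al <= ga, and q(D) be^2 <= la q(D) |D| <= la
    ep. *)
Lemma stopped_euler_drift (N m i : nat) (r eta : R) : (0 < m)%N -> (N <= m)%N -> (i <= m)%N ->
  0 <= r ->
  Pr P [set w | r <= `|clipped_euler W x0 al be t m i w - D (grid t m i) w|] <= eta ->
  Ex (fun w => p (stopped_euler t N m i w) * stopped t N m al i w +
    130 * (q (stopped_euler t N m i w) * stopped t N m be i w ^+ 2)) <=
  cc + 130 * la * ep + (N%:R + 130 * N%:R ^+ 2) * (L * r + 2 * L * eta).
Proof.
move=> m0 Nm im r0 Pe.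
set E := [set w | r <= _] in Pe.
have mE : measurable E by exact: (clipped_euler_error_measurable x0 al_adapted be_adapted D_adapted t0).
have gi := grid_in t0 m0 im.
have gi0 : 0 <= grid t m i by case/andP: gi.
set B := N%:R + 130 * N%:R ^+ 2.
have N0 : 0 <= N%:R :> R by exact: ler0n.
have B0 : 0 <= B by rewrite addr_ge0// mulr_ge0// exprn_ge0.
pose U w := ga (grid t m i) w + (130 * la * ep + B * (L * r)) + (B * (2 * L)) * \1_E w.
have iU : L1 U.
  apply: L1D; first by apply: L1D; [exact: ga_L1|exact: L1_cst].
  by apply: L1Z; exact: L1_indic.
have aN w : `|stopped t N m al i w| <= N%:R.
  by apply: stopped_le => // w' h; have [] := h i (leqnn _).
have bN w : `|stopped t N m be i w| <= N%:R.
  by apply: stopped_le => // w' h; have [] := h i (leqnn _).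
have mX := sub_measurable_measurable (@stopped_euler_adapted t t0 N m i).
have ma := sub_measurable_measurable (@stopped_adapted t t0 N m al i al_adapted).
have mb := sub_measurable_measurable (@stopped_adapted t t0 N m be i be_adapted).
apply: (@le_trans _ _ (Ex U)); last first.
  rewrite /U ExD; [|by apply: L1D; [exact: ga_L1|exact: L1_cst]|by apply: L1Z; exact: L1_indic].
  rewrite ExD; [|exact: ga_L1|exact: L1_cst].
  rewrite ExZ ?Ex_cst ?Ex_indic//; last exact: L1_indic.
  have := ga_Ex gi.
  have : B * (2 * L) * Pr P E <= B * (2 * L) * eta by rewrite ler_wpM2l// mulr_ge0// mulr_ge0.
  rewrite mulrDr !mulrA; lra.
apply: Ex_ae_le => //.
  apply: (@L1_bounded _ _ _ _ _ (L * N%:R + 130 * (L * N%:R ^+ 2))).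
    apply: measurable_funD.
      by apply: measurable_funM => //; apply: (measurableT_comp (mlip pl)).
    apply: measurable_funM => //; apply: measurable_funM; last exact: measurable_funX.
    exact: (measurableT_comp (mlip ql)).
  move=> w; rewrite (le_trans (ler_normD _ _))// lerD//.
    by rewrite normrM ler_pM//; case: pl.
  rewrite normrM ger0_norm// ler_wpM2l// normrM normrX ler_pM//; first by case: ql.
  by rewrite ler_sqr ?nnegrE.
have good : {ae P, forall w, be (grid t m i) w ^+ 2 <= la * `|D (grid t m i) w| /\
  (al (grid t m i) w * D (grid t m i) w <= ga (grid t m i) w * `|D (grid t m i) w| /\
   0 <= ga (grid t m i) w)}.
  apply: filterS (aeI be_le (aeI al_le ga0)) => w [h1 [h2 h3]].
  by split; [exact: h1|split; [exact: h2|exact: h3]].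
apply: filterS good => w [hb [ha hg]].
rewrite /U indicE (_ : (w \in E) = (r <= `|clipped_euler W x0 al be t m i w - D (grid t m i) w|)); last first.
  by apply/idP/idP; rewrite inE.
(* Once stopped, both coefficients vanish and it is enough that the majorant is nonnegative. *)
have [ok|nok] := pselect (bounded_until t N m i w); last first.
  rewrite /stopped indicE memNset// !mulr0 expr0n/= !mulr0 addr0.
  rewrite addr_ge0//; last by rewrite !mulr_ge0.
  by rewrite addr_ge0// addr_ge0 ?mulr_ge0.
have -> : stopped_euler t N m i w = clipped_euler W x0 al be t m i w.
  by apply: stopped_euler_clipped => // j ji l lj; apply: ok; rewrite (leq_trans lj)// ltnW.
have [aok bok] := ok i (leqnn _).
rewrite /stopped indicE mem_set// !mulr1.
set X := clipped_euler _ _ _ _ _ _ _ _; set Dw := D _ w in hb ha *.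
set A := al _ w in ha aok *; set Bw := be _ w in hb bok *.
have dp := lip_dist X Dw pl r0; have dq := lip_dist X Dw ql r0.
have -> : ((r <= `|X - Dw|)%R)%:R = (if r <= `|X - Dw| then 1 else 0) :> R by case: ifP.
set I := (if _ then _ else _) in dp dq *.
set V := L * r + 2 * L * I in dp dq.
have V0 : 0 <= V by rewrite (le_trans _ dp).
have h1 : p X * A <= ga (grid t m i) w + V * N%:R.
  have -> : p X * A = p Dw * A + (p X - p Dw) * A by ring.
  apply: lerD; first exact: p_le.
  by rewrite (le_trans (ler_norm _))// normrM ler_pM.
have h2 : q X * Bw ^+ 2 <= la * ep + V * N%:R ^+ 2.
  have -> : q X * Bw ^+ 2 = q Dw * Bw ^+ 2 + (q X - q Dw) * Bw ^+ 2 by ring.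
  apply: lerD.
    have [q0 qep] := q_le Dw.
    apply: (le_trans (ler_wpM2l q0 hb)); rewrite mulrCA ler_wpM2l//.
  rewrite (le_trans (ler_norm _))// normrM normrX ler_pM// ?sqr_ge0//.
  by rewrite ler_sqr ?nnegrE.
rewrite (_ : _ + _ + _ = ga (grid t m i) w + V * N%:R + 130 * (la * ep + V * N%:R ^+ 2)); last first.
  by rewrite /V /B; ring.
by apply: lerD => //; rewrite ler_pM2l.
Qed.

(** m Euler steps of length h = t / m accumulate a remainder C t sqrt h, where [C] depends on N but
    not on m. The scheme is compared with [D] only at the final time and inside the drift terms. *)
Lemma test_function_bound :
  Ex (fun w => G (D t w)) <= G x0 + t * (cc + 130 * la * ep).
Proof.
apply/ler_addgt0Pr => z z0.
have L1p : 0 < L + 1 by rewrite ltr_wpDl.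
(* The choices of [z1], [r] and [y] keep the errors below z / 4 for stopping, 3 z / 8 for the
   distance to [D] and z / 4 for the Taylor remainder. *)
pose z1 := z / (16 * (L + 1)).
have z10 : 0 < z1 by rewrite divr_gt0// mulr_gt0.
have mal s : 0 <= s -> measurable_fun setT (al s).
  by move=> s0; apply: (sub_measurable_measurable (P := P) (W := W) (t := s)); exact: al_adapted.
have mbe s : 0 <= s -> measurable_fun setT (be s).
  by move=> s0; apply: (sub_measurable_measurable (P := P) (W := W) (t := s)); exact: be_adapted.
have n1 := cvg0_lt z10 (exceeds_cvg t0 mal al_cont).
have n2 := cvg0_lt z10 (exceeds_cvg t0 mbe be_cont).
have [N [N1 N2]] : exists N, Pr P (exceeds al t N) <= z1 /\ Pr P (exceeds be t N) <= z1.
  have m1 k : measurable (exceeds al t k) by exact: exceeds_measurable.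
  have m2 k : measurable (exceeds be t k) by exact: exceeds_measurable.
  near \oo => N; exists N; rewrite -!lee_fin -!PrE//.
  by split; apply: ltW; near: N.
pose B := N%:R + 130 * N%:R ^+ 2 : R.
have N0 : 0 <= N%:R :> R by exact: ler0n.
have B0 : 0 <= B by rewrite addr_ge0// mulr_ge0// exprn_ge0.
(* The distance r is paid with weight t B in the accumulated drift and once more at the final time,
   hence the 1. *)
pose A1 := t * B + 1.
have A10 : 1 <= A1 by rewrite lerDr mulr_ge0// ltW.
have A1p : 0 < A1 by exact: lt_le_trans A10.
pose r := z / (8 * A1 * (L + 1)).
have r0 : 0 < r by rewrite divr_gt0// !mulr_gt0.
pose C := L * N%:R ^+ 2 + 524 * K * N%:R ^+ 3.
have C0 : 0 <= C by rewrite addr_ge0// !mulr_ge0// exprn_ge0.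
have Ct1 : 0 < C * t + 1 by rewrite ltr_wpDl// mulr_ge0// ltW.
pose y := z / (4 * (C * t + 1)).
have y0 : 0 < y by rewrite divr_gt0// mulr_gt0.
have cl := clipped_euler_close kap0 al_adapted be_adapted D_adapted al_cont be_cont
  M_lenglart D_eq t0 r0 r0.
have [m [m0 Nm m1 my clm]] : exists m : nat, [/\ (0 < m)%N, (N <= m)%N, t / m%:R <= 1,
    Num.sqrt (t / m%:R) <= y &
    forall i, (i <= m)%N -> Pr P [set w | r <= `|clipped_euler W x0 al be t m i w - D (grid t m i) w|] <= r].
  near \oo => m; exists m.
  have m0 : (0 < m)%N by near: m; exact: nbhs_infty_gt.
  have mR : 0 < m%:R :> R by rewrite ltr0n.
  split => //.
  - by near: m; exact: nbhs_infty_ge.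
  - by rewrite ler_pdivrMr// mul1r; near: m; exact: nbhs_infty_ger.
  - rewrite -[leRHS]gtr0_norm// -sqrtr_sqr ler_wsqrtr// ler_pdivrMr// mulrC -ler_pdivrMr ?exprn_gt0//.
    by near: m; exact: nbhs_infty_ger.
  - by near: m.
pose h := t / m%:R.
have h0 : 0 <= h by rewrite divr_ge0// ltW.
pose A := cc + 130 * la * ep + B * (L * r + 2 * L * r).
pose X := stopped_euler t N m.
have aN i w : `|stopped t N m al i w| <= N%:R.
  by apply: stopped_le => // w' h'; have [] := h' i (leqnn _).
have bN i w : `|stopped t N m be i w| <= N%:R.
  by apply: stopped_le => // w' h'; have [] := h' i (leqnn _).
have step i : (i <= m)%N ->
    Ex (fun w => G (X i w)) <= G x0 + i%:R * (h * A + C * (h * Num.sqrt h)).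
  elim: i => [_|i IH im].
    rewrite mul0r addr0 -[leRHS](Ex_cst P) le_eqVlt; apply/orP; left; apply/eqP.
    congr (Ex _); apply/funext => w.
    by rewrite /X /stopped_euler /euler big_ord0 addr0.
  have im' := ltnW im.
  have q0L x : 0 <= q x <= L.
    by have [-> _] := q_le x; rewrite (le_trans (ler_norm _))//; case: ql.
  have h01 : 0 <= h <= 1 by rewrite h0.
  have := @ito_step _ _ _ P W hW G p q K L K0 L0 (mlip Gl) (mlip pl) (mlip ql)
    (proj1 Gl) (proj1 pl) q0L taylor (grid t m i) h N%:R (X i)
    (stopped t N m al i) (stopped t N m be i) (grid_ge0 t0 m i) h01 N0
    (@stopped_euler_adapted t t0 N m i) (@stopped_adapted t t0 N m al i al_adapted)
    (@stopped_adapted t t0 N m be i be_adapted) (aN i) (bN i).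
  rewrite -gridS -/C => st.
  have -> : (fun w => G (X i.+1 w)) = (fun w => G (X i w + (stopped t N m al i w * h +
     stopped t N m be i w * (W (grid t m i.+1) w - W (grid t m i) w)))).
    by apply/funext => w; rewrite /X /stopped_euler eulerS.
  apply: (le_trans st).
  have dr := @stopped_euler_drift N m i r r m0 Nm im' (ltW r0) (clm i im').
  have := IH im'; have := ler_wpM2l h0 dr; rewrite -/A -natr1; lra.
have := step m (leqnn m).
have mR : m%:R != 0 :> R by rewrite pnatr_eq0 -lt0n.
have -> : m%:R * (h * A + C * (h * Num.sqrt h)) = t * A + C * t * Num.sqrt h.
  by rewrite /h; field.
move=> stm.
pose E := [set w | r <= `|clipped_euler W x0 al be t m m w - D (grid t m m) w|].
have mE : measurable E by exact: (clipped_euler_error_measurable x0 al_adapted be_adapted D_adapted t0).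
have mnb : measurable (~` bounded_until t N m m).
  by apply: measurableC; exact: (augmented_filtration_measurable (@bounded_until_measurable t t0 N m m)).
have iGf (f : Omega -> R) : measurable_fun setT f -> L1 (fun w => G (f w)).
  move=> mf; apply: (@L1_bounded _ _ _ _ _ L); first exact: (measurableT_comp (mlip Gl)).
  by move=> w; case: Gl.
have iX : L1 (fun w => G (X m w)).
  by apply: iGf; exact: (sub_measurable_measurable (@stopped_euler_adapted t t0 N m m)).
have i1 := L1D iX (L1_cst P (L * r)).
have i2 := L1D i1 (L1Z (2 * L) (L1_indic P mE)).
have i3 := L1D i2 (L1Z (2 * L) (L1_indic P mnb)).
have : Ex (fun w => G (D t w)) <= Ex (fun w => G (X m w) + L * r + 2 * L * \1_E w +
    2 * L * \1_(~` bounded_until t N m m) w).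
  apply: Ex_le => //; first by apply: iGf; apply: D_meas; exact: ltW.
  move=> w; rewrite -{1}(gridm t m0).
  have [ok|nok] := pselect (bounded_until t N m m w); last first.
    rewrite [\1_(~` _) w]indicE mem_set// mulr1.
    have : `|G (D (grid t m m) w) - G (X m w)| <= 2 * L.
      have [gb _] := Gl; rewrite (le_trans (ler_normB _ _))//.
      by apply: (le_trans (lerD (gb _) (gb _))); lra.
    have i01 : 0 <= \1_E w :> R by rewrite indicE.
    have := mulr_ge0 L0 (ltW r0); have := mulr_ge0 L0 i01.
    by move=> ? ? /ler_normlP[]; lra.
  have -> : X m w = clipped_euler W x0 al be t m m w.
    by apply: stopped_euler_clipped => // j jm l lj; apply: ok; rewrite (leq_trans lj)// ltnW.
  rewrite [\1_(~` _) w]indicE memNset; last by move=> /(_ ok).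
  rewrite mulr0 addr0.
  have := lip_dist (clipped_euler W x0 al be t m m w) (D (grid t m m) w) Gl (ltW r0).
  have -> : (if r <= `|clipped_euler W x0 al be t m m w - D (grid t m m) w| then 1 else 0) = \1_E w :> R.
    rewrite indicE (_ : (w \in E) = (r <= `|clipped_euler W x0 al be t m m w - D (grid t m m) w|)).
      by case: ifP.
    by apply/idP/idP; rewrite inE.
  by move=> /ler_normlP[]; lra.
rewrite (ExD i2 (L1Z (2 * L) (L1_indic P mnb))) (ExD i1 (L1Z (2 * L) (L1_indic P mE))).
rewrite (ExD iX (L1_cst P (L * r))) Ex_cst.
rewrite (ExZ _ (L1_indic P mE)) (ExZ _ (L1_indic P mnb)) !Ex_indic//.
move=> H.
have PE : 2 * L * Pr P E <= 2 * L * r by rewrite ler_wpM2l ?mulr_ge0//; exact: clm.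
have Pnb : 2 * L * Pr P (~` bounded_until t N m m) <= 2 * L * (2 * z1).
  rewrite ler_wpM2l ?mulr_ge0//.
  have := @bounded_untilN_Pr t t0 N m m0; lra.
have Lz : 2 * L * (2 * z1) <= z / 4.
  rewrite /z1 [leLHS](_ : _ = z / 4 * (L / (L + 1))); last by field; rewrite gt_eqF.
  by rewrite ler_piMr ?divr_ge0 ?(ltW z0)// ler_pdivrMr// mul1r lerDl.
have Lr : 3 * (L * r) * A1 <= 3 / 8 * z.
  rewrite /r [leLHS](_ : _ = 3 / 8 * z * (L / (L + 1))); last by field; rewrite !gt_eqF.
  by rewrite ler_piMr ?mulr_ge0 ?(ltW z0)// ler_pdivrMr// mul1r lerDl.
have Cy : C * t * Num.sqrt h <= z / 4.
  apply: (@le_trans _ _ (C * t * y)); first by rewrite ler_wpM2l// mulr_ge0// ltW.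
  rewrite /y [leLHS](_ : _ = z / 4 * (C * t / (C * t + 1))); last by field; rewrite gt_eqF.
  by rewrite ler_piMr ?divr_ge0 ?(ltW z0)// ler_pdivrMr// mul1r lerDl.
have tA : t * A = t * (cc + 130 * la * ep) + 3 * (L * r) * (A1 - 1) by rewrite /A /A1; ring.
lra.
Unshelve. all: by end_near. Qed.

End test_function.

Lemma integral_capped_norm_le (eta : R) : 0 < eta ->
  Ex (fun w => `|D t w| / (1 + eta * `|D t w|)) <= `|x0| + t * cc.
Proof.
move=> eta0; apply/ler_addgt0Pr => z z0.
(* G x0 exceeds |x0| by at most [ep] and the second-order term adds 130 t la ep; in total ep y =
   z. *)
pose y := 1 + t * (130 * la).
have y0 : 0 < y by rewrite ltr_wpDr// !mulr_ge0// ltW.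
pose ep := z / y.
have ep0 : 0 < ep by rewrite divr_gt0.
have [G [p [q [K K0 [Gx px qx [[L1' L10 [Gb Gl]] [[L2 L20 [pb pl]] [L3 L30 [qb ql]]]] taylor]]]]] :=
  smooth_bounded_abs ep0 eta0.
pose L := L1' + L2 + L3.
have weaken (f : R -> R) (L' : R) : L' <= L ->
    (forall x, `|f x| <= L') -> (forall x y, `|f x - f y| <= L' * `|x - y|) ->
    (forall x, `|f x| <= L) /\ (forall x y, `|f x - f y| <= L * `|x - y|).
  move=> LL h1 h2; split=> [x|x x']; first exact: le_trans LL.
  by rewrite (le_trans (h2 x x'))// ler_wpM2r.
have l1 : L1' <= L by rewrite /L; lra.
have l2 : L2 <= L by rewrite /L; lra.
have l3 : L3 <= L by rewrite /L; lra.
have L0 : 0 <= L by rewrite /L; lra.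
have := test_function_bound K0 L0 (ltW ep0) (weaken _ _ l1 Gb Gl) (weaken _ _ l2 pb pl)
  (weaken _ _ l3 qb ql) px qx taylor.
have mD : measurable_fun setT (D t).
  by apply: (sub_measurable_measurable (P := P) (W := W) (t := t)); apply: D_adapted; exact: ltW.
have mnD : measurable_fun setT (fun w => `|D t w|).
  exact: (measurableT_comp (@normr_measurable _ setT)).
have iG : L1 (fun w => G (D t w)).
  apply: (@L1_bounded _ _ _ _ _ L1'); last by move=> w; exact: Gb.
  by apply: measurableT_comp => //; apply: lipb_measurable; exists L1'.
have d0 w : 0 < 1 + eta * `|D t w| by rewrite ltr_pwDl// mulr_ge0// ltW.
have Hle : Ex (fun w => `|D t w| / (1 + eta * `|D t w|)) <= Ex (fun w => G (D t w)).
  apply: Ex_le => //; last by move=> w; have /andP[] := Gx (D t w).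
  apply: (L1_le _ iG) => [|w]; last first.
    by rewrite ger0_norm ?divr_ge0 ?(ltW (d0 w))//; have /andP[] := Gx (D t w).
  exact: (measurableT_comp (capped_norm_measurable (ltW eta0))).
have /andP[_ G0] := Gx x0.
have epy : ep * y = z by rewrite /ep divfK// gt_eqF.
rewrite /y in epy; lra.
Qed.

(** Integrability of [D t] is part of the conclusion: the capped norms with eta = 1 / (n + 1)
    increase to |D t|, and the uniform bound passes to the limit by monotone convergence. *)
Lemma yamada_watanabe : (\int[P]_w (`|D t w|)%:E <= (`|x0| + t * cc)%:E)%E.
Proof.
have mD : measurable_fun setT (D t).
  by apply: (sub_measurable_measurable (P := P) (W := W) (t := t)); apply: D_adapted; exact: ltW.
have mnD : measurable_fun setT (fun w => `|D t w|).
  exact: (measurableT_comp (@normr_measurable _ setT)).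
pose f (n : nat) w : R := `|D t w| / (1 + n.+1%:R^-1 * `|D t w|).
have n0 n : 0 < n.+1%:R^-1 :> R by rewrite invr_gt0.
have d1 n w : 1 <= 1 + n.+1%:R^-1 * `|D t w| by rewrite lerDl mulr_ge0// ltW.
have d0 n w : 0 < 1 + n.+1%:R^-1 * `|D t w| by exact: lt_le_trans (d1 n w).
have f0 n w : 0 <= f n w by rewrite divr_ge0// ltW.
have mf n : measurable_fun setT (f n).
  exact: (measurableT_comp (capped_norm_measurable (ltW (n0 n)))).
have fn n w : f n w <= n.+1%:R.
  rewrite ler_pdivrMr// mulrDr mulr1 mulrA divff ?mul1r ?pnatr_eq0//.
  by rewrite lerDr.
have fcvg w : (f n w)%:E @[n --> \oo] --> `|D t w|%:E.
  apply: cvg_EFin; first exact: nearW.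
  apply/cvgrPdist_le => e e0; near=> n.
  rewrite /f; set x := `|D t w|; have x0' : 0 <= x by exact: normr_ge0.
  set b : R := n.+1%:R^-1; have b0 : 0 < b by exact: n0.
  have dx : 0 < 1 + b * x by exact: (d0 n w).
  have -> : x - x / (1 + b * x) = b * x ^+ 2 / (1 + b * x) by field; rewrite gt_eqF.
  rewrite ger0_norm; last by rewrite divr_ge0 ?(ltW dx)// mulr_ge0 ?(ltW b0)// sqr_ge0.
  apply: (@le_trans _ _ (b * x ^+ 2)).
    rewrite ler_pdivrMr// ler_peMr; [by []|by rewrite mulr_ge0 ?(ltW b0)// sqr_ge0|].
    exact: (d1 n w).
  rewrite /b mulrC ler_pdivrMr// mulrC -ler_pdivrMr//.
  apply: (@le_trans _ _ n%:R); last by rewrite ler_nat.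
  by near: n; exact: nbhs_infty_ger.
have fmono w n m : (n <= m)%N -> f n w <= f m w.
  move=> nm; rewrite /f ler_wpM2l// lef_pV2 ?posrE// lerD2l ler_wpM2r//.
  by rewrite lef_pV2 ?posrE// ler_nat.
have -> : (\int[P]_w (`|D t w|)%:E = \int[P]_w (limn (fun n => (f n w)%:E)))%E.
  by apply: eq_integral => w _; apply/esym/cvg_lim.
rewrite monotone_convergence//.
- apply: lime_le.
    apply: ereal_nondecreasing_is_cvgn => n m nm; apply: ge0_le_integral => //.
    + by move=> w _; rewrite lee_fin.
    + exact/measurable_EFinP.
    + exact/measurable_EFinP.
    + by move=> w _; rewrite lee_fin; exact: fmono.
  apply: nearW => n; rewrite ExE; first by rewrite lee_fin; exact: integral_capped_norm_le.
  by apply: (@L1_bounded _ _ _ _ _ n.+1%:R) => // w; rewrite ger0_norm.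
- by move=> n; exact/measurable_EFinP.
- by move=> n w _; rewrite lee_fin.
- by move=> w _ n m nm; rewrite lee_fin; exact: fmono.
Unshelve. all: by end_near. Qed.

End yamada_watanabe.

(** * Squared Bessel and Cox-Ingersoll-Ross processes *)

Section cox_ingersoll_ross.
Context {R : realType} {d : measure_display} {Omega : measurableType d}.
Variables (P : probability Omega R) (W : R -> {RV P >-> R}).
Hypothesis hW : wiener_process W.
Notation F := (augmented_filtration P W).
Notation Po := (mu_ext P).
Notation mu := (@lebesgue_measure R).
Variables (y0 a sigma : R).
Hypothesis y00 : 0 < y0.
Hypothesis a0 : 0 < a.

(** [lenglart_ito] brought to the shape of [M_lenglart], with kap = 130 * 9. *)
Lemma lenglart_ito_process (a1 a2 : R) (H1 H2 I1 I2 : R -> Omega -> R) :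
  ito_integral_process W H1 I1 -> ito_integral_process W H2 I2 ->
  forall (s : R) (e : simple_process) (dl c : R), 0 <= s -> 0 < dl -> 0 < c ->
  simple_on F s e ->
  (Po [set w | (2 * c <= `|simple_integral W e w - (a1 * I1 s w + a2 * I2 s w)|)%R] <=
   Po [set w | dl%:E <= \int[mu]_(r in `[0%R, s])
      (((simple_value e r w - (a1 * H1 r w + a2 * H2 r w)) ^+ 2)%R)%:E] +
   ((130 * 9 * dl / c ^+ 2)%R)%:E)%E.
Proof.
move=> [_ _ h1] [_ _ h2] s e dl c s0 dl0 c0 eF.
rewrite -[130 * 9 * dl]mulrA.
exact: (lenglart_ito hW a1 a2 s0 dl0 c0 (h1 s s0) (h2 s s0) eF).
Qed.

Lemma sqrt_path_continuous (f : R -> R) : {within `[0, +oo[, continuous f} ->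
  {within `[0, +oo[, continuous (fun s => Num.sqrt (f s))}.
Proof.
move=> cf x; apply: continuous_comp; first exact: cf.
exact: sqrt_continuous.
Qed.

Lemma lincomb_path_continuous (c1 c2 : R) (f g : R -> R) :
  {within `[0, +oo[, continuous f} -> {within `[0, +oo[, continuous g} ->
  {within `[0, +oo[, continuous (fun s => c1 * f s + c2 * g s)}.
Proof.
move=> cf cg x; apply: cvgD; apply: cvgM; do ?exact: cvg_cst; [exact: cf|exact: cg].
Qed.

Variables (Y : R -> Omega -> R).
Hypothesis hY : nonneg_strong_solution W y0 sigma (fun t _ => a * t) Y.

(** The single noise is fitted to the two-integral form by a second integral of weight 0, and be^2 =
    sigma^2 Y gives la = sigma^2. The bound supplies the integrability and the mean of [ga] in
    [cir_distance]. *)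
Lemma squared_bessel_mean (t : R) : 0 <= t -> (\int[P]_w (`|Y t w|)%:E <= (y0 + t * a)%:E)%E.
Proof.
have [aY cY pY [I hI eqI]] := hY.
have k0 : 0 < 130 * 9 :> R by rewrite mulr_gt0.
have aad : adapted F (fun _ _ => a) by move=> s s0; exact: sub_measurable_cst.
have bad : adapted F (fun s w => sigma * Num.sqrt (Y s w) + 0 * Num.sqrt (Y s w)).
  move=> s s0; apply: sub_measurableD; apply: sub_measurableM; do ?exact: sub_measurable_cst.
    by apply: sub_measurable_comp (aY s s0); apply: continuous_measurable_fun; exact: sqrt_continuous.
  by apply: sub_measurable_comp (aY s s0); apply: continuous_measurable_fun; exact: sqrt_continuous.
have ca : continuous_paths P (fun (_ : R) (_ : Omega) => a).
  by apply: aeW => w; exact: cst_continuous.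
have cb : continuous_paths P (fun s w => sigma * Num.sqrt (Y s w) + 0 * Num.sqrt (Y s w)).
  by apply: filterS cY => w cw; apply: lincomb_path_continuous; exact: sqrt_path_continuous.
have L := @lenglart_ito_process sigma 0 _ _ _ _ hI hI.
have eqD : {ae P, forall w, forall s : R, 0 <= s ->
   Y s w = y0 + \int[mu]_(r in `[0, s]) a + (sigma * I s w + 0 * I s w)}.
  apply: filterS eqI => w h s s0; rewrite h// mul0r addr0; congr (_ + _ + _).
  rewrite Rintegral_cst//= lebesgue_measure_itv/= lte_fin.
  case: ltP => // s0'; first by rewrite /= subr0.
  by have -> : s = 0; [apply/eqP; rewrite eq_le s0' s0|rewrite !mulr0].
rewrite le_eqVlt => /predU1P[<-|t0].
  rewrite mul0r addr0 -[X in X%:E]gtr0_norm//.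
  exact: (integral_norm_start k0 aad bad aY ca cb L eqD).
have bl : {ae P, forall w, forall s : R, 0 <= s ->
    (sigma * Num.sqrt (Y s w) + 0 * Num.sqrt (Y s w)) ^+ 2 <= sigma ^+ 2 * `|Y s w|}.
  apply: filterS pY => w h s s0; rewrite mul0r addr0 exprMn sqr_sqrtr; last exact: h.
  by rewrite ler_wpM2l ?sqr_ge0// ler_norm.
have al : {ae P, forall w, forall s : R, 0 <= s -> a * Y s w <= a * `|Y s w|}.
  by apply: aeW => w s _; rewrite ler_wpM2l ?(ltW a0)// ler_norm.
have ag : {ae P, forall w : Omega, forall s : R, 0 <= s -> 0 <= a}.
  by apply: aeW => w s _; exact: ltW.
have := @yamada_watanabe _ _ _ _ _ hW y0 _ _ _ _ (fun _ _ => a) _ (sigma ^+ 2) k0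
  aad bad aY ca cb L eqD bl al ag t a t0 (fun s _ => L1_cst P a).
rewrite (gtr0_norm y00); apply; last exact: sqr_ge0.
by move=> s _; rewrite Ex_cst.
Qed.

Variables (b : R) (Z : R -> Omega -> R).
Hypothesis b0 : 0 <= b.
Hypothesis hZ : nonneg_strong_solution W y0 sigma
  (fun t w => \int[mu]_(s in `[0, t]) (a - b * Z s w)) Z.

(** Starting points and the constant drift a cancel in the difference, leaving x0 = 0 and the drift
    - b Z; the weights sigma and - sigma combine the two noises. *)
Lemma cir_distance (t : R) : 0 <= t ->
  (\int[P]_w (`|Z t w - Y t w|)%:E <= (t * (b * (y0 + t * a)))%:E)%E.
Proof.
have [aY cY pY [I hI eqI]] := hY.
have [aZ cZ pZ [J hJ eqJ]] := hZ.
have k0 : 0 < 130 * 9 :> R by rewrite mulr_gt0.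
pose al s w := - b * Z s w.
pose be s w := sigma * Num.sqrt (Z s w) + (- sigma) * Num.sqrt (Y s w).
pose D s w := Z s w - Y s w.
have aal : adapted F al.
  by move=> s s0; apply: sub_measurableM; [exact: sub_measurable_cst|exact: aZ].
have msqrt : measurable_fun setT (@Num.sqrt R).
  by apply: continuous_measurable_fun; exact: sqrt_continuous.
have abe : adapted F be.
  move=> s s0; apply: sub_measurableD; apply: sub_measurableM; do ?exact: sub_measurable_cst.
    exact: sub_measurable_comp (aZ s s0).
  exact: sub_measurable_comp (aY s s0).
have aD : adapted F D by move=> s s0; apply: sub_measurableB; [exact: aZ|exact: aY].
have cal : continuous_paths P al.
  apply: filterS cZ => w cw; rewrite /al.
  rewrite (_ : (fun s => _) = (fun s => - b * Z s w + 0 * Z s w)).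
    exact: lincomb_path_continuous.
  by apply/funext => s; rewrite mul0r addr0.
have cbe : continuous_paths P be.
  apply: filterS (aeI cZ cY) => w [cw1 cw2].
  by apply: lincomb_path_continuous; exact: sqrt_path_continuous.
have L := @lenglart_ito_process sigma (- sigma) _ _ _ _ hJ hI.
have eqD : {ae P, forall w, forall s : R, 0 <= s ->
   D s w = 0 + \int[mu]_(r in `[0, s]) al r w + (sigma * J s w + (- sigma) * I s w)}.
  apply: filterS (aeI (aeI eqI eqJ) cal) => w [[h1 h2] cw] s s0.
  rewrite /D h1// h2//.
  have mD : measurable (`[0, s]%classic : set (measurableTypeR R)) by exact: measurable_itv.
  have i1 : mu.-integrable `[0, s] (EFin \o (fun r => al r w)).
    exact: continuous_path_integrable.
  have i2 : mu.-integrable `[0, s] (EFin \o (fun r : R => a)).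
    apply: continuous_path_integrable => //.
    by apply: continuous_subspaceT => x; exact: cst_continuous.
  have -> : \int[mu]_(r in `[0, s]) (a - b * Z r w) = \int[mu]_(r in `[0, s]) (a + al r w).
    by apply: eq_Rintegral => r _; rewrite /al mulNr.
  rewrite RintegralD// Rintegral_cst//.
  have -> : fine (mu `[0, s]%classic) = s.
    rewrite lebesgue_measure_itv/= lte_fin; case: ltP => // s0'; first by rewrite /= subr0.
    by apply/eqP; rewrite eq_sym eq_le s0' s0.
  ring.
have bl : {ae P, forall w, forall s : R, 0 <= s -> be s w ^+ 2 <= sigma ^+ 2 * `|D s w|}.
  apply: filterS (aeI pZ pY) => w [h1 h2] s s0; rewrite /be /D.
  have := h1 s s0; have := h2 s s0; set y := Y s w; set z := Z s w => y1 z1.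
  have -> : (sigma * Num.sqrt z + - sigma * Num.sqrt y) ^+ 2 =
     sigma ^+ 2 * (Num.sqrt z - Num.sqrt y) ^+ 2 by ring.
  rewrite ler_wpM2l ?sqr_ge0//.
  have sy := sqrtr_ge0 y; have sz := sqrtr_ge0 z.
  (* z - y = (sqrt z - sqrt y)(sqrt z + sqrt y), and the second factor dominates |sqrt z - sqrt
     y|. *)
  rewrite -{2}(sqr_sqrtr z1) -{2}(sqr_sqrtr y1) subr_sqr normrM.
  rewrite -[leLHS]real_normK ?num_real// expr2 ler_wpM2l//.
  rewrite (le_trans (ler_normB _ _))// !ger0_norm// ?addr_ge0//.
pose ga s w := b * `|Y s w|.
have all : {ae P, forall w, forall s : R, 0 <= s -> al s w * D s w <= ga s w * `|D s w|}.
  apply: filterS (aeI pZ pY) => w [h1 h2] s s0; rewrite /al /D /ga.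
  have := h1 s s0; have := h2 s s0; set y := Y s w; set z := Z s w => y1 z1.
  rewrite -mulrA mulNr -mulrN -mulrA ler_wpM2l// (ger0_norm y1).
  (* For y <= z the left side is nonpositive; for z < y it is z (y - z) <= y (y - z). *)
  case: (leP y z) => yz.
    rewrite ger0_norm ?subr_ge0//; apply: (@le_trans _ _ 0).
      by rewrite oppr_le0 mulr_ge0// subr_ge0.
    by rewrite mulr_ge0// subr_ge0.
  by rewrite ltr0_norm ?subr_lt0// -mulrN ler_wpM2r// ?oppr_ge0 ?subr_le0 ltW.
have gag : {ae P, forall w : Omega, forall s : R, 0 <= s -> 0 <= ga s w}.
  by apply: aeW => w s _; rewrite mulr_ge0.
rewrite le_eqVlt => /predU1P[<-|t0].
  rewrite mul0r -[X in X%:E](@normr0 _ R).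
  exact: (integral_norm_start k0 aal abe aD cal cbe L eqD).
have iY (s : R) : 0 <= s -> L1 P (fun w => `|Y s w|).
  move=> s0; apply/integrableP; split.
    apply/measurable_EFinP; apply: (measurableT_comp (@normr_measurable _ setT)).
    apply: (sub_measurable_measurable (P := P) (W := W) (t := s)); exact: aY.
  under eq_integral do rewrite /= normr_id.
  by apply: (le_lt_trans (squared_bessel_mean s0)); rewrite ltry.
have gaL (s : R) : 0 <= s <= t -> L1 P (ga s).
  by move=> /andP[s0 _]; apply: L1Z; exact: iY.
have gaE (s : R) : 0 <= s <= t -> Ex P (ga s) <= b * (y0 + t * a).
  move=> /andP[s0 st]; rewrite /ga (ExZ _ (iY s s0)) ler_wpM2l// -lee_fin -(ExE (iY s s0)).
  apply: (le_trans (squared_bessel_mean s0)).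
  by rewrite lee_fin lerD2l ler_wpM2r// ltW.
have := @yamada_watanabe _ _ _ _ _ hW 0 _ _ _ _ ga _ (sigma ^+ 2) k0
  aal abe aD cal cbe L eqD bl all gag t _ t0 gaL gaE (sqr_ge0 _).
by rewrite normr0 add0r.
Qed.

End cox_ingersoll_ross.

Theorem corollary4p5 (R : realType) (d : measure_display)
  (Omega : measurableType d) (P : probability Omega R)
  (W : R -> {RV P >-> R}) (hW : wiener_process W)
  (y0 a sigma : R) (hy0 : 0 < y0) (ha : 0 < a) (hsigma : 0 < sigma)
  (hFeller : sigma ^+ 2 <= 2 * a)
  (Y : R -> Omega -> R)
  (hY : nonneg_strong_solution W y0 sigma (fun t _ => a * t) Y)
  (b : nat -> R) (hb0 : forall n, 0 <= b n)
  (hbdec : forall m n, (m <= n)%N -> b n <= b m)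
  (hblim : b @ \oo --> (0 : R))
  (Yn : nat -> R -> Omega -> R)
  (hYn : forall n, nonneg_strong_solution W y0 sigma
     (fun t w => \int[lebesgue_measure]_(s in `[0, t]) (a - b n * Yn n s w))
     (Yn n))
  (T : nat -> R) (hT0 : forall n, 0 < T n)
  (hTlim : T @ \oo --> +oo)
  (hbT : (fun n => expR (b n * T n) * b n * T n ^+ 2) @ \oo --> (0 : R)) :
  (fun n => ereal_sup
     [set 'E_P[fun w => `|Yn n t w - Y t w|%R]%E | t in `[0, T n]])
    @ \oo --> 0%E.
Proof.
pose B n := T n * (b n * (y0 + T n * a)).
have bound n t : `[0, T n]%classic t -> ('E_P[fun w => `|Yn n t w - Y t w|%R] <= (B n)%:E)%E.
  move=> /=; rewrite in_itv/= => /andP[t0 tT].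
  rewrite unlock.
  apply: (le_trans (cir_distance hW hy0 ha hY (hb0 n) (hYn n) t0)).
  rewrite lee_fin ler_pM// ?mulr_ge0 ?addr_ge0 ?ler_wpM2l ?lerD2l ?ler_wpM2r ?mulr_ge0 ?(ltW hy0) ?(ltW ha)//.
have cB : (fun n => ((y0 + a) * (expR (b n * T n) * b n * T n ^+ 2))%:E) @ \oo --> 0%E.
  apply: cvg_EFin; first exact: nearW.
  by rewrite -(mulr0 (y0 + a)); apply: cvgMr.
apply: (squeeze_cvge _ (cvg_cst 0%E) cB).
have := hTlim; move/cvgryPge => /(_ 1); apply: filterS => n T1.
apply/andP; split.
  (* Time 0 belongs to the index set, so the supremum is nonnegative; over an empty set it would be
     -oo. *)
  apply: (@le_trans _ _ ('E_P[fun w => `|Yn n 0 w - Y 0 w|%R])%E).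
    by rewrite unlock; apply: integral_ge0 => w _; rewrite lee_fin.
  by apply: ereal_sup_ubound; exists 0 => //=; rewrite in_itv/= lexx (ltW (hT0 n)).
apply: ge_ereal_sup => _ [t tT <-].
apply: (le_trans (bound n t tT)); rewrite lee_fin /B.
(* As the exponential is at least 1, b T^2 is dominated by the sequence assumed to vanish. *)
have e1 : 1 <= expR (b n * T n) by rewrite -expR0 ler_expR mulr_ge0// ltW.
have : b n * T n ^+ 2 <= expR (b n * T n) * (b n * T n ^+ 2).
  by rewrite ler_peMl// mulr_ge0 ?sqr_ge0.
rewrite -mulrA => /(ler_wpM2l (addr_ge0 (ltW hy0) (ltW ha))); apply: le_trans.
(* The explicit factor 1 is then replaced by T n >= 1, which makes y0 + a a common factor of b
   T^2. *)
have -> : T n * (b n * (y0 + T n * a)) = b n * T n * (y0 * 1 + T n * a) by ring.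
have -> : (y0 + a) * (b n * T n ^+ 2) = b n * T n * (y0 * T n + T n * a) by ring.
by rewrite ler_wpM2l ?mulr_ge0 ?(ltW (hT0 n))// lerD2r ler_wpM2l ?(ltW hy0).
Qed.
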